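(* Let $1<p,q<\infty$, $0\le\alpha<n$, $1/q=1/p-\alpha/n$, $m\in\mathbb{Z}^+$ and $\omega\in A_{p,q}$. Let $\Omega$ be a bounded measurable real-valued function on $\mathbb{S}^{n-1}$ (extended to $\mathbb{R}^n\setminus\{0\}$ as a homogeneous function of degree zero, and of mean value zero on $\mathbb{S}^{n-1}$ when $\alpha=0$) which does not change sign and is not equivalent to zero on some open subset of $\mathbb{S}^{n-1}$. Let $b$ be a locally integrable function on $\mathbb{R}^n$, assumed real-valued if $m\ge 2$. If the iterated commutator $(T_{\Omega,\alpha})_b^m$ is a compact operator from $L^p(\omega^p)$ to $L^q(\omega^q)$, then $b\in \mathrm{CMO}(\mathbb{R}^n)$.
   Context: Functions are complex-valued unless stated otherwise, and cubes $Q\subset\mathbb{R}^n$ have sides parallel to the axes. $\mathrm{BMO}(\mathbb{R}^n)$ is the space of $f\in L^1_{loc}(\mathbb{R}^n)$ with $\|f\|_{\mathrm{BMO}}:=\sup_Q \frac1{|Q|}\int_Q|f(x)-f_Q|\,dx<\infty$, where $f_Q=\frac1{|Q|}\int_Q f$. $\mathrm{CMO}(\mathbb{R}^n)$ is the closure of $C_c^\infty(\mathbb{R}^n)$ in the $\mathrm{BMO}(\mathbb{R}^n)$ topology. Weights: for $1<p,q<\infty$ with $1/q=1/p-\alpha/n$, $0\le\alpha<n$, a weight $\omega$ belongs to $A_{p,q}$ if $$[\omega]_{A_{p,q}}^{1/q}:=\sup_Q\Big(\frac1{|Q|}\int_Q\omega^q\,dx\Big)^{1/q}\Big(\frac1{|Q|}\int_Q\omega^{-p'}\,dx\Big)^{1/p'}<\infty,\qquad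 \frac1p+\frac1{p'}=1.$$ $L^p(\omega^p)$ is the weighted space with norm $(\int|f|^p\omega^p\,dx)^{1/p}$, and similarly for $L^q(\omega^q)$. Operator: $T_{\Omega,\alpha}f(x)=\int_{\mathbb{R}^n}\frac{\Omega(x-y)}{|x-y|^{n-\alpha}}f(y)\,dy$, understood in the usual singular integral (principal value) sense when $\alpha=0$, in which case $\int_{\mathbb{S}^{n-1}}\Omega\,d\sigma=0$ is assumed. Commutators: for suitable functions $f$, $T_b^1f=[b,T]f:=b\,T(f)-T(bf)$, and $T_b^m:=[b,T_b^{m-1}]$ for $m\ge2$. In particular, for $x\notin\operatorname{supp} f$, $(T_{\Omega,\alpha})_b^mf(x)=\int_{\mathbb{R}^n}(b(x)-b(y))^m\frac{\Omega(x-y)}{|x-y|^{n-\alpha}}f(y)\,dy$. ''Does not change sign and is not equivalent to zero on some open subset'' means: there is an open $U\subset\mathbb{S}^{n-1}$ such that $\Omega$ has constant sign ($\ge0$ or $\le0$) on $U$ and $\Omega$ is not a.e. zero on $U$. *)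

(* Defs.v *)
From HB Require Import structures.
From mathcomp Require Import all_boot all_order all_algebra.
From mathcomp Require Import all_classical all_reals all_analysis.
From mathcomp Require Import measurable_realfun complex.

Set Implicit Arguments.
Unset Strict Implicit.
Unset Printing Implicit Defensive.

Import Order.TTheory GRing.Theory Num.Theory.
Import numFieldNormedType.Exports.
Import ComplexField.Normc.

Local Open Scope classical_set_scope.
Local Open Scope ring_scope.

(* R^n is ['rV[R]_n]. Its library topology is the usual one, but its library
   norm is the sup norm, hence the separate Euclidean norm [enorm] below. The
   library has no measurable structure on this type. *)

Section measurable_rV.
Context {R : realType} {n : nat}.

Let coor (i : 'I_n) (x : 'rV[R]_n) : R := x ord0 i.

Let rV_set0 : g_sigma_preimage coor set0.
Proof. exact: sigma_algebra0. Qed.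

Let rV_setC A : g_sigma_preimage coor A -> g_sigma_preimage coor (~` A).
Proof. exact: sigma_algebraC. Qed.

Let rV_bigcup (F : (set 'rV[R]_n)^nat) :
  (forall i, g_sigma_preimage coor (F i)) ->
  g_sigma_preimage coor (\bigcup_i (F i)).
Proof. exact: sigma_algebra_bigcup. Qed.

(* The product sigma-algebra, which coincides with the Borel sets. *)
HB.instance Definition _ :=
  @isMeasurable.Build (measure_tuple_display default_measure_display)
    'rV[R]_n (g_sigma_preimage coor) rV_set0 rV_setC rV_bigcup.

Lemma measurable_coord (i : 'I_n) :
  measurable_fun [set: 'rV[R]_n] (fun x => x ord0 i).
Proof.
move=> _ Y mY; rewrite setTI; apply: sub_sigma_algebra => /=.
rewrite -bigcup_seq/=; exists i => /=; first by rewrite mem_index_enum.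
by exists Y => //; rewrite setTI.
Qed.

Lemma measurable_fun_rVP d (T : measurableType d) (f : T -> 'rV[R]_n) :
  measurable_fun [set: T] f <->
  forall i, measurable_fun [set: T] (fun x => f x ord0 i).
Proof.
split=> [mf i|mf].
  exact: (measurableT_comp (measurable_coord i) mf).
move=> _ A; rewrite setTI => mA; move: A mA.
suff: g_sigma_preimage (fun i => coor i \o f) `<=` measurable.
  rewrite g_sigma_preimage_comp => H A mA; apply: H.
  by exists A => //; rewrite setTI.
apply: smallest_sub; first exact: sigma_algebra_measurable.
rewrite -bigcup_seq => A [i _ [B mB <-]].
exact: mf.
Qed.

End measurable_rV.

Section image_measure.
Local Open Scope ereal_scope.
Context d d' (T1 : measurableType d) (T2 : measurableType d') (R : realType).
Variables (m : {measure set T1 -> \bar R}) (f : T1 -> T2).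
Hypothesis mf : measurable_fun [set: T1] f.

(* [pushforward] with the measurability proof as an argument, so that the
   measure structure can be inferred. *)
Definition image_measure of measurable_fun [set: T1] f : set T2 -> \bar R :=
  pushforward m f.

Let image_measure0 : image_measure mf set0 = 0.
Proof. exact: (measure0 (Measure.clone _ _ _ (pushforward m f) _)). Qed.

Let image_measure_ge0 A : 0 <= image_measure mf A.
Proof. exact: (measure_ge0 (Measure.clone _ _ _ (pushforward m f) _)). Qed.

Let image_measure_sigma_additive : semi_sigma_additive (image_measure mf).
Proof.
exact: (@measure_semi_sigma_additive _ _ _
  (Measure.clone _ _ _ (pushforward m f) _)).
Qed.

HB.instance Definition _ := isMeasure.Build _ _ _ (image_measure mf)
  image_measure0 image_measure_ge0 image_measure_sigma_additive.

End image_measure.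

Section lebesgue_rV.
Context {R : realType}.

Definition rV_cons n (p : measurableTypeR R * 'rV[R]_n) : 'rV[R]_n.+1 :=
  \row_i oapp (fun j => p.2 ord0 j) p.1 (unlift ord0 i).

Definition rV_uncons n (x : 'rV[R]_n.+1) : measurableTypeR R * 'rV[R]_n :=
  (x ord0 ord0, \row_j x ord0 (lift ord0 j)).

Lemma rV_unconsK n : cancel (@rV_uncons n) (@rV_cons n).
Proof.
move=> x; apply/rowP => i; rewrite mxE /=.
by case: unliftP => [j ->|->] /=; rewrite ?mxE.
Qed.

Lemma rV_consK n : cancel (@rV_cons n) (@rV_uncons n).
Proof.
move=> [t x]; rewrite /rV_uncons mxE unlift_none /=; congr pair.
by apply/rowP => j; rewrite !mxE liftK.
Qed.

Lemma measurable_rV_cons n : measurable_fun setT (@rV_cons n).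
Proof.
apply/measurable_fun_rVP => i.
case: (unliftP ord0 i) => [j ->|->].
  rewrite (_ : (fun _ => _) = (fun x : 'rV[R]_n => x ord0 j) \o snd).
    by apply: measurableT_comp => //; exact: measurable_coord.
  by apply/funext => p /=; rewrite mxE liftK.
rewrite (_ : (fun _ => _) = fst); first exact: measurable_fst.
by apply/funext => p /=; rewrite mxE unlift_none.
Qed.

Lemma measurable_rV_uncons n : measurable_fun setT (@rV_uncons n).
Proof.
apply: measurable_fun_pair; first exact: measurable_coord.
apply/measurable_fun_rVP => i.
rewrite (_ : (fun _ => _) = (fun x : 'rV[R]_n.+1 => x ord0 (lift ord0 i))).
  exact: measurable_coord.
by apply/funext => p /=; rewrite mxE.
Qed.

Section step.
Variables (n : nat) (mu : {sigma_finite_measure set 'rV[R]_n -> \bar R}).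

Definition lebesgue_rV_step : set 'rV[R]_n.+1 -> \bar R :=
  image_measure [the {measure set _ -> \bar R} of (lebesgue_measure \x mu)%E]
    (@measurable_rV_cons n).

HB.instance Definition _ := Measure.on lebesgue_rV_step.

Let lebesgue_rV_step_sigma_finite : sigma_finite setT lebesgue_rV_step.
Proof.
have [F TF Foo] : sigma_finite setT (lebesgue_measure \x mu)%E.
  have /sigma_finiteP[G [TG ndG Goo]] :=
    sigma_finiteT (@lebesgue_measure R : {sigma_finite_measure set _ -> \bar R}).
  have /sigma_finiteP[H [TH ndH Hoo]] := sigma_finiteT mu.
  exists (fun k => G k `*` H k).
    rewrite -setXTT TG TH predeqE => -[x y]; split.
      move=> [/= [k _ Gkx] [l _ Hly]]; exists (maxn k l) => //; split.
      - by move: x Gkx; exact/subsetPset/ndG/leq_maxl.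
      - by move: y Hly; exact/subsetPset/ndH/leq_maxr.
    by move=> [k _ []/= ? ?]; split; exists k.
  move=> k; have [? ?] := Goo k; have [? ?] := Hoo k.
  split; first exact: measurableX.
  by rewrite product_measure1E// lte_mul_pinfty// ge0_fin_numE.
exists (fun k => @rV_uncons n @^-1` F k).
  by rewrite -preimage_bigcup -TF preimage_setT.
move=> k; have [mF Fk] := Foo k; split.
  by rewrite -[X in measurable X]setTI; exact: measurable_rV_uncons.
rewrite /lebesgue_rV_step /image_measure /pushforward -comp_preimage.
rewrite (_ : _ \o _ = id) ?preimage_id//.
by apply/funext => p /=; exact: rV_consK.
Qed.

HB.instance Definition _ := Measure_isSigmaFinite.Build _ _ _
  lebesgue_rV_step lebesgue_rV_step_sigma_finite.

End step.

Fixpoint Leb n : {sigma_finite_measure set 'rV[R]_n -> \bar R} :=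
  if n is n'.+1 then
    [the {sigma_finite_measure set _ -> \bar R} of lebesgue_rV_step (Leb n')]
  else [the {sigma_finite_measure set _ -> \bar R} of \d_(0 : 'rV[R]_0)].

End lebesgue_rV.
Arguments Leb {R}.

Section sphere.
Context {R : realType} (n : nat).
Implicit Types x : 'rV[R]_n.

Definition enorm x : R := Num.sqrt (\sum_i x ord0 i ^+ 2).

Definition sphere : set 'rV[R]_n := [set x | enorm x = 1].

Definition direction x : 'rV[R]_n := (enorm x)^-1 *: x.

Definition punctured_ball : set 'rV[R]_n := [set x | 0 < enorm x <= 1].

Lemma measurable_enorm : measurable_fun setT enorm.
Proof.
apply: (@measurableT_comp _ _ _ _ _ _ (@Num.sqrt R)).
  by apply: continuous_measurable_fun; exact: sqrt_continuous.
by apply: measurable_sum => i; apply: measurable_funX; exact: measurable_coord.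
Qed.

Lemma measurable_direction : measurable_fun setT direction.
Proof.
apply/measurable_fun_rVP => i.
rewrite (_ : (fun _ => _) = (fun x => enorm x `^ (-1) * x ord0 i)).
  apply: measurable_funM; last exact: measurable_coord.
  by apply: (@measurableT_comp _ _ _ _ _ _ (fun t : R => t `^ (-1))) => //;
    exact: measurable_enorm.
by apply/funext => x; rewrite mxE powR_inv1// sqrtr_ge0.
Qed.

Lemma measurable_punctured_ball : measurable punctured_ball.
Proof.
rewrite (_ : punctured_ball = setT `&` enorm @^-1` `]0, 1]%classic).
  exact: measurable_enorm.
by rewrite setTI; apply/seteqP; split => x /=; rewrite in_itv.
Qed.

Definition Leb_punctured_ball : {measure set 'rV[R]_n -> \bar R} :=
  mrestr (Leb n) measurable_punctured_ball.

Definition Leb_direction : {measure set 'rV[R]_n -> \bar R} :=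
  image_measure Leb_punctured_ball measurable_direction.

(* The surface measure of a Borel set A of the sphere is n times the Lebesgue
   measure of the cone {r *: a | 0 < r <= 1, a in A}. *)
Definition surface_measure : {measure set 'rV[R]_n -> \bar R} :=
  mscale (NngNum (ler0n R n)) Leb_direction.

End sphere.
Arguments sphere {R}.
Arguments surface_measure {R}.

(* The library only integrates real and extended real functions, so complex
   functions are treated componentwise. *)

Section complex_functions.
Context {R : realType} {n : nat}.
Local Notation Rn := 'rV[R]_n.
Implicit Types (f g b : Rn -> R[i]) (Q : set Rn).

Definition cmeasurable f :=
  measurable_fun setT (fun x => complex.Re (f x)) /\
  measurable_fun setT (fun x => complex.Im (f x)).

Definition cintegral Q f : R[i] :=
  (\int[Leb n]_(x in Q) complex.Re (f x) +i*
   \int[Leb n]_(x in Q) complex.Im (f x))%C.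

Definition clim0 (u : R -> R[i]) : R[i] :=
  (lim (complex.Re (u e) @[e --> 0^'+]) +i*
   lim (complex.Im (u e) @[e --> 0^'+]))%C.

Definition L1loc f := cmeasurable f /\
  forall K, compact K -> (\int[Leb n]_(x in K) (normc (f x))%:E < +oo)%E.

Definition csupport f : set Rn := closure [set x | f x != 0].

Definition cubes : set (set Rn) :=
  [set Q | exists (a : Rn) (l : R), 0 < l /\
    Q = [set x : Rn | forall i, a ord0 i <= x ord0 i <= a ord0 i + l]].

Definition mean Q (h : Rn -> \bar R) : \bar R :=
  (((fine (Leb n Q))^-1)%:E * \int[Leb n]_(x in Q) h x)%E.

Definition cmean Q f : R[i] := ((fine (Leb n Q))^-1)%:C%C * cintegral Q f.

Definition bmo_norm f : \bar R :=
  ereal_sup [set mean Q (fun x => (normc (f x - cmean Q f))%:E) | Q in cubes].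

Definition BMO f := L1loc f /\ (bmo_norm f < +oo)%E.

Definition partial (i : 'I_n) (h : Rn -> R) : Rn -> R :=
  'D_(delta_mx ord0 i) h.

Definition iter_partial (s : seq 'I_n) (h : Rn -> R) : Rn -> R :=
  foldr partial h s.

Definition smooth (h : Rn -> R) := forall s : seq 'I_n,
  continuous (iter_partial s h) /\
  forall i x, derivable (iter_partial s h) x (delta_mx ord0 i).

Definition Cc_infty f :=
  [/\ smooth (fun x => complex.Re (f x)),
      smooth (fun x => complex.Im (f x)) & compact (csupport f)].

Definition CMO f := BMO f /\
  forall e : R, 0 < e -> exists phi, Cc_infty phi /\
    (bmo_norm (fun x => f x - phi x)%R < e%:E)%E.

Definition weight (w : Rn -> R) :=
  [/\ L1loc (fun x => (w x)%:C%C), (forall x, 0 <= w x) &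
      {ae Leb n, forall x, 0 < w x}].

Definition conjugate_exponent (p : R) : R := (1 - p^-1)^-1.

Definition Apq_sup (p q : R) (w : Rn -> R) : \bar R :=
  let p' := conjugate_exponent p in
  ereal_sup [set (mean Q (fun x => (w x `^ q)%:E) `^ q^-1 *
                  mean Q (fun x => (w x `^ (- p'))%:E) `^ p'^-1)%E | Q in cubes].

Definition Apq (p q : R) (w : Rn -> R) :=
  weight w /\ (Apq_sup p q w < +oo)%E.

Definition wLp_norm (p : R) (w : Rn -> R) f : \bar R :=
  ((\int[Leb n]_x (normc (f x) `^ p * w x `^ p)%:E) `^ p^-1)%E.

Definition wLp (p : R) (w : Rn -> R) f :=
  cmeasurable f /\ (wLp_norm p w f < +oo)%E.

Definition rough_kernel (Omega : Rn -> R) (alpha : R) (x : Rn) : R :=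
  Omega x / (enorm x `^ (n%:R - alpha)).

Definition T_op (Omega : Rn -> R) (alpha : R) f : Rn -> R[i] := fun x =>
  let integrand y := (rough_kernel Omega alpha (x - y))%:C%C * f y in
  if alpha == 0 then
    clim0 (fun e => cintegral [set y | e < enorm (x - y)] integrand)
  else cintegral setT integrand.

Definition commutator b (T : (Rn -> R[i]) -> Rn -> R[i]) f : Rn -> R[i] :=
  fun x => b x * T f x - T (fun y => b y * f y) x.

Definition iter_commutator (m : nat) b (T : (Rn -> R[i]) -> Rn -> R[i]) :
    (Rn -> R[i]) -> Rn -> R[i] :=
  iter m (commutator b) T.

(* The functions f to which the recursive definition of the m-th commutator is
   applied: f, b f, ..., b^m f are bounded with compact support, so that every
   term T (b^k f) of the expansion is classically defined (by an absolutely
   convergent integral if alpha > 0, by a principal value existing almost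
   everywhere if alpha = 0) although b is only locally integrable. For w in
   A_{p,q} these functions are dense in L^p(w^p). *)
Definition suitable (m : nat) b f :=
  [/\ cmeasurable f, compact (csupport f) &
      exists M : R, forall k, (k <= m)%N -> forall x, normc (b x ^+ k * f x) <= M].

(* Elements of the weighted spaces are represented by functions, so S acts on
   functions and is required to respect almost everywhere equality; its values
   outside L^p(w^p) are irrelevant. *)
Definition compact_operator (p q : R) (w : Rn -> R)
    (S : (Rn -> R[i]) -> Rn -> R[i]) :=
  [/\ forall f, wLp p w f -> wLp q w (S f),
      forall f g, wLp p w f -> wLp p w g ->
        {ae Leb n, forall x, f x = g x} -> {ae Leb n, forall x, S f x = S g x},
      forall (c : R[i]) f g, wLp p w f -> wLp p w g ->
        {ae Leb n, forall x, S (fun y => c * f y + g y) x = c * S f x + S g x} &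
      forall u : nat -> Rn -> R[i], (forall k, wLp p w (u k)) ->
        (exists M : R, forall k, (wLp_norm p w (u k) <= M%:E)%E) ->
        exists (j : nat -> nat) (g : Rn -> R[i]),
          [/\ {homo j : k l / (k < l)%N}, wLp q w g &
              wLp_norm q w (fun x => S (u (j k)) x - g x) @[k --> \oo] --> 0%E]].

(* The commutator is given on the dense class of suitable functions; as an
   operator on L^p(w^p) it is its (necessarily unique) continuous extension. *)
Definition iter_commutator_compact (p q : R) (w : Rn -> R) (m : nat) b
    (T : (Rn -> R[i]) -> Rn -> R[i]) :=
  exists S, compact_operator p q w S /\
    forall f, suitable m b f ->
      {ae Leb n, forall x, S f x = iter_commutator m b T f x}.

Definition homogeneous0 (Omega : Rn -> R) :=
  forall (t : R) (x : Rn), 0 < t -> x != 0 -> Omega (t *: x) = Omega x.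

Definition bounded_on_sphere (Omega : Rn -> R) :=
  exists M : R, forall x, sphere n x -> `|Omega x| <= M.

Definition constant_sign_on_open (Omega : Rn -> R) :=
  exists V : set Rn, let U := V `&` sphere n in
    [/\ open V,
        (forall x, U x -> 0 <= Omega x) \/ (forall x, U x -> Omega x <= 0) &
        ~ {ae surface_measure n, forall x, U x -> Omega x = 0}].

End complex_functions.

(* Main.v *)
(* Let [beta] be the real or the imaginary part of b. Suppose that [beta] oscillates
   by e on a cube Q of side l, that is, the integral of |beta - M| over Q exceeds
   e l^n for every M. Since Omega has constant sign and is not negligible on an
   open part of the sphere, there is a fixed vector v such that, for x in Q and y
   in P = Q - l v, the kernel has constant sign and, off a small set, size at
   least a multiple of l^(alpha - n). Let M be a median of [beta] on P. Testing
   the commutator on multiples of indicators of halves of P, where beta - M has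
   constant sign, gives values of size at least a multiple of l^alpha |beta - M|^m
   on a part of Q, and with the A_{p,q} condition an image whose norm is bounded
   below in terms of e alone; moreover a set of small measure may be removed from
   P beforehand. Were there such cubes of arbitrarily small side, or far away,
   removals would produce normalised functions f_k with disjoint supports and
   images bounded below. A compact operator admits no such sequence: along a
   subsequence the images are close to a fixed nonzero function, so that those of
   N^(-1/p) (f_1 + ... + f_N), which are bounded in norm, grow like N^(1 - 1/p).

   So [beta] oscillates little on small cubes and on cubes not contained in a
   large ball. Cutting [beta] off at infinity and averaging the result against a
   smooth partition of unity subordinate to a fine lattice of cubes gives smooth
   functions with compact support close to [beta] in BMO. *)
Require Import Defs.
From HB Require Import structures.
From mathcomp Require Import all_boot all_order all_algebra.
From mathcomp Require Import all_classical all_reals all_analysis.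
From mathcomp Require Import measurable_realfun complex.
From mathcomp Require Import ring lra.
Set Implicit Arguments.
Unset Strict Implicit.
Unset Printing Implicit Defensive.

Import Order.TTheory GRing.Theory Num.Theory.
Import numFieldNormedType.Exports.
Import ComplexField.Normc.

Local Open Scope classical_set_scope.
Local Open Scope ring_scope.

(** * Lebesgue measure, cubes and density points *)

(** Of the half of P on which beta - M has the right sign, 1/16 of P may be removed to separate
    supports, 1/16 is lost where |b| is large and, for each x, 1/16 where the kernel is small; at
    least a quarter of P is left. Cutting off large values of |b| is forced by b being only locally
    integrable: the commutator is given on [suitable] functions.

    The weight enters through a single cube containing both P and Q. Since p <= q, hence q' <= p',
    power means pass from the A_{p,q} bounds on w^q and w^(-p') to bounds on w^p and w^(-q'). The
    powers of l cancel because 1/p + 1/q' = 1 + alpha/n.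

    The sign argument needs real numbers: for m = 1 the commutator is linear in b, and its real and
    imaginary parts are tested one at a time.

    Oscillation is measured against an arbitrary constant, which medians, chains of cubes or local
    approximants supply. The obstacle to cutting off is logarithmic: the constants of a cube of side
    l and of a large cube of side about r may differ by a multiple of log(r / l), which the
    variation l / r of the cut-off on the small cube absorbs. *)

Section lebesgue_affine.
Context {R : realType}.
Local Notation mu := (@lebesgue_measure R).

Lemma measurable_affine (c s : R) : measurable_fun setT (fun t : R => c + s * t).
Proof.
apply: measurable_funD => //; exact: measurable_funM.
Qed.

(** [nu] and [mu] agree on half-open intervals, which determine Lebesgue measure. For s < 0 the
    preimage of []a, b]] is closed on the left instead, without change of length. *)
Lemma lebesgue_measure_affine (c s : R) (A : set R) : s != 0 -> measurable A ->
  mu ((fun t => c + s * t) @^-1` A) = (`|s|^-1%:E * mu A)%E.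
Proof.
move=> s0 mA; pose T t := c + s * t.
have mT : measurable_fun [set: measurableTypeR R] (T : _ -> measurableTypeR R).
  exact: measurable_affine.
pose nu := mscale (NngNum (normr_ge0 s)) (image_measure mu mT).
have H : forall X, ocitv X -> mu X = nu X.
  move=> _ [[a b] _ <-]; rewrite /nu /mscale /image_measure /pushforward /=.
  have [sp|sn|/eqP] := ltgtP 0 s; last by rewrite eq_sym (negbTE s0).
    have -> : T @^-1` `]a, b] = `](a - c) / s, (b - c) / s]%classic.
      apply/seteqP; split => t /=; rewrite !in_itv /= /T ltr_pdivrMr// ler_pdivlMr//;
        by rewrite ltrBlDl lerBrDl (mulrC t).
    rewrite !lebesgue_measure_itv /= !lte_fin ltr_pM2r ?invr_gt0// ltrD2r.
    case: ifP => ab; last by rewrite mule0.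
    by rewrite gtr0_norm// -!EFinB -EFinM; congr EFin; field.
  have -> : T @^-1` `]a, b] = `[(b - c) / s, (a - c) / s[%classic.
    apply/seteqP; split => t /=; rewrite !in_itv /= /T ltr_ndivlMr// ler_ndivrMr//;
      by rewrite ltrBlDl lerBrDl (mulrC t) andbC.
  rewrite !lebesgue_measure_itv /= !lte_fin ltr_nM2r ?invr_lt0// ltrD2r.
  case: ifP => ab; last by rewrite mule0.
  by rewrite ltr0_norm// -!EFinB -EFinM; congr EFin; field.
have -> : mu A = nu A by apply: lebesgue_measure_unique.
rewrite /nu /mscale /image_measure /pushforward /= muleA -EFinM mulVf ?mul1e//.
by rewrite normr_eq0.
Qed.

End lebesgue_affine.

Section Leb.
Context {R : realType}.

Definition cube n (a : 'rV[R]_n) (l : R) : set 'rV[R]_n :=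
  [set x | forall i, a ord0 i <= x ord0 i <= a ord0 i + l].

Lemma LebS n (A : set 'rV[R]_n.+1) :
  Leb n.+1 A = (lebesgue_measure \x Leb n)%E (@rV_cons R n @^-1` A).
Proof. by []. Qed.

Lemma measurable_halfl n (i : 'I_n) (t : R) :
  measurable [set x : 'rV[R]_n | t <= x ord0 i].
Proof.
rewrite (_ : mkset _ = setT `&` (fun x : 'rV[R]_n => x ord0 i) @^-1` `[t, +oo[%classic).
  by apply: measurable_coord.
by apply/seteqP; split => x /=; rewrite in_itv/= andbT//; case.
Qed.

Lemma measurable_halfr n (i : 'I_n) (t : R) :
  measurable [set x : 'rV[R]_n | x ord0 i <= t].
Proof.
rewrite (_ : mkset _ = setT `&` (fun x : 'rV[R]_n => x ord0 i) @^-1` `]-oo, t]%classic).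
  by apply: measurable_coord.
by apply/seteqP; split => x /=; rewrite in_itv/=//; case.
Qed.

Lemma measurable_cube n a l : measurable (@cube n a l).
Proof.
rewrite (_ : cube a l = \bigcap_(i in [set: 'I_n])
  ([set x | a ord0 i <= x ord0 i] `&` [set x | x ord0 i <= a ord0 i + l])).
  apply: fin_bigcap_measurable => // i _; apply: measurableI.
  - exact: measurable_halfl.
  - exact: measurable_halfr.
apply/seteqP; split => x /= H i; first by move=> _; apply/andP.
by apply/andP; exact: (H i).
Qed.

Lemma compact_cube n a l : compact (@cube n a l).
Proof.
rewrite (_ : cube a l = [set v : 'rV[R]_n | forall i, `[a ord0 i, a ord0 i + l]%classic (v ord0 i)]).
  by apply: (@rV_compact R n (fun i => `[a ord0 i, a ord0 i + l]%classic)) => i; exact: segment_compact.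
by apply/seteqP; split => x /= H i; move: (H i); rewrite in_itv.
Qed.

Definition box n (I : 'I_n -> set R) : set 'rV[R]_n :=
  [set x | forall i, I i (x ord0 i)].

Lemma measurable_box n (I : 'I_n -> set R) :
  (forall i, measurable (I i)) -> measurable (box I).
Proof.
move=> mI.
rewrite (_ : box I = \bigcap_(i in [set: 'I_n])
    (setT `&` (fun x : 'rV[R]_n => x ord0 i) @^-1` I i)).
  by apply: fin_bigcap_measurable => // i _; apply: measurable_coord.
by apply/seteqP; split => x /= H i => [_|]; [split=> //; exact: H|have [] := H i].
Qed.

Lemma Leb_box n (I : 'I_n -> set R) (s : 'I_n -> R) :
  (forall i, measurable (I i)) -> (forall i, lebesgue_measure (I i) = (s i)%:E) ->
  Leb n (box I) = (\prod_i s i)%:E.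
Proof.
elim: n I s => [|n IH] I s mI Is.
  by rewrite big_ord0 /= diracE (_ : _ \in _)// inE => i; case: i.
rewrite LebS.
have -> : @rV_cons R n @^-1` box I = I ord0 `*` box (fun i => I (lift ord0 i)).
  apply/seteqP; split => -[t x] /= H.
    split; first by have := H ord0; rewrite mxE unlift_none.
    by move=> i; have := H (lift ord0 i); rewrite !mxE liftK.
  move=> i; case: (unliftP ord0 i) => [j ->|->]; rewrite mxE ?unlift_none ?liftK /=.
    by case: H => _; apply.
  by case: H.
rewrite product_measure1E; last 2 first.
- exact: mI.
- exact: measurable_box.
by rewrite [X in (X * _)%E](Is ord0) (IH _ (fun i => s (lift ord0 i)))// -EFinM big_ord_recl.
Qed.

Lemma Leb_cube n (a : 'rV[R]_n) l : 0 <= l -> Leb n (cube a l) = (l ^+ n)%:E.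
Proof.
move=> l0.
have -> : cube a l = box (fun i => `[a ord0 i, a ord0 i + l]%classic).
  by apply/seteqP; split => x /= H i; have := H i; rewrite /= in_itv.
rewrite (@Leb_box _ _ (fun=> l)) => [|i|i]; rewrite ?prodr_const ?card_ord//.
rewrite [LHS]lebesgue_measure_itv /= lte_fin ltrDl -EFinB addrAC subrr add0r.
by move: l0; rewrite le_eqVlt => /predU1P[<-|->]; rewrite ?ltxx.
Qed.

Lemma measurable_affine_rV n (c : 'rV[R]_n) (s : R) :
  measurable_fun setT (fun x : 'rV[R]_n => c + s *: x).
Proof.
apply/measurable_fun_rVP => i.
rewrite (_ : (fun _ => _) = (fun t : R => c ord0 i + s * t) \o (fun x : 'rV[R]_n => x ord0 i)).
  by apply: measurableT_comp; [exact: measurable_affine|exact: measurable_coord].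
by apply/funext => x /=; rewrite !mxE.
Qed.

(** Induction on the dimension: scaled by |s|^(n+1), the image of the product measure under the
    affine map agrees with the product measure on rectangles, hence everywhere. In dimension 0 the
    map is the identity. *)
Lemma Leb_affine n (c : 'rV[R]_n) (s : R) (A : set 'rV[R]_n) :
  s != 0 -> measurable A ->
  Leb n ((fun y : 'rV[R]_n => c + s *: y) @^-1` A) = ((`|s| ^- n)%:E * Leb n A)%E.
Proof.
move=> s0; elim: n c A => [|n IH] c A mA.
  rewrite expr0 invr1 mul1e (_ : _ @^-1` _ = A)//.
  by apply/seteqP; split => x /=; rewrite [_ + _]thinmx0 [x]thinmx0.
pose c' : 'rV[R]_n := \row_j c ord0 (lift ord0 j).
pose T0 (t : R) := c ord0 ord0 + s * t.
pose T1 (y : 'rV[R]_n) := c' + s *: y.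
pose T (p : measurableTypeR R * 'rV[R]_n) : measurableTypeR R * 'rV[R]_n :=
  (T0 p.1, T1 p.2).
have mT : measurable_fun setT T.
  apply: measurable_fun_pair.
    by apply: (measurableT_comp (measurable_affine _ _)); exact: measurable_fst.
  by apply: (measurableT_comp (measurable_affine_rV _ _)); exact: measurable_snd.
have sn : 0 <= `|s| ^+ n.+1 by rewrite exprn_ge0.
pose nu := mscale (NngNum sn) (image_measure (lebesgue_measure \x Leb n)%E mT).
have mcA : measurable (@rV_cons R n @^-1` A).
  by rewrite -[X in measurable X]setTI; exact: measurable_rV_cons.
have nuE : (lebesgue_measure \x Leb n)%E (@rV_cons R n @^-1` A) =
    nu (@rV_cons R n @^-1` A).
  apply: product_measure_unique => // X Y mX mY.
  rewrite [LHS](_ : _ = ((`|s| ^+ n.+1)%:E * (lebesgue_measure \x Leb n)%E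
      ((T0 @^-1` X) `*` (T1 @^-1` Y)))%E)//.
  rewrite product_measure1E; last 2 first.
    by rewrite -[X in measurable X]setTI; apply: measurable_affine.
    by rewrite -[X in measurable X]setTI; apply: measurable_affine_rV.
  rewrite IH// [X in (_ * (X * _))%E]lebesgue_measure_affine//.
  rewrite (muleACA (`|s|^-1)%:E).
  rewrite -EFinM [LHS]muleA -EFinM exprS.
  by rewrite -invfM mulfV ?mul1e// mulf_neq0// ?expf_neq0// normr_eq0.
rewrite !LebS nuE.
rewrite [X in (_ * X)%E](_ : _ = ((`|s| ^+ n.+1)%:E *
    (lebesgue_measure \x Leb n)%E (T @^-1` (@rV_cons R n @^-1` A)))%E)//.
rewrite muleA -EFinM mulVf ?mul1e; last by rewrite expf_neq0// normr_eq0.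
congr (product_measure1 _ _ _).
have E t x : c + s *: rV_cons (t, x) = rV_cons (c ord0 ord0 + s * t, c' + s *: x).
  apply/rowP => i; rewrite !mxE.
  by case: (unliftP ord0 i) => [j ->|->]; rewrite ?liftK ?unlift_none /= ?mxE.
by apply/seteqP; split => -[t x] /=; rewrite E.
Qed.

End Leb.

Section open_sets.
Context {R : realType} {n : nat}.
Local Notation Rn := 'rV[R]_n.

Lemma normr_rV_lt (x : Rn) (e : R) : 0 < e ->
  (`|x| < e) = [forall i, `|x ord0 i| < e].
Proof.
move=> e0; have -> : `|x| = \big[Num.max/0]_ij `|x ij.1 ij.2| := mx_normrE x; apply/bigmax_ltP/forallP => /=.
  by move=> [_ H] i; exact: (H (ord0, i)).
by move=> H; split=> // -[i j] _ /=; rewrite (ord1 i); exact: H.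
Qed.

Lemma normr_rV_le (x : Rn) (e : R) : 0 <= e ->
  (`|x| <= e) = [forall i, `|x ord0 i| <= e].
Proof.
move=> e0; have -> : `|x| = \big[Num.max/0]_ij `|x ij.1 ij.2| := mx_normrE x; apply/bigmax_leP/forallP => /=.
  by move=> [_ H] i; exact: (H (ord0, i)).
by move=> H; split=> // -[i j] _ /=; rewrite (ord1 i); exact: H.
Qed.

Lemma open_rational_cube (V : set Rn) (x : Rn) : open V -> V x ->
  exists (c : 'rV[rat]_n) (l : rat),
    [/\ 0 < l, cube (map_mx ratr c) (ratr l) x & cube (map_mx ratr c) (ratr l) `<=` V].
Proof.
rewrite openE => /[apply]; rewrite /interior -nbhs_ballE => -[e /= e0 eV].
have [l] := @rat_in_itvoo R 0 (e / 2) ltac:(by rewrite divr_gt0).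
rewrite in_itv /= => /andP[l0 le].
have H i : exists q : rat, x ord0 i - ratr l < ratr q < x ord0 i.
  have [q] := @rat_in_itvoo R (x ord0 i - ratr l) (x ord0 i) ltac:(by rewrite ltrBlDr ltrDl).
  by rewrite in_itv /=; exists q.
pose c : 'rV[rat]_n := \row_i projT1 (cid (H i)).
have cP i : x ord0 i - ratr l < ratr (c ord0 i) < x ord0 i.
  by rewrite mxE; exact: (projT2 (cid (H i))).
exists c, l; split.
- by rewrite -(ltr0q R).
- by move=> i; rewrite mxE; have := cP i; lra.
- move=> y yc; apply: eV; rewrite mx_norm_ball /ball_ /= normr_rV_lt//.
  apply/forallP => i; rewrite !mxE; have := cP i; have := yc i; rewrite mxE.
  by rewrite ltr_norml; lra.
Qed.

(** Cubes with rational corner and side are countable. As the sigma-algebra is generated by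
    coordinates, this is what makes open sets measurable; it also localises a set of positive
    measure to one cube. *)
Lemma open_bigcup_cubes (V : set Rn) : open V ->
  exists (a : nat -> Rn) (l : nat -> R),
  (forall k, 0 < l k) /\ exists D : set nat, V = \bigcup_(k in D) cube (a k) (l k).
Proof.
move=> oV.
pose d (k : nat) : 'rV[rat]_n * rat := odflt (0, 1) (unpickle k).
(* Codes of a nonpositive side get side 1, so that every side is positive. *)
pose l k : R := if 0 < (d k).2 then ratr (d k).2 else 1.
exists (fun k => map_mx ratr (d k).1), l; split.
  by move=> k; rewrite /l; case: ifP => // h; rewrite ltr0q.
exists [set k | cube (map_mx ratr (d k).1) (l k) `<=` V].
apply/seteqP; split => [x Vx|x [k /= kV]]; last exact: kV.
have [c [q [q0 xc cV]]] := open_rational_cube oV Vx.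
exists (pickle (c, q)); rewrite /= /l /d pickleK /= q0//.
Qed.

Lemma measurable_open (V : set Rn) : open V -> measurable V.
Proof.
move=> /open_bigcup_cubes[a [l [_ [D ->]]]].
by apply: bigcup_measurable => k _; exact: measurable_cube.
Qed.

Lemma measurable_continuous (f : Rn -> R) : continuous f -> measurable_fun setT f.
Proof.
move=> cf; apply: (measurability _ (RGenOpens.measurableE R)) => /=.
move=> _ [_ [a [b ->] <-]]; rewrite setTI; apply: measurable_open.
by move: cf => /continuousP; apply; exact: interval_open.
Qed.

End open_sets.

(** * Density of measurable sets along dyadic grids *)

Section density.
Context {R : realType} {n : nat}.
Local Notation Rn := 'rV[R]_n.
Variables (a : Rn) (l : R).
Hypothesis l0 : 0 < l.

(** Half-open, so that the dyadic cells partition it exactly; the missing faces are null. *)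
Let hcube : set Rn := [set x | forall i, `[a ord0 i, a ord0 i + l[%classic (x ord0 i)].

(** The index, along axis i, of the dyadic slab of width l / 2^N containing x; points with equal
    indices form a cell of generation N. *)
Let idx (N : nat) (x : Rn) (i : 'I_n) : int := Num.floor (2 ^+ N * ((x ord0 i - a ord0 i) / l)).

Let cell N (k : 'I_n -> int) : set Rn := [set x | forall i, idx N x i = k i].

Let cell_interval N (k : int) (i : 'I_n) : set R :=
  `[a ord0 i + l / 2 ^+ N * k%:~R, a ord0 i + l / 2 ^+ N * (k + 1)%:~R[%classic.

Let idx_interval N x i k : (idx N x i = k) <-> cell_interval N k i (x ord0 i).
Proof.
rewrite /idx /cell_interval /= in_itv /=.
have H t (m : int) : (a ord0 i + l / 2 ^+ N * m%:~R <= t) = (m%:~R <= 2 ^+ N * ((t - a ord0 i) / l)).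
  have p : 0 < 2 ^+ N / l :> R by rewrite divr_gt0 ?exprn_gt0.
  rewrite -(ler_pM2l p) mulrDr -lerBrDl -mulrBr.
  rewrite [X in _ = (_ <= X)](_ : _ = 2 ^+ N / l * (t - a ord0 i)); last by rewrite mulrCA mulrC mulrAC mulrC.
  congr (_ <= _); field; by rewrite ?gt_eqF//= ?expf_neq0// pnatr_eq0.
have e : Num.floor (2 ^+ N * ((x ord0 i - a ord0 i) / l)) = k <->
   (Num.floor (2 ^+ N * ((x ord0 i - a ord0 i) / l)) == k) by split=> /eqP.
rewrite e floor_eq.
by move: (H (x ord0 i) k) (H (x ord0 i) (k+1)); rewrite ltNge => <- <-; rewrite -ltNge.
Qed.

(** The grids are nested because floor(2u) determines floor(u): for an integer k, u < k exactly when
    2u < 2k. *)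
Let idx_refine N x y i : idx N.+1 x i = idx N.+1 y i -> idx N x i = idx N y i.
Proof.
rewrite /idx exprS -!mulrA.
suff H (u v : R) : Num.floor u < Num.floor v -> Num.floor (2 * u) < Num.floor (2 * v).
  move: (2 ^+ N * _) (2 ^+ N * _) => u v uv.
  by have [/H|/H|//] := ltgtP (Num.floor u) (Num.floor v); rewrite uv ltxx.
move=> h.
have e k : 2 * k%:~R = (2 * k)%:~R :> R by rewrite intrM.
have h1 : (Num.floor (2 * u) < 2 * Num.floor v)%R.
  by rewrite floor_lt_int -e ltr_pM2l// -floor_lt_int.
by apply: (lt_le_trans h1); rewrite floor_ge_int -e ler_pM2l// floor_le.
Qed.

Let idx_refineW N M x y i : (N <= M)%N -> idx M x i = idx M y i -> idx N x i = idx N y i.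
Proof.
move=> /subnK <-; elim: (M - N)%N => // k IH; rewrite addSn => /idx_refine; exact: IH.
Qed.

Let cellE N k : cell N k = box (fun i => cell_interval N (k i) i).
Proof. by apply/seteqP; split => x /= h i; have := h i; rewrite idx_interval. Qed.

Let step N : 0 < l / 2 ^+ N. Proof. by rewrite divr_gt0// exprn_gt0. Qed.

Let Leb_cell N k : Leb n (cell N k) = ((l / 2 ^+ N) ^+ n)%:E.
Proof.
rewrite cellE (@Leb_box _ _ _ (fun=> l / 2 ^+ N)) => [|i|i].
- by rewrite prodr_const card_ord.
- exact: measurable_itv.
rewrite [LHS]lebesgue_measure_itv /= lte_fin ltrD2l ltr_pM2l// ltr_int ltrDl ltr01.
by rewrite -EFinB; congr EFin; rewrite intrD; ring.
Qed.

Let measurable_cell N k : measurable (cell N k).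
Proof. by rewrite cellE; apply: measurable_box => i; exact: measurable_itv. Qed.

Let hcubeE : hcube = cell 0 (fun=> 0).
Proof.
rewrite cellE; apply/seteqP; split => x /= h i; have := h i;
  by rewrite /cell_interval /= !in_itv /= expr0 divr1 mulr0 addr0 add0r mulr1.
Qed.

(** [D] is a union of cells of generation [N]. *)
Let lev N (D : set Rn) := forall x y, (forall i, idx N x i = idx N y i) -> D x -> D y.

Let levW N M D : (N <= M)%N -> lev N D -> lev M D.
Proof. by move=> NM DN x y xy; apply: DN => i; exact: (idx_refineW NM). Qed.

(** Approximation within the cube by unions of cells of one generation. The sets that admit it
    contain the half-spaces x_i > t and are closed under complements and countable unions, so every
    measurable set is among them. *)
Let approx (B : set Rn) := measurable B /\ forall e : R, 0 < e ->
  exists N D, [/\ measurable D, lev N D &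
    (Leb n (hcube `&` (B `+` D)) <= e%:E)%E].

Let measurable_hcube : measurable hcube.
Proof. by rewrite hcubeE. Qed.

Let Leb_hcube : Leb n hcube = (l ^+ n)%:E.
Proof. by rewrite hcubeE Leb_cell expr0 divr1. Qed.

Let Leb_sub_hcube A : measurable A -> A `<=` hcube -> (Leb n A < +oo)%E.
Proof.
move=> mA Ah; apply: (@le_lt_trans _ _ (Leb n hcube)); last by rewrite Leb_hcube ltry.
by apply: le_measure => //; rewrite inE.
Qed.

Let approxC B : approx B -> approx (~` B).
Proof.
move=> [mB aB]; split; first exact: measurableC.
move=> e e0; have [N [D [mD lD BD]]] := aB e e0.
exists N, (~` D); split; first exact: measurableC.
  by move=> x y xy Dx /= Dy; apply: Dx; apply: lD Dy => i; rewrite xy.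
rewrite (_ : ~` B `+` ~` D = B `+` D)//.
apply/seteqP; split => x; rewrite /setY /=; have := EM (B x); have := EM (D x); tauto.
Qed.

Let approx_bigcup (F : nat -> set Rn) : (forall i, approx (F i)) -> approx (\bigcup_i F i).
Proof.
move=> aF; have mF i : measurable (F i) by have [] := aF i.
have mU : measurable (\bigcup_i F i) by exact: bigcup_measurable.
split=> // e e0.
(* The part of the cube missed by the first [m] sets. Its trace on the union is below e / 2 for some
   [m]; the [m] sets kept share the other e / 2. *)
pose G m := hcube `\` \big[setU/set0]_(i < m) F i.
have mG m : measurable (G m).
  by apply: measurableD => //; apply: bigsetU_measurable => i _.
have [m Gm] : exists m, (Leb n (G m `&` \bigcup_i F i) <= (e / 2)%:E)%E.
  have c : (Leb n \o (fun m => G m `&` \bigcup_i F i)) x @[x --> \oo] --> 0%E.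
    rewrite -(measure0 (Leb n)) (_ : set0 = \bigcap_m (G m `&` \bigcup_i F i)).
      apply: nonincreasing_cvg_mu.
      - by apply: Leb_sub_hcube; [exact: measurableI|move=> x [[]]].
      - by move=> i; exact: measurableI.
      - by apply: bigcapT_measurable => i; exact: measurableI.
      - move=> i j ij; apply/subsetPset => x [[hx xj] xU]; split=> //; split=> //.
        move=> xi; apply: xj; move: xi; apply: subset_bigsetU => //.
    apply/seteqP; split => // x /= H.
    have [_ [i _ Fi]] := H 0 I; have [[_ h] _] := H i.+1 I.
    by apply: h; rewrite big_ord_recr /=; right.
  have e2 : 0 < e / 2 by rewrite divr_gt0.
  move/fine_cvgP : c => [fc] /cvgrPdist_le /(_ _ e2) [M _ /(_ M (leqnn M))] /=.
  rewrite sub0r normrN => h; exists M; move: fc => [M' _ _].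
  have ff : Leb n (G M `&` \bigcup_i F i) \is a fin_num.
    by rewrite ge0_fin_numE//; apply: Leb_sub_hcube; [exact: measurableI|move=> x [[]]].
  by rewrite -(fineK ff) lee_fin; apply: le_trans h; exact: ler_norm.
(* Division by [m.+1], because [m] may be 0. *)
have em : 0 < e / 2 / m.+1%:R by rewrite !divr_gt0.
have aFm i := (aF i).2 _ em.
pose N i := projT1 (cid (aFm i)); pose D i := projT1 (cid (projT2 (cid (aFm i)))).
have ND i : [/\ measurable (D i), lev (N i) (D i) &
    (Leb n (hcube `&` (F i `+` D i)) <= (e / 2 / m.+1%:R)%:E)%E].
  exact: (projT2 (cid (projT2 (cid (aFm i))))).
pose M := \max_(i < m) N i.
pose U := \big[setU/set0]_(i < m) D i.
exists M, U; split.
- by apply: bigsetU_measurable => i _; have [] := ND i.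
- move=> x y xy; rewrite /U -!bigcup_mkord => -[i /= im Dx]; exists i => //.
  have [_ lD _] := ND i; apply: (levW _ lD) xy Dx.
  by rewrite /M; apply: (leq_bigmax (Ordinal im)).
pose E i := hcube `&` (F i `+` D i).
have mY i : measurable (E i).
  have [mD _ _] := ND i; apply: measurableI => //.
  by apply: measurableU; exact: measurableD.
apply: (@le_trans _ _ (Leb n (G m `&` \bigcup_i F i) +
    Leb n (\big[setU/set0]_(i < m) (E i)))%E).
  apply: le_trans (measureU2 _ _ _); last 2 first.
  - exact: measurableI.
  - by apply: bigsetU_measurable => i _.
  apply: le_measure.
  - rewrite inE; apply: measurableI => //; apply: measurableU; apply: measurableD => //;
      by apply: bigsetU_measurable => i _; have [] := ND i.
  - rewrite inE; apply: measurableU; first exact: measurableI.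
    by apply: bigsetU_measurable => i _.
  - move=> x [hx [[[i _ Fi] xU]|[xU Fx]]].
    + have [xm|xm] := pselect ((\big[setU/set0]_(i < m) F i) x).
        right; move: xm; rewrite -bigcup_mkord => -[j /= jm Fj];  rewrite -bigcup_mkord; exists j => //=.
        split=> //; left; split=> // Dj; apply: xU; rewrite /U -bigcup_mkord; by exists j.
      by left; split; [split|exists i].
    + right; move: xU; rewrite /U -bigcup_mkord => -[j /= jm Dj]; rewrite -bigcup_mkord; exists j => //=.
      split=> //; right; split=> // Fj; apply: Fx; by exists j.
rewrite [e in leRHS](splitr e) EFinD; apply: leeD => //.
apply: (@le_trans _ _ (\sum_(i < m) Leb n (E i))%E).
  by apply: content_subadditive => //; exact: bigsetU_measurable.
apply: (@le_trans _ _ (\sum_(i < m) (e / 2 / m.+1%:R)%:E)%E).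
  by apply: lee_sum => i _; have [] := ND i.
rewrite sumEFin lee_fin sumr_const card_ord -[leLHS]mulr_natr mulrAC ler_pdivrMr//.
by rewrite ler_pM2l ?divr_gt0// ler_nat.
Qed.

(** With [D] made of the slabs strictly beyond that of t, the error lies in the slab of t, of
    measure (l / 2^N) l^(n-1) in the cube. *)
Let approx_ray i (t : R) : approx [set x | t < x ord0 i].
Proof.
split.
  rewrite [X in measurable X](_ : _ = setT `&` (fun x : Rn => x ord0 i) @^-1` `]t, +oo[%classic).
    by apply: measurable_coord.
  by apply/seteqP; split => x /=; rewrite in_itv/= andbT//; case.
move=> e e0.
(* Only coordinate i of this point matters: [idx N tv i] is the slab of t. *)
pose tv : Rn := \row_j (if j == i then t else a ord0 j).
have [N le] : exists N, (l / 2 ^+ N) * l ^+ n.-1 <= e.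
  have c : (fun N => l ^+ n * (2^-1) ^+ N) @ \oo --> l ^+ n * 0.
    by apply: cvgMr; apply: cvg_expr; rewrite ger0_norm// invf_lt1// ltr1n.
  move: c; rewrite mulr0 => /cvgrPdist_le /(_ _ e0) [N _ /(_ N (leqnn N))] /=.
  rewrite sub0r normrN => h; exists N; apply: le_trans (le_trans (ler_norm _) h).
  have -> : l ^+ n = l * l ^+ n.-1.
    by rewrite -exprS prednK// (leq_ltn_trans (leq0n i) (ltn_ord i)).
  by rewrite exprVn le_eqVlt; apply/orP; left; apply/eqP; ring.
pose D := [set x : Rn | idx N tv i < idx N x i].
have mD : measurable D.
  have -> : D = [set x | a ord0 i + l / 2 ^+ N * (idx N tv i + 1)%:~R <= x ord0 i].
    have H (x : Rn) : (idx N tv i < idx N x i) =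
        (a ord0 i + l / 2 ^+ N * (idx N tv i + 1)%:~R <= x ord0 i).
      rewrite -lezD1 [in LHS]/(idx N x i) floor_ge_int.
      move: (_%:~R) => z; rewrite -[RHS]lerBrDl -[RHS]ler_pdivlMl//.
      by congr (_ <= _); field; rewrite ?expf_neq0// ?pnatr_eq0// gt_eqF.
    by apply/seteqP; split => x /=; rewrite /D /= H.
  exact: measurable_halfl.
exists N, D; split=> //.
  by move=> x y xy; rewrite /D /= xy.
have idx_mono (x y : Rn) : x ord0 i <= y ord0 i -> idx N x i <= idx N y i.
  move=> xy; apply: le_floor; rewrite ler_pM2l ?exprn_gt0// ler_pM2r ?invr_gt0//.
  by rewrite lerD2r.
pose I j := if j == i then cell_interval N (idx N tv i) i else `[a ord0 j, a ord0 j + l[%classic.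
have mI j : measurable (I j) by rewrite /I; case: ifP => _; exact: measurable_itv.
apply: (@le_trans _ _ (Leb n (box I))).
  apply: le_measure.
  - rewrite inE; apply: measurableI => //.
    have mB : measurable [set x : Rn | t < x ord0 i].
      rewrite [X in measurable X](_ : _ = setT `&` (fun x : Rn => x ord0 i) @^-1` `]t, +oo[%classic).
        by apply: measurable_coord.
      by apply/seteqP; split => x /=; rewrite in_itv/= andbT//; case.
    by apply: measurableU; exact: measurableD.
  - by rewrite inE; exact: measurable_box.
  - move=> x [hx xD] j; rewrite /I; case: eqP => [->|//]; apply/idx_interval.
    apply/eqP; rewrite eq_le; case: xD => -[] /=; rewrite /D /=.
      move=> tx /negP; rewrite -leNgt => -> /=; apply: idx_mono; by rewrite mxE eqxx ltW.
    move=> h /negP; rewrite -leNgt => xt; rewrite (ltW h) andbT.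
    by apply: idx_mono; rewrite mxE eqxx.
rewrite (@Leb_box _ _ _ (fun j => if j == i then l / 2 ^+ N else l)) => [|//|j].
  rewrite (bigD1 i)//= eqxx (eq_bigr (fun=> l)) => [|j /negbTE->//].
  by rewrite prodr_const cardC1 card_ord lee_fin.
rewrite /I; case: eqP => [_|_]; rewrite [LHS]lebesgue_measure_itv /= lte_fin.
  rewrite ltrD2l ltr_pM2l// ltr_int ltrDl ltr01.
  by rewrite -EFinB; congr EFin; rewrite intrD; ring.
by rewrite ltrDl l0 -EFinB addrAC subrr add0r.
Qed.

Let approx_coord i (Y : set R) : measurable Y -> approx ((fun x : Rn => x ord0 i) @^-1` Y).
Proof.
move=> mY; have {}mY : (<<s @RGenOInfty.G R >>) Y.
  by move: mY; rewrite -[<<s _ >>](RGenOInfty.measurableE R).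
suff : <<s @RGenOInfty.G R >> `<=` [set Y | approx ((fun x : Rn => x ord0 i) @^-1` Y)] by apply.
apply: smallest_sub => [|_ [t ->]]; last first.
  apply: (eq_rect _ approx (approx_ray i t)).
  by apply/seteqP; split => x /=; rewrite in_itv /= andbT.
split=> [/=|X /= aX|F /= aF].
- rewrite preimage_set0 -setCT; apply: approxC; split=> // e e0; exists 0%N, setT.
  by split=> //; rewrite setYK setI0 measure0 lee_fin ltW.
- by rewrite /= setTD preimage_setC; exact: approxC.
- by rewrite preimage_bigcup; exact: approx_bigcup.
Qed.

Let approx_measurable (A : set Rn) : measurable A -> approx A.
Proof.
move=> mA; suff : g_sigma_preimage (fun i (x : Rn) => x ord0 i) `<=` [set Y | approx Y].
  by apply.
apply: smallest_sub => [|B].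
  split=> [/=|X /= aX|F /= aF]; last exact: approx_bigcup.
  - rewrite -setCT; apply: approxC; split=> // e e0; exists 0%N, setT.
    by split=> //; rewrite setYK setI0 measure0 lee_fin ltW.
  - by rewrite setTD; exact: approxC.
rewrite -bigcup_seq => -[i _ [Y mY <-]]; rewrite setTI; exact: approx_coord.
Qed.

Let Leb_setD_cube (z : Rn) (s : R) A : 0 <= s -> measurable A -> A `<=` cube z s ->
  Leb n A = (s ^+ n)%:E -> Leb n (cube z s `\` A) = 0%E.
Proof.
move=> s0 mA Az As; have mc := measurable_cube z s.
have fin : (Leb n (cube z s) < +oo)%E by rewrite Leb_cube// ltry.
have := measureD mc mA fin; rewrite setIidr// => h.
apply: (etrans h); apply: (@etrans _ _ ((s ^+ n)%:E - (s ^+ n)%:E)%E).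
  by congr (_ - _)%E => //; exact: Leb_cube.
by rewrite -EFinB subrr.
Qed.

(** Inside the half-open cube, [A] is within eta of a union [D] of cells. If each cell had more than
    a fraction d outside [A], then d |D| <= |D \ A| <= eta. Together with |A| <= eta + |D| this
    gives d |A| <= (1 + d) eta, against the choice of eta. *)
Lemma density_subcube (A : set Rn) (d : R) : measurable A -> 0 < d ->
  (0 < Leb n (A `&` cube a l))%E ->
  exists z r, [/\ 0 < r, cube z r `<=` cube a l &
    (Leb n (cube z r `\` A) <= (d * r ^+ n)%:E)%E].
Proof.
move=> mA d0 A0.
have Leb_hcubeC : Leb n (cube a l `\` hcube) = 0%E.
  have sub : hcube `<=` cube a l.
    by move=> x h i; have := h i; rewrite /= in_itv /= => /andP[-> /ltW].
  apply: Leb_setD_cube => //; first exact: ltW.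
have hA0 : (0 < Leb n (A `&` hcube))%E.
  apply: (lt_le_trans A0); rewrite -[leRHS]adde0 -[X in (_ + X)%E]Leb_hcubeC.
  have mc := measurable_cube a l.
  apply: le_trans (measureU2 _ _ _); last 2 first.
  - exact: measurableI.
  - exact: measurableD.
  apply: le_measure; rewrite ?inE.
  - exact: measurableI.
  - by apply: measurableU; [exact: measurableI|exact: measurableD].
  - by move=> x [Ax cx]; have [hx|hx] := pselect (hcube x); [left|right].
have : Leb n (A `&` hcube) \is a fin_num.
  by rewrite ge0_fin_numE//; apply: Leb_sub_hcube => //; exact: measurableI.
move: hA0; case mE : (Leb n (A `&` hcube)) => [m| |]// + _; rewrite lte_fin => m0.
(* This makes (1 + d) eta equal to d m / 2, which is less than d m. *)
pose eta := d * m / (2 * (1 + d)).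
have eta0 : 0 < eta by rewrite divr_gt0 ?mulr_gt0// addr_gt0.
have [_ /(_ _ eta0) [N [D [mD lD AD]]]] := approx_measurable mA.
pose s := l / 2 ^+ N.
pose K : finType := {ffun 'I_n -> 'I_(2 ^ N)}.
pose C (k : K) := cell N (fun i => Posz (k i)).
have mC k : measurable (C k) by exact: measurable_cell.
suff [k Ck] : exists k, (Leb n (C k `\` A) <= (d * s ^+ n)%:E)%E.
  pose z : Rn := \row_i (a ord0 i + s * (k i)%:R).
  have CzE x i : C k x -> z ord0 i <= x ord0 i <= z ord0 i + s.
    move=> /(_ i); rewrite idx_interval /cell_interval /= in_itv /= mxE intrD.
    by rewrite mulrDr mulr1 addrA => /andP[-> /ltW].
  exists z, s; split; first exact: step.
    move=> x xz i; have := xz i; rewrite mxE => /andP[h1 h2]; apply/andP; split.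
      by apply: le_trans h1; rewrite lerDl mulr_ge0// ltW// step.
    apply: (le_trans h2); rewrite -addrA lerD2l -[X in _ + X]mulr1 -mulrDr natr1.
    rewrite /s -mulrA ler_piMr ?(ltW l0)// ler_pdivrMl ?exprn_gt0// mulr1.
    by rewrite -natrX ler_nat.
  (* The closed cube exceeds the cell by a null set. *)
  apply: le_trans Ck; rewrite -[leRHS]adde0.
  have <- : Leb n (cube z s `\` C k) = 0%E.
    have sub : C k `<=` cube z s by move=> x Cx i; exact: CzE.
    by apply: (Leb_setD_cube (ltW (step N)) (mC k) sub); exact: Leb_cell.
  have mc := measurable_cube z s.
  apply: le_trans (measureU2 _ _ _); last 2 first.
  - exact: measurableD.
  - exact: measurableD.
  apply: le_measure; rewrite ?inE.
  - exact: measurableD.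
  - by apply: measurableU; exact: measurableD.
  - by move=> x [Ax cx]; have [hx|hx] := pselect (C k x); [left|right].
apply: contrapT => /forallNP Ck.
have hC x : hcube x -> exists k : K, C k x.
  move=> hx; have H i : exists k : 'I_(2 ^ N), idx N x i = Posz k.
    have [x0 xl] : a ord0 i <= x ord0 i /\ x ord0 i < a ord0 i + l.
      by have := hx i; rewrite /= in_itv /= => /andP.
    have i0 : 0 <= idx N x i.
      by rewrite floor_ge0 mulr_ge0// divr_ge0 ?subr_ge0// ltW.
    have iN : idx N x i < (2 ^ N)%N.
      rewrite floor_lt_int -[ltRHS]/((2 ^ N)%:R) natrX -[ltRHS]mulr1.
      by rewrite ltr_pM2l ?exprn_gt0// ltr_pdivrMr// mul1r ltrBlDl.
    case: (idx N x i) i0 iN => // j _ jN; by exists (Ordinal jN).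
  exists [ffun i => projT1 (cid (H i))] => i; rewrite ffunE.
  exact: (projT2 (cid (H i))).
pose P : set K := [set k | exists x, C k x /\ D x].
have PD k : P k -> C k `<=` hcube `&` D.
  move=> [x [Cx Dx]] y Cy; split; last first.
    by apply: lD Dx => i; rewrite Cx Cy.
  move=> i; have := Cy i; rewrite idx_interval /cell_interval /= !in_itv /=.
  move=> /andP[h1 h2]; apply/andP; split.
    by apply: le_trans h1; rewrite lerDl mulr_ge0// ltW// step.
  apply: (lt_le_trans h2); rewrite lerD2l -mulrA ler_piMr ?(ltW l0)//.
  rewrite ler_pdivrMl ?exprn_gt0// mulr1 -[leLHS]/((k i + 1)%:R) -natrX ler_nat.
  by rewrite addn1.
have finP : finite_set P by exact: finite_finset.
have trivC (F : K -> set Rn) : (forall k, F k `<=` C k) -> trivIset P F.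
  move=> FC k k' _ _ [x [/FC h /FC h']]; apply/ffunP => i; apply: val_inj.
  by have := h i; rewrite (h' i) => -[].
have m1 : (m%:E <= eta%:E + \sum_(k \in P) Leb n (C k))%E.
  rewrite -mE.
  apply: (@le_trans _ _ (Leb n (hcube `&` (A `+` D)) + Leb n (hcube `&` D))%E).
    apply: le_trans (measureU2 _ _ _); last 2 first.
    - by apply: measurableI => //; apply: measurableU; exact: measurableD.
    - exact: measurableI.
    apply: le_measure; rewrite ?inE.
    - exact: measurableI.
    - apply: measurableU; last exact: measurableI.
      by apply: measurableI => //; apply: measurableU; exact: measurableD.
    - move=> x [Ax hx]; have [Dx|Dx] := pselect (D x); first by right.
      by left; split=> //; left.
  apply: leeD => //; apply: content_sub_fsum => //; first exact: measurableI.
  by move=> x [/hC[k Ck'] Dx]; exists k => //; exists x.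
have m2 : (d%:E * \sum_(k \in P) Leb n (C k) <= eta%:E)%E.
  rewrite ge0_mule_fsumr//.
  apply: (@le_trans _ _ (\sum_(k \in P) Leb n (C k `\` A))%E).
    apply: lee_fsum => // k _; rewrite Leb_cell -EFinM.
    by have /negP := Ck k; rewrite -ltNge => /ltW.
  rewrite -measure_fin_bigcup//; last 2 first.
  - by apply: trivC => k x [].
  - by move=> k _; exact: measurableD.
  apply: le_trans AD; apply: le_measure; rewrite ?inE.
  - by apply: fin_bigcup_measurable => // k _; exact: measurableD.
  - by apply: measurableI => //; apply: measurableU; exact: measurableD.
  - by move=> x [k /PD PDk [/PDk[hx Dx] Ax]]; split=> //; right.
move: m1 m2; case: (\sum_(k \in P) Leb n (C k))%E => [t| |]//; last first.
  by rewrite mulry gtr0_sg// mul1e.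
rewrite -EFinD -EFinM !lee_fin => m1 m2.
have eE : eta * (2 * (1 + d)) = d * m by rewrite /eta divfK// gt_eqF// mulr_gt0// addr_gt0.
have dm0 : 0 < d * m by rewrite mulr_gt0.
have : d * m <= d * eta + d * t by rewrite -mulrDr ler_pM2l.
lra.
Qed.

End density.

(** * Weighted spaces and compact operators *)

Section complex_aux.
Context {R : realType}.
Implicit Types z t : R[i].

Lemma normcE z : normc z = Num.sqrt (complex.Re z ^+ 2 + complex.Im z ^+ 2).
Proof. by case: z. Qed.

Lemma normc_ge0 z : 0 <= normc z.
Proof. by rewrite normcE sqrtr_ge0. Qed.

Lemma normcD z t : normc (z + t) <= normc z + normc t.
Proof. exact: le_normcD. Qed.

Lemma normc_real (r : R) : normc r%:C%C = `|r|.
Proof. by rewrite normcE /= expr0n /= addr0 sqrtr_sqr. Qed.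

Lemma abs_Re_le z : `|complex.Re z| <= normc z.
Proof.
rewrite normcE -sqrtr_sqr ler_wsqrtr// lerDl sqr_ge0//.
Qed.

Lemma abs_Im_le z : `|complex.Im z| <= normc z.
Proof.
rewrite normcE -sqrtr_sqr ler_wsqrtr// lerDr sqr_ge0//.
Qed.

Lemma ReD z t : complex.Re (z + t) = complex.Re z + complex.Re t.
Proof. by case: z; case: t. Qed.
Lemma ImD z t : complex.Im (z + t) = complex.Im z + complex.Im t.
Proof. by case: z; case: t. Qed.
Lemma ReN z : complex.Re (- z) = - complex.Re z.
Proof. by case: z. Qed.
Lemma ImN z : complex.Im (- z) = - complex.Im z.
Proof. by case: z. Qed.
Lemma ReM z t : complex.Re (z * t) = complex.Re z * complex.Re t - complex.Im z * complex.Im t.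
Proof. by case: z; case: t. Qed.
Lemma ImM z t : complex.Im (z * t) = complex.Re z * complex.Im t + complex.Im z * complex.Re t.
Proof. by case: z => a b; case: t => c d /=. Qed.

Lemma normc_le z : normc z <= `|complex.Re z| + `|complex.Im z|.
Proof.
rewrite normcE -[leRHS]ger0_norm ?addr_ge0// -sqrtr_sqr ler_wsqrtr//.
rewrite sqrrD !real_normK ?num_real// -addrA lerD2l lerDr mulrn_wge0//.
Qed.

End complex_aux.

Section cmeas.
Context {R : realType} {n : nat}.
Local Notation Rn := 'rV[R]_n.
Implicit Types f g : Rn -> R[i].

Lemma cmeasurable_cst (c : R[i]) : cmeasurable (fun _ : Rn => c).
Proof. by split. Qed.

Lemma cmeasurableD f g : cmeasurable f -> cmeasurable g -> cmeasurable (fun x => f x + g x).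
Proof.
move=> [f1 f2] [g1 g2]; split.
  by under eq_fun do rewrite ReD; exact: measurable_funD.
by under eq_fun do rewrite ImD; exact: measurable_funD.
Qed.

Lemma cmeasurableN f : cmeasurable f -> cmeasurable (fun x => - f x).
Proof.
move=> [f1 f2]; split.
  by under eq_fun do rewrite ReN; exact: measurableT_comp.
by under eq_fun do rewrite ImN; exact: measurableT_comp.
Qed.

Lemma cmeasurableB f g : cmeasurable f -> cmeasurable g -> cmeasurable (fun x => f x - g x).
Proof. by move=> mf mg; apply: cmeasurableD => //; exact: cmeasurableN. Qed.

Lemma cmeasurableM f g : cmeasurable f -> cmeasurable g -> cmeasurable (fun x => f x * g x).
Proof.
move=> [f1 f2] [g1 g2]; split.
  by under eq_fun do rewrite ReM; apply: measurable_funB; exact: measurable_funM.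
by under eq_fun do rewrite ImM; apply: measurable_funD; exact: measurable_funM.
Qed.

Lemma cmeasurableX f k : cmeasurable f -> cmeasurable (fun x => f x ^+ k).
Proof.
move=> mf; elim: k => [|k IH]; first exact: cmeasurable_cst.
by under eq_fun do rewrite exprS; exact: cmeasurableM.
Qed.

Lemma cmeasurable_real (f : Rn -> R) : measurable_fun setT f -> cmeasurable (fun x => (f x)%:C%C).
Proof. by move=> mf; split. Qed.

Lemma cmeasurable_sum (F : nat -> Rn -> R[i]) N : (forall k, cmeasurable (F k)) ->
  cmeasurable (fun x => \sum_(k < N) F k x).
Proof.
move=> mF; elim: N => [|N IH].
  by under eq_fun do rewrite big_ord0; exact: cmeasurable_cst.
by under eq_fun do rewrite big_ord_recr /=; exact: cmeasurableD.
Qed.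

Lemma measurable_normc f : cmeasurable f -> measurable_fun setT (fun x => normc (f x)).
Proof.
move=> [f1 f2]; under eq_fun do rewrite normcE.
apply: (@measurableT_comp _ _ _ _ _ _ (@Num.sqrt R)).
  by apply: continuous_measurable_fun; exact: sqrt_continuous.
by apply: measurable_funD; apply: measurable_funX.
Qed.

End cmeas.

Section weighted.
Context {R : realType} {n : nat}.
Local Notation Rn := 'rV[R]_n.
Variable (w : Rn -> R).
Hypothesis mw : measurable_fun setT w.
Hypothesis w0 : forall x, 0 <= w x.
Implicit Types f g : Rn -> R[i].

(** Attaching the weight to the function instead of the measure makes the inequalities of Minkowski
    and Hölder for Lebesgue measure applicable. *)
Lemma wLp_normE q f : wLp_norm q w f =
  ('N[Leb n]_q%:E[EFin \o (fun x => (normc (f x) * w x)%R)])%E.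
Proof.
rewrite unlock /wLp_norm; congr (_ `^ _)%E; apply: eq_integral => x _ /=.
by rewrite ger0_norm ?mulr_ge0 ?normc_ge0// powRM ?normc_ge0.
Qed.

Lemma measurable_normcw f : cmeasurable f ->
  measurable_fun setT (fun x => normc (f x) * w x).
Proof. by move=> mf; apply: measurable_funM => //; exact: measurable_normc. Qed.

Lemma measurable_powR_normcw q f : cmeasurable f ->
  measurable_fun setT (fun x => (normc (f x) `^ q * w x `^ q)%:E).
Proof.
move=> mf; apply/measurable_EFinP; apply: measurable_funM.
  by apply: (measurableT_comp (measurable_powR q)); exact: measurable_normc.
exact: (measurableT_comp (measurable_powR q)).
Qed.

Lemma wLp_norm_ge0 q f : (0 <= wLp_norm q w f)%E.
Proof. exact: poweR_ge0. Qed.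

Lemma wLp_norm_le q f g : 0 < q -> cmeasurable f -> cmeasurable g ->
  {ae Leb n, forall x, normc (f x) <= normc (g x)} ->
  (wLp_norm q w f <= wLp_norm q w g)%E.
Proof.
move=> q0 mf mg fg; rewrite /wLp_norm gt0_ler_poweR ?in_itv/= ?leey ?andbT//.
- by rewrite invr_ge0 ltW.
- by apply: integral_ge0 => x _; rewrite lee_fin mulr_ge0 ?powR_ge0.
- by apply: integral_ge0 => x _; rewrite lee_fin mulr_ge0 ?powR_ge0.
apply: ae_ge0_le_integral => //.
- by move=> x _; rewrite lee_fin mulr_ge0 ?powR_ge0.
- exact: measurable_powR_normcw.
- by move=> x _; rewrite lee_fin mulr_ge0 ?powR_ge0.
- exact: measurable_powR_normcw.
move: fg; apply: filterS => x fg _; rewrite lee_fin ler_wpM2r ?powR_ge0//.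
by rewrite ge0_ler_powR ?nnegrE ?normc_ge0// ltW.
Qed.

Lemma wLp_normD q f g : 1 <= q -> cmeasurable f -> cmeasurable g ->
  (wLp_norm q w (fun x => (f x + g x)%R) <= wLp_norm q w f + wLp_norm q w g)%E.
Proof.
move=> q1 mf mg; rewrite [leRHS](congr2 (fun a b => (a + b)%E) (wLp_normE q f) (wLp_normE q g)).
apply: le_trans (minkowski_EFin _ (measurable_normcw mf) (measurable_normcw mg) q1).
rewrite unlock /wLp_norm gt0_ler_poweR ?in_itv/= ?leey ?andbT//.
- by rewrite invr_ge0 (le_trans ler01).
- by apply: integral_ge0 => x _; rewrite lee_fin mulr_ge0 ?powR_ge0.
- by apply: integral_ge0 => x _; rewrite lee_fin powR_ge0.
apply: ge0_le_integral => //.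
- by move=> x _; rewrite lee_fin mulr_ge0 ?powR_ge0.
- by apply: measurable_powR_normcw; exact: cmeasurableD.
- apply/measurable_EFinP; apply: (measurableT_comp (measurable_powR q)).
  by apply: measurableT_comp => //; apply: measurable_funD; exact: measurable_normcw.
move=> x _; rewrite lee_fin -powRM ?normc_ge0//.
rewrite ge0_ler_powR ?nnegrE ?(le_trans ler01 q1) ?mulr_ge0 ?normc_ge0//.
by rewrite -mulrDl ger0_norm ?mulr_ge0 ?addr_ge0 ?normc_ge0// ler_wpM2r// normcD.
Qed.

Lemma wLp_normZ q (c : R[i]) f : 0 < q -> cmeasurable f ->
  wLp_norm q w (fun x => c * f x) = ((normc c)%:E * wLp_norm q w f)%E.
Proof.
move=> q0 mf; rewrite /wLp_norm.
under eq_integral => x _ do rewrite normcM powRM ?normc_ge0// -mulrA EFinM.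
rewrite ge0_integralZl//; last 3 first.
- exact: measurable_powR_normcw.
- by move=> x _; rewrite lee_fin mulr_ge0 ?powR_ge0.
- by rewrite lee_fin powR_ge0.
rewrite poweRM ?lee_fin ?powR_ge0//; last first.
  by apply: integral_ge0 => x _; rewrite lee_fin mulr_ge0 ?powR_ge0.
by rewrite poweR_EFin -powRrM divff ?gt_eqF// powRr1 ?normc_ge0.
Qed.

Lemma ae_eq_wLp_norm q f g : 0 < q -> cmeasurable f -> cmeasurable g ->
  {ae Leb n, forall x, f x = g x} -> wLp_norm q w f = wLp_norm q w g.
Proof.
move=> q0 mf mg fg; apply/eqP; rewrite eq_le !wLp_norm_le//.
  by move: fg; apply: filterS => x ->.
by move: fg; apply: filterS => x ->.
Qed.

Lemma wLp_norm_sum q (F : nat -> Rn -> R[i]) N (C : R) : 1 <= q ->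
  (forall k, cmeasurable (F k)) -> (forall k, (wLp_norm q w (F k) <= C%:E)%E) ->
  (wLp_norm q w (fun x => \sum_(k < N) F k x)%R <= (N%:R * C)%:E)%E.
Proof.
move=> q1 mF FC; have q0 : 0 < q by exact: lt_le_trans ltr01 q1.
elim: N => [|N IH].
  rewrite mul0r; under [X in wLp_norm q w X]eq_fun do rewrite big_ord0.
  have -> : (fun _ : Rn => 0 : R[i]) = (fun x => 0 * F 0%N x).
    by apply/funext => x; rewrite mul0r.
  by rewrite wLp_normZ// normc0 mul0e.
under [X in wLp_norm q w X]eq_fun do rewrite big_ord_recr /=.
apply: le_trans (wLp_normD _ _ _) _ => //; first exact: cmeasurable_sum.
by rewrite -natr1 mulrDl mul1r EFinD leeD.
Qed.

Lemma wLpD q f g : 1 <= q -> wLp q w f -> wLp q w g -> wLp q w (fun x => f x + g x).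
Proof.
move=> q1 [mf nf] [mg ng]; split; first exact: cmeasurableD.
by apply: le_lt_trans (wLp_normD q1 mf mg) _; exact: lte_add_pinfty.
Qed.

Lemma wLpZ q c f : 0 < q -> wLp q w f -> wLp q w (fun x => c * f x).
Proof.
move=> q0 [mf nf]; split; first by apply: cmeasurableM => //; exact: cmeasurable_cst.
rewrite (wLp_normZ _ q0 mf); apply: lte_mul_pinfty; last exact: nf.
  by rewrite lee_fin normc_ge0.
by [].
Qed.

Lemma wLp0 q : 0 < q -> wLp q w (fun=> 0).
Proof.
move=> q0; split; first exact: cmeasurable_cst.
rewrite /wLp_norm; under eq_integral do rewrite normc0 powR0 ?gt_eqF// mul0r.
by rewrite integral0 poweR0r// invr_neq0// gt_eqF.
Qed.

Lemma wLp_sum q (F : nat -> Rn -> R[i]) N : 1 <= q -> (forall k, wLp q w (F k)) ->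
  wLp q w (fun x => \sum_(k < N) F k x).
Proof.
move=> q1 wF; elim: N => [|N IH].
  by under [X in wLp q w X]eq_fun do rewrite big_ord0; apply: wLp0; exact: lt_le_trans ltr01 q1.
rewrite (_ : (fun _ => _) = (fun x => \sum_(k < N) F k x + F N x)).
  exact: (wLpD q1 IH (wF N)).
by apply/funext => x; rewrite big_ord_recr.
Qed.

(** At each point at most one term is nonzero, so the p-th power of the sum is the sum of the p-th
    powers. *)
Lemma wLp_norm_disjoint_sum p (F : nat -> Rn -> R[i]) N : 0 < p ->
  (forall k, cmeasurable (F k)) -> (forall k, (wLp_norm p w (F k) <= 1)%E) ->
  (forall j k x, j != k -> F j x = 0 \/ F k x = 0) ->
  (\int[Leb n]_x (normc (\sum_(k < N) F k x)%R `^ p * w x `^ p)%:E <= N%:R%:E)%E.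
Proof.
move=> p0 mF F1 dF; elim: N => [|N IH].
  by under eq_integral do rewrite big_ord0 normc0 powR0 ?gt_eqF// mul0r; rewrite integral0.
under eq_integral => x _.
  rewrite big_ord_recr /= (_ : normc _ `^ p * _ =
    normc (\sum_(i < N) F i x) `^ p * w x `^ p + normc (F N x) `^ p * w x `^ p); last first.
    have [->|FN] := eqVneq (F N x) 0.
      by rewrite addr0 normc0 powR0 ?gt_eqF// mul0r addr0.
    rewrite big1 => [|i _]; first by rewrite add0r normc0 powR0 ?gt_eqF// mul0r add0r.
    have [//|F0] := dF i N x (negbT (ltn_eqF (ltn_ord i))).
    by rewrite F0 eqxx in FN.
  rewrite EFinD; over.
rewrite ge0_integralD//; last 4 first.
- by move=> x _; rewrite lee_fin mulr_ge0 ?powR_ge0.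
- by apply: measurable_powR_normcw; exact: cmeasurable_sum.
- by move=> x _; rewrite lee_fin mulr_ge0 ?powR_ge0.
- exact: measurable_powR_normcw.
rewrite -natr1 EFinD; apply: leeD => //.
set I := (\int[_]_x _)%E; have I0 : (0 <= I)%E.
  by apply: integral_ge0 => x _; rewrite lee_fin mulr_ge0 ?powR_ge0.
have -> : I = (wLp_norm p w (F N) `^ p)%E by rewrite -poweRrM mulVf ?gt_eqF// poweRe1.
rewrite -[leRHS](poweR1r p) gt0_ler_poweR ?in_itv/= ?leey ?andbT ?(ltW p0)//.
exact: wLp_norm_ge0.
Qed.

End weighted.

(** * Compact operators on disjointly supported functions *)

Section compactness.
Context {R : realType} {n : nat}.
Local Notation Rn := 'rV[R]_n.
Variables (w : Rn -> R) (p q : R) (S : (Rn -> R[i]) -> Rn -> R[i]).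
Hypothesis mw : measurable_fun setT w.
Hypothesis w0 : forall x, 0 <= w x.
Hypotheses (p1 : 1 < p) (q1 : 1 < q).
Hypothesis cS : compact_operator p q w S.

Let p0 : 0 < p. Proof. exact: lt_trans ltr01 p1. Qed.
Let q0 : 0 < q. Proof. exact: lt_trans ltr01 q1. Qed.

(** [S] is linear only almost everywhere: each use of linearity costs a null set, and a finite sum
    costs finitely many. That [S] kills 0 follows from S 0 = S 0 + S 0. *)
Lemma compact_operator_sum (F : nat -> Rn -> R[i]) (c : R[i]) N :
  (forall k, wLp p w (F k)) ->
  {ae Leb n, forall x, S (fun y => c * \sum_(k < N) F k y) x = c * \sum_(k < N) S (F k) x}.
Proof.
move=> wF; have [_ _ Slin _] := cS.
have S0 : {ae Leb n, forall x, S (fun=> 0) x = 0}.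
  have := Slin 1 (fun=> 0) (fun=> 0) (wLp0 w p0) (wLp0 w p0).
  rewrite (_ : (fun _ => 1 * 0 + 0) = (fun=> 0)); last first.
    by apply/funext => y; rewrite mul1r addr0.
  by apply: filterS => x; rewrite mul1r -[LHS]addr0 => /addrI.
have Ssum : {ae Leb n, forall x, S (fun y => \sum_(k < N) F k y) x = \sum_(k < N) S (F k) x}.
  elim: N => [|N IH].
    rewrite (_ : (fun _ => _) = (fun=> 0)); last by apply/funext => y; rewrite big_ord0.
    by move: S0; apply: filterS => x ->; rewrite big_ord0.
  have := Slin 1 _ _ (wF N) (wLp_sum mw w0 N (ltW p1) wF).
  rewrite (_ : (fun _ => 1 * _ + _) = (fun y => \sum_(k < N.+1) F k y)); last first.
    by apply/funext => y; rewrite mul1r addrC big_ord_recr.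
  by apply: filterS2 IH => x -> ->; rewrite mul1r addrC big_ord_recr.
have := Slin c _ _ (wLp_sum mw w0 N (ltW p1) wF) (wLp0 w p0).
rewrite (_ : (fun _ => c * _ + 0) = (fun y => c * \sum_(k < N) F k y)); last first.
  by apply/funext => y; rewrite addr0.
by apply: filterS3 S0 Ssum => x -> -> ->; rewrite addr0.
Qed.

(* The normalised partial sums [N^(-1/p) sum_(k < N) F k] have norm at most 1,
   while the averages of the [S (F k)] stay close to a nonzero limit. *)
Lemma compact_operator_disjoint (F : nat -> Rn -> R[i]) (c : R) : 0 < c ->
  (forall k, wLp p w (F k)) -> (forall k, (wLp_norm p w (F k) <= 1)%E) ->
  (forall j k x, j != k -> F j x = 0 \/ F k x = 0) ->
  ~ (forall k, (c%:E <= wLp_norm q w (S (F k)))%E).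
Proof.
move=> c0 wF F1 dF FS; have [SLq _ _ Scpt] := cS.
have [j [g [jinc gL jg]]] := Scpt F wF (ex_intro _ 1 F1).
have c4 : 0 < c / 4 by rewrite divr_gt0.
(* From index K on, the images stay within c / 4 of the limit [g], whose norm is therefore at least
   3 c / 4. *)
have [K Kc] : exists K, forall k, (K <= k)%N ->
    (wLp_norm q w (fun x => S (F (j k)) x - g x)%R <= (c / 4)%:E)%E.
  move/fine_cvgP : jg => [[K1 _ jf] /cvgrPdist_le /(_ _ c4) [K2 _ jK]].
  exists (maxn K1 K2) => k; rewrite geq_max => /andP[k1 k2].
  have := jK k k2; rewrite /= sub0r normrN => h.
  by rewrite -(fineK (jf k k1)) lee_fin; apply: le_trans h; exact: ler_norm.
pose G k := F (j (K + k)%N).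
have wG k : wLp p w (G k) by exact: wF.
have mG k : cmeasurable (G k) by have [] := wG k.
have mSG k : cmeasurable (S (G k)) by have [] := SLq _ (wG k).
have dG i k x : i != k -> G i x = 0 \/ G k x = 0.
  move=> ik; apply: dF; apply: contra ik => /eqP jj.
  have [ik'|ki|//] := ltngtP i k.
    have /jinc : (K + i < K + k)%N by rewrite ltn_add2l.
    by rewrite jj ltnn.
  have /jinc : (K + k < K + i)%N by rewrite ltn_add2l.
  by rewrite jj ltnn.
have mg : cmeasurable g by have [] := gL.
have gc : ((3 * (c / 4))%:E <= wLp_norm q w g)%E.
  have := FS (j K).
  have -> : wLp_norm q w (S (F (j K))) =
      wLp_norm q w (fun x => (S (F (j K)) x - g x) + g x)%R.
    by congr wLp_norm; apply/funext => x; rewrite subrK.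
  have mSF : cmeasurable (S (F (j K))) by have [] := SLq _ (wF (j K)).
  move=> /le_trans /(_ (wLp_normD mw w0 (ltW q1) (cmeasurableB mSF mg) mg)) h.
  have := le_trans h (leeD2r _ (Kc K (leqnn K))).
  case: (wLp_norm q w g) (wLp_norm_ge0 w q g) => [r| |]//= _; last by move=> *; exact: leey.
  by rewrite -EFinD !lee_fin => ?; lra.
have gfin : wLp_norm q w g \is a fin_num.
  by have [_ nf] := gL; rewrite ge0_fin_numE ?wLp_norm_ge0.
(* The factor -1 makes [S (G k) + D k] equal to [g], so that N g splits into the sum of the images
   and a small remainder. *)
pose D k : Rn -> R[i] := fun x => -1 * (S (G k) x - g x).
have mD k : cmeasurable (D k).
  by apply: cmeasurableM; [exact: cmeasurable_cst|exact: cmeasurableB].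
pose H k : Rn -> R[i] := S (G k).
have mH k : cmeasurable (H k) by exact: mSG.
(* N (3 c / 4) minus the remainder N (c / 4). *)
have sumG N : ((N%:R * (c / 2))%:E <= wLp_norm q w (fun x => \sum_(k < N) H k x)%R)%E.
  have h1 : (wLp_norm q w (fun x => (N%:R * g x)%R) <= wLp_norm q w (fun x => \sum_(k < N) H k x)%R
      + wLp_norm q w (fun x => \sum_(k < N) D k x)%R)%E.
    apply: (@le_trans _ _ (wLp_norm q w (fun x => \sum_(k < N) H k x + \sum_(k < N) D k x)%R)).
      rewrite (_ : (fun x => _ + _) = (fun x => N%:R * g x)); first exact: le_refl.
      apply/funext => x; rewrite -big_split /= (eq_bigr (fun=> g x)).
        by rewrite sumr_const card_ord mulr_natl.
      by move=> k _; rewrite /D mulN1r opprB addrC subrK.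
    exact: (wLp_normD mw w0 (ltW q1) (cmeasurable_sum N mH) (cmeasurable_sum N mD)).
  have h2 : (wLp_norm q w (fun x => \sum_(k < N) D k x)%R <= (N%:R * (c / 4))%:E)%E.
    apply: (wLp_norm_sum mw w0 N (ltW q1) mD) => k.
    rewrite /D (wLp_normZ mw _ q0 (cmeasurableB (mSG k) mg)).
    by rewrite normcN normc1 mul1e; apply: Kc; exact: leq_addr.
  move: h1; rewrite (wLp_normZ mw _ q0 mg) => /le_trans /(_ (leeD2l _ h2)).
  have -> : normc (N%:R : R[i]) = N%:R.
    by rewrite -(rmorph_nat (real_complex R)) normc_real ger0_norm.
  move: gc; rewrite -(fineK gfin) lee_fin => gc.
  case: (wLp_norm q w (fun x => \sum_(k < N) H k x)%R) (wLp_norm_ge0 w q (fun x => \sum_(k < N) H k x))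
    => [r| |]//= _; last by move=> *; exact: leey.
  rewrite -EFinM -EFinD !lee_fin => h; have : N%:R * (3 * (c / 4)) <= N%:R * fine (wLp_norm q w g).
    by rewrite ler_wpM2l.
  have -> : N%:R * (3 * (c / 4)) = N%:R * (c / 2) + N%:R * (c / 4) by field.
  by move: h; set t := N%:R * _; set t' := N%:R * (c / 4); set t'' := N%:R * (c / 2); lra.
(* Normalises a sum of N + 1 disjoint functions of norm at most 1, for which p-th powers of norms
   add. *)
pose a N : R := N.+1%:R `^ (- p^-1).
have a0 N : 0 <= a N by exact: powR_ge0.
pose u N : Rn -> R[i] := fun x => (a N)%:C%C * \sum_(k < N.+1) G k x.
have uL N : wLp p w (u N) by apply: wLpZ => //; apply: wLp_sum => //; exact: ltW.
have u1 N : (wLp_norm p w (u N) <= 1%:E)%E.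
  rewrite wLp_normZ//; last exact: cmeasurable_sum.
  rewrite normc_real ger0_norm//.
  have h : (wLp_norm p w (fun x => \sum_(k < N.+1) G k x)%R <= (N.+1%:R `^ p^-1)%:E)%E.
    rewrite -poweR_EFin /wLp_norm gt0_ler_poweR ?in_itv/= ?leey ?andbT//.
    - by rewrite invr_ge0 ltW.
    - by apply: integral_ge0 => x _; rewrite lee_fin mulr_ge0 ?powR_ge0.
    - exact: (wLp_norm_disjoint_sum mw N.+1 p0 mG (fun k => F1 (j (K + k)%N)) dG).
  apply: (le_trans (lee_wpmul2l _ h)); first by rewrite lee_fin.
  by rewrite -EFinM lee_fin /a powRN mulVf// powR_eq0 pnatr_eq0.
(* A second convergent subsequence, of the images of the normalised sums, bounds these images by
   [B], whereas their lower bound grows like N^(1 - 1/p). *)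
have [i [v [iinc vL iv]]] := Scpt u uL (ex_intro _ 1 u1).
have igt N : (N <= i N)%N.
  by elim: N => // N IH; apply: (leq_ltn_trans IH); exact: iinc.
pose B := fine (wLp_norm q w v) + 1.
have [M MB] : exists M, forall N, (M <= N)%N -> (wLp_norm q w (S (u (i N))) <= B%:E)%E.
  move/fine_cvgP : iv => [[K1 _ jf] /cvgrPdist_le /(_ _ ltr01) [K2 _ jK]].
  exists (maxn K1 K2) => k; rewrite geq_max => /andP[k1 k2].
  have := jK k k2; rewrite /= sub0r normrN => h.
  have [mv nv] := vL; have [mSu _] := SLq _ (uL (i k)).
  have -> : wLp_norm q w (S (u (i k))) =
      wLp_norm q w (fun x => (S (u (i k)) x - v x) + v x)%R.
    by congr wLp_norm; apply/funext => x; rewrite subrK.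
  apply: le_trans (wLp_normD mw w0 (ltW q1) (cmeasurableB mSu mv) mv) _.
  have vfin : wLp_norm q w v \is a fin_num by rewrite ge0_fin_numE ?wLp_norm_ge0.
  rewrite /B EFinD fineK// [leLHS]addeC; apply: leeD2l.
  rewrite -(fineK (jf k k1)) lee_fin.
  by apply: le_trans h; exact: ler_norm.
have Slow N : ((a N * (N.+1%:R * (c / 2)))%:E <= wLp_norm q w (S (u N)))%E.
  have [mSu _] := SLq _ (uL N).
  have -> : wLp_norm q w (S (u N)) =
      wLp_norm q w (fun x => (a N)%:C%C * \sum_(k < N.+1) H k x)%R.
    apply: ae_eq_wLp_norm => //; last exact: compact_operator_sum.
    by apply: cmeasurableM; [exact: cmeasurable_cst|exact: cmeasurable_sum].
  rewrite wLp_normZ//; last exact: cmeasurable_sum.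
  rewrite normc_real ger0_norm; last exact: a0.
  by rewrite EFinM; apply: lee_wpmul2l; [rewrite lee_fin; exact: a0|exact: sumG].
have e0 : 0 < 1 - p^-1 by rewrite subr_gt0 invf_lt1.
have aN N : a N * (N.+1%:R * (c / 2)) = N.+1%:R `^ (1 - p^-1) * (c / 2).
  by rewrite mulrA; congr (_ * _); rewrite /a powRD ?powRr1 1?mulrC// pnatr_eq0 implybT.
(* Solves t^(1 - 1/p) c / 2 = B. *)
pose t := (2 * B / c) `^ (1 - p^-1)^-1.
have B0 : 0 < B.
  by apply: ltr_wpDl; [apply: fine_ge0; exact: wLp_norm_ge0|exact: ltr01].
pose N := maxn M (Num.truncn t).+1.
have := le_trans (Slow (i N)) (MB N (leq_maxl _ _)).
rewrite lee_fin aN leNgt => /negP; apply.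
have tN : t < (i N).+1%:R.
  apply: (@lt_le_trans _ _ (Num.truncn t).+1%:R); first by rewrite truncnS_gt.
  by rewrite ler_nat; apply: leq_trans (leqW (igt N)); exact: leq_maxr.
have : t `^ (1 - p^-1) < (i N).+1%:R `^ (1 - p^-1).
  by apply: gt0_ltr_powR => //; rewrite ?nnegrE ?powR_ge0.
rewrite -powRrM mulVf ?gt_eqF// powRr1; last by rewrite !mulr_ge0 ?invr_ge0 ?(ltW B0) ?(ltW c0).
by rewrite ltr_pdivrMr// => h; rewrite mulrA ltr_pdivlMr// mulrC.
Qed.

End compactness.

(** * The commutator away from the support *)

Section complex_integral.
Context {R : realType} {n : nat}.
Local Notation Rn := 'rV[R]_n.
Implicit Types f g : Rn -> R[i].

Definition cintegrable f :=
  (Leb n).-integrable setT (EFin \o (fun x => complex.Re (f x))) /\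
  (Leb n).-integrable setT (EFin \o (fun x => complex.Im (f x))).

Lemma cintegrable_bounded (P : set Rn) f (M : R) : measurable P ->
  (Leb n P < +oo)%E -> cmeasurable f -> (forall x, ~ P x -> f x = 0) ->
  (forall x, normc (f x) <= M) -> cintegrable f.
Proof.
move=> mP Pfin [mf1 mf2] f0 fM.
have H (u : Rn -> R) : measurable_fun setT u -> (forall x, ~ P x -> u x = 0) ->
    (forall x, `|u x| <= M) -> (Leb n).-integrable setT (EFin \o u).
  move=> mu u0 uM; have -> : EFin \o u = (EFin \o u) \_ P.
    apply/funext => x; rewrite patchE; case: ifPn => // /negP; rewrite inE => /u0 /= -> //.
  apply/(integrable_mkcond _ mP); apply: measurable_bounded_integrable => //.
    exact: measurable_funS mu.
  by exists M; split=> [|y My x Px]; [exact: num_real|exact: le_trans (uM x) (ltW My)].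
split; apply: H => //.
- by move=> x /f0 ->.
- by move=> x; exact: le_trans (abs_Re_le _) (fM x).
- by move=> x /f0 ->.
- by move=> x; exact: le_trans (abs_Im_le _) (fM x).
Qed.

Lemma cintegrableZ c f : cintegrable f -> cintegrable (fun x => c * f x).
Proof.
move=> [f1 f2]; split.
  rewrite (_ : EFin \o _ = fun x => (((complex.Re c)%:E * (complex.Re (f x))%:E)
      - ((complex.Im c)%:E * (complex.Im (f x))%:E))%E); last first.
    by apply/funext => x; rewrite /= ReM EFinB !EFinM.
  by apply: integrableB => //; exact: integrableZl.
rewrite (_ : EFin \o _ = fun x => (((complex.Re c)%:E * (complex.Im (f x))%:E)
    + ((complex.Im c)%:E * (complex.Re (f x))%:E))%E); last first.
  by apply/funext => x; rewrite /= ImM EFinD !EFinM.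
by apply: integrableD => //; exact: integrableZl.
Qed.

Lemma cintegrableB f g : cintegrable f -> cintegrable g -> cintegrable (fun x => f x - g x).
Proof.
move=> [f1 f2] [g1 g2]; split.
  rewrite (_ : EFin \o _ = fun x => ((complex.Re (f x))%:E - (complex.Re (g x))%:E)%E).
    exact: integrableB.
  by apply/funext => x; rewrite /= ReD ReN.
rewrite (_ : EFin \o _ = fun x => ((complex.Im (f x))%:E - (complex.Im (g x))%:E)%E).
  exact: integrableB.
by apply/funext => x; rewrite /= ImD ImN.
Qed.

Lemma integrable_scale (u : Rn -> R) (c : R) : (Leb n).-integrable setT (EFin \o u) ->
  (Leb n).-integrable setT (EFin \o (fun x => c * u x)).
Proof.
move=> iu; rewrite (_ : EFin \o _ = fun x => (c%:E * (EFin \o u) x)%E).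
  exact: integrableZl.
by apply/funext => x; rewrite /= EFinM.
Qed.

Lemma eq_complex (z t : R[i]) : complex.Re z = complex.Re t ->
  complex.Im z = complex.Im t -> z = t.
Proof. by case: z => a b; case: t => c d /= -> ->. Qed.

Lemma cintegralZ c f : cintegrable f ->
  cintegral setT (fun x => c * f x) = c * cintegral setT f.
Proof.
move=> [f1 f2]; apply: eq_complex.
  rewrite ReM /=; transitivity (\int[Leb n]_x
      (complex.Re c * complex.Re (f x) - complex.Im c * complex.Im (f x)))%R.
    by apply: eq_Rintegral => x _; rewrite ReM.
  rewrite RintegralB// ?RintegralZl//; exact: integrable_scale.
rewrite ImM /=; transitivity (\int[Leb n]_x
    (complex.Re c * complex.Im (f x) + complex.Im c * complex.Re (f x)))%R.
  by apply: eq_Rintegral => x _; rewrite ImM.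
rewrite RintegralD// ?RintegralZl//; exact: integrable_scale.
Qed.

Lemma cintegralB f g : cintegrable f -> cintegrable g ->
  cintegral setT (fun x => f x - g x) = cintegral setT f - cintegral setT g.
Proof.
move=> [f1 f2] [g1 g2]; apply: eq_complex.
  rewrite ReD ReN /= -RintegralB//; apply: eq_Rintegral => x _.
  by rewrite ReD ReN.
rewrite ImD ImN /= -RintegralB//; apply: eq_Rintegral => x _.
by rewrite ImD ImN.
Qed.

End complex_integral.

Section commutator_formula.
Context {R : realType} {n : nat}.
Local Notation Rn := 'rV[R]_n.
Variables (Omega : Rn -> R) (alpha : R) (b : Rn -> R[i]) (P : set Rn) (x : Rn).
Hypothesis mb : cmeasurable b.
Hypothesis mP : measurable P.
Hypothesis finP : (Leb n P < +oo)%E.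
Variables (d C : R).
Hypothesis d0 : 0 < d.
Hypothesis C0 : 0 <= C.
Hypothesis Pd : forall y, P y -> d <= enorm (x - y).
Hypothesis mK : measurable_fun setT (fun y : Rn => rough_kernel Omega alpha (x - y)).
Hypothesis PK : forall y, P y -> `|rough_kernel Omega alpha (x - y)| <= C.
Implicit Types g : Rn -> R[i].

Local Notation K := (fun y : Rn => (rough_kernel Omega alpha (x - y))%:C%C).

Definition bounded_on_support g := [/\ cmeasurable g, (forall y, ~ P y -> g y = 0) &
  exists M, forall y, normc (g y) <= M].

(** A truncation at e < d does not touch [P], so the principal value is the limit of an eventually
    constant function. *)
Lemma T_op_far g : bounded_on_support g ->
  T_op Omega alpha g x = cintegral setT (fun y => K y * g y).
Proof.
move=> [mg g0 _]; rewrite /T_op; case: ifPn => // _; rewrite /clim0.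
have H (u : Rn -> R) : (forall y, ~ P y -> u y = 0) ->
  lim ((\int[Leb n]_(y in [set y | (e < enorm (x - y))%R]) u y)%R @[e --> 0^'+]) =
  (\int[Leb n]_y u y)%R.
  move=> u0; apply: lim_near_cst; first exact: Rhausdorff.
  near=> e; rewrite Rintegral_mkcond; apply: eq_Rintegral => y _.
  rewrite patchE; case: ifPn => // /negP; rewrite inE /= => h.
  apply/esym/u0 => Py; apply: h; apply: lt_le_trans (Pd Py); near: e.
  exact: nbhs_right_lt.
have Kg0 y : ~ P y -> K y * g y = 0 by move=> /g0 ->; rewrite mulr0.
apply: eq_complex => /=; apply: H => y /Kg0 -> //.
Unshelve. all: by end_near.
Qed.

Lemma cintegrable_kernel0 g : bounded_on_support g -> cintegrable (fun y => K y * g y).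
Proof.
move=> [mg g0 [M gM]]; apply: (@cintegrable_bounded _ _ P _ (C * M)) => //.
- by apply: cmeasurableM; first exact: cmeasurable_real.
- by move=> y /g0 ->; rewrite mulr0.
move=> y; rewrite normcM normc_real; have [Py|/g0 ->] := pselect (P y).
  by apply: ler_pM => //; [exact: normc_ge0|exact: PK].
by rewrite normc0 mulr0 mulr_ge0// (le_trans (normc_ge0 _) (gM y)).
Qed.

(** Shaped after the recursion of the commutator, which passes from g to b g and uses up one power
    of b. *)
Definition bounded_powers j g :=
  forall k, (k <= j)%N -> bounded_on_support (fun y => b y ^+ k * g y).

Lemma bounded_powers0 j g : bounded_powers j g -> bounded_on_support g.
Proof.
move=> /(_ 0%N (leq0n j)).
by rewrite (_ : (fun y => b y ^+ 0 * g y) = g)//; apply/funext => y; rewrite expr0 mul1r.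
Qed.

Lemma bounded_powersW j g : bounded_powers j.+1 g -> bounded_powers j g.
Proof. by move=> h k kj; apply: h; exact: leqW. Qed.

Lemma bounded_powersS j g : bounded_powers j.+1 g -> bounded_powers j (fun y => b y * g y).
Proof.
move=> h k kj; have := h k.+1 kj.
by rewrite (_ : (fun y => b y ^+ k.+1 * g y) = (fun y => b y ^+ k * (b y * g y)))//;
  apply/funext => y; rewrite exprSr mulrA.
Qed.

Let expandS j g : (fun y => (b x - b y) ^+ j.+1 * (K y * g y)) =
  (fun y => b x * ((b x - b y) ^+ j * (K y * g y)) -
    (b x - b y) ^+ j * (K y * (b y * g y))).
Proof.
by apply/funext => y; rewrite exprS; ring.
Qed.

Lemma cintegrable_kernel j g : bounded_powers j g ->
  cintegrable (fun y => (b x - b y) ^+ j * (K y * g y)).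
Proof.
elim: j g => [|j IH] g gb.
  under [X in cintegrable X]eq_fun do rewrite expr0 mul1r.
  exact/cintegrable_kernel0/(bounded_powers0 gb).
rewrite expandS; apply: cintegrableB.
  by apply: cintegrableZ; apply: IH; exact: bounded_powersW.
by apply: IH; exact: bounded_powersS.
Qed.

(** One commutator step is the identity (b(x) - b(y))^(j+1) = b(x) (b(x) - b(y))^j - (b(x) - b(y))^j
    b(y) under the integral, which splits because both terms are integrable. *)
Lemma iter_commutator_far j g : bounded_powers j g ->
  iter_commutator j b (T_op Omega alpha) g x =
  cintegral setT (fun y => (b x - b y) ^+ j * (K y * g y)).
Proof.
elim: j g => [|j IH] g gb.
  under [X in cintegral _ X]eq_fun do rewrite expr0 mul1r.
  exact/T_op_far/(bounded_powers0 gb).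
have gb' := bounded_powersW gb; have gbS := bounded_powersS gb.
rewrite /iter_commutator iterS /commutator -/(iter_commutator j b _).
rewrite (IH _ gb') (IH _ gbS) -cintegralZ; last exact: cintegrable_kernel.
rewrite -cintegralB ?expandS//; last exact: cintegrable_kernel.
by apply: cintegrableZ; exact: cintegrable_kernel.
Qed.

End commutator_formula.

Lemma continuous_sum {R : realType} (T : topologicalType) (I : Type) (s : seq I)
    (F : I -> T -> R) :
  (forall i, continuous (F i)) -> continuous (fun x => \sum_(i <- s) F i x).
Proof.
move=> cF; elim: s => [|i s IH].
  rewrite (_ : (fun _ => _) = cst 0); first exact: cst_continuous.
  by apply/funext => x; rewrite big_nil.
rewrite (_ : (fun _ => _) = F i \+ (fun x => \sum_(j <- s) F j x)).
  by move=> x; exact: (continuousD (cF i x) (IH x)).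
by apply/funext => x; rewrite big_cons.
Qed.

(** * Rough kernels *)

Section euclidean.
Context {R : realType} {n : nat}.
Local Notation Rn := 'rV[R]_n.
Implicit Types x : Rn.

Lemma enorm_ge0 x : 0 <= enorm x.
Proof. exact: sqrtr_ge0. Qed.

Lemma enormZ (t : R) x : enorm (t *: x) = `|t| * enorm x.
Proof.
rewrite /enorm -[in RHS]sqrtr_sqr -sqrtrM ?sqr_ge0// mulr_sumr.
by congr Num.sqrt; apply: eq_bigr => i _; rewrite mxE exprMn.
Qed.

Lemma coord_le_enorm x i : `|x ord0 i| <= enorm x.
Proof.
rewrite -sqrtr_sqr ler_wsqrtr// (bigD1 i)//= lerDl sumr_ge0// => j _.
exact: sqr_ge0.
Qed.

Lemma enorm_le x (L : R) : 0 <= L -> (forall i, `|x ord0 i| <= L) ->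
  enorm x <= Num.sqrt n%:R * L.
Proof.
move=> L0 xL; rewrite -[L in leRHS]ger0_norm// -sqrtr_sqr -sqrtrM ?ler0n// ler_wsqrtr//.
apply: (@le_trans _ _ (\sum_(i < n) L ^+ 2)).
  by apply: ler_sum => i _; rewrite -[x _ _ ^+ 2]real_normK ?num_real// lerXn2r ?nnegrE.
by rewrite sumr_const card_ord mulr_natl.
Qed.

Lemma enorm_eq0 x : (enorm x == 0) = (x == 0).
Proof.
apply/eqP/eqP => [e0|->].
  apply/rowP => i; rewrite mxE; apply/eqP; rewrite -normr_le0.
  by have := coord_le_enorm x i; rewrite e0.
by rewrite /enorm big1 ?sqrtr0// => i _; rewrite mxE expr0n.
Qed.

Lemma enorm_gt0 x : (0 < enorm x) = (x != 0).
Proof. by rewrite lt0r enorm_eq0 enorm_ge0 andbT. Qed.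

Lemma direction_sphere x : x != 0 -> sphere n (direction x).
Proof.
move=> x0; rewrite /sphere /= /direction enormZ ger0_norm ?invr_ge0 ?enorm_ge0//.
by rewrite mulVf// enorm_eq0.
Qed.

Lemma continuous_enorm : continuous (@enorm R n).
Proof.
move=> x; apply: continuous_comp; last exact: sqrt_continuous.
apply: (continuous_sum (F := fun i (y : Rn) => y ord0 i ^+ 2)) => i {}x.
apply: (@continuous_comp _ _ _ (fun y : Rn => y ord0 i) (fun t => t ^+ 2)).
  exact: coord_continuous.
exact: exprn_continuous.
Qed.

Lemma continuous_direction x : x != 0 -> {for x, continuous (@direction R n)}.
Proof.
move=> x0; have e0 : enorm x != 0 by rewrite enorm_eq0.
exact: (cvgZ (cvgV e0 (@continuous_enorm x)) cvg_id).
Qed.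

Lemma measurable_sphere : measurable (@sphere R n).
Proof.
rewrite (_ : sphere n = setT `&` @enorm R n @^-1` [set 1]).
  by apply: measurable_enorm => //; exact: measurable_set1.
by apply/seteqP; split => x //= -[].
Qed.

Lemma open_cone (V : set Rn) : open V -> open [set x | x != 0 /\ V (direction x)].
Proof.
move=> oV; rewrite openE => x [x0 Vx]; rewrite /interior.
apply: filterI; last first.
  by apply: (continuous_direction x0); exact: open_nbhs_nbhs.
apply: open_nbhs_nbhs; split=> //.
rewrite (_ : (fun _ => _) = ~` [set (0 : Rn)]).
  by apply: closed_openC; apply: compact_closed; [exact: norm_hausdorff|exact: compact_set1].
by apply/seteqP; split => y /= /eqP.
Qed.

End euclidean.

Section rough_function.
Context {R : realType} {n : nat}.
Local Notation Rn := 'rV[R]_n.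
Variable Omega : Rn -> R.
Hypothesis mO : measurable_fun (sphere n) Omega.
Hypothesis hO : homogeneous0 Omega.

Lemma homogeneous0_direction x : x != 0 -> Omega (direction x) = Omega x.
Proof. by move=> x0; rewrite hO// invr_gt0 enorm_gt0. Qed.

(** Off the origin, Omega is its restriction to the sphere pulled back along [direction]; the
    origin, where homogeneity says nothing, is treated apart. *)
Lemma measurable_homogeneous0 : measurable_fun setT Omega.
Proof.
move=> _ Y mY; rewrite setTI.
have m0 : measurable [set x : Rn | x = 0].
  rewrite (_ : mkset _ = setT `&` @enorm R n @^-1` [set 0]).
    by apply: measurable_enorm => //; exact: measurable_set1.
  apply/seteqP; split => x /=; first by move=> ->; split=> //; apply/eqP; rewrite enorm_eq0.
  by move=> [_ /eqP]; rewrite enorm_eq0 => /eqP.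
rewrite (_ : _ @^-1` _ = ([set x : Rn | x = 0] `&` [set x | Y (Omega 0)]) `|`
  (~` [set x : Rn | x = 0] `&` (setT `&` @direction R n @^-1` (sphere n `&` Omega @^-1` Y)))).
  apply: measurableU.
    have [Y0|Y0] := pselect (Y (Omega 0)).
      by rewrite (_ : [set x | Y (Omega 0)] = setT) ?setIT//; apply/seteqP; split.
    by rewrite (_ : [set x | Y (Omega 0)] = set0) ?setI0//; apply/seteqP; split.
  apply: measurableI; first exact: measurableC.
  apply: measurable_direction => //; apply: mO => //; exact: measurable_sphere.
apply/seteqP; split => x /=.
  have [->|x0] := eqVneq x 0; first by left.
  move=> Yx; right; split; first exact/eqP.
  by split=> //; split; [exact: direction_sphere|rewrite homogeneous0_direction].
move=> [[-> //]|[/eqP x0 [_ [_]]]]; by rewrite homogeneous0_direction.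
Qed.

Lemma measurable_rough_kernel alpha (x : Rn) :
  measurable_fun setT (fun y : Rn => rough_kernel Omega alpha (x - y)).
Proof.
have mxy : measurable_fun setT (fun y : Rn => x - y).
  rewrite (_ : (fun y : Rn => x - y) = (fun y : Rn => x + (-1) *: y)).
    exact: measurable_affine_rV.
  by apply/funext => y; rewrite scaleN1r.
apply: (measurableT_comp (f := rough_kernel Omega alpha)) => //.
rewrite /rough_kernel.
rewrite (_ : (fun _ => _) = fun x : Rn => Omega x * ((enorm x `^ (n%:R - alpha)) `^ (-1))).
  apply: measurable_funM; first exact: measurable_homogeneous0.
  apply: (measurableT_comp (measurable_powR _)); apply: (measurableT_comp (measurable_powR _)).
  exact: measurable_enorm.
by apply/funext => y; rewrite powR_inv1 ?powR_ge0.
Qed.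

(** With s the sign of Omega on the open set, the cone over that set contains points with s Omega >
    0 in positive Lebesgue measure. Hence some level s Omega >= 1/(k+1) has positive measure in one
    cube of a countable cover of the cone, and [density_subcube] shrinks that cube. *)
Lemma homogeneous0_dense_cube (d : R) : 0 < d -> constant_sign_on_open Omega ->
  exists (z : Rn) (r k s : R),
  [/\ 0 < r, 0 < k, s ^+ 2 = 1,
      (forall y, cube z r y -> y != 0 /\ 0 <= s * Omega y) &
      (Leb n (cube z r `&` [set y | (s * Omega y < k)%R]) <= (d * r ^+ n)%:E)%E].
Proof.
move=> d0 [V [oV sV nV]].
have [s s2 sO] : exists2 s : R, s ^+ 2 = 1 & forall x, (V `&` sphere n) x -> 0 <= s * Omega x.
  case: sV => h; [exists 1|exists (-1)]; rewrite ?expr1n ?sqrrN ?expr1n// => x /h.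
    by rewrite mul1r.
  by rewrite mulN1r oppr_ge0.
pose C := [set x : Rn | x != 0 /\ V (direction x)].
have oC : open C by exact: open_cone.
pose A k := C `&` [set y | k.+1%:R^-1 <= s * Omega y].
have msO : measurable_fun setT (fun y => s * Omega y).
  by apply: measurable_funM => //; exact: measurable_homogeneous0.
have mle k : measurable [set y | k <= s * Omega y].
  rewrite (_ : mkset _ = setT `&` (fun y => s * Omega y) @^-1` `[k, +oo[%classic).
    by apply: msO.
  by apply/seteqP; split => x /=; rewrite in_itv/= andbT//; case.
have mA k : measurable (A k).
  by apply: measurableI => //; exact: measurable_open.
have [k Ak] : exists k, (0 < Leb n (A k))%E.
  apply: contrapT => /forallNP nA; apply: nV.
  have A0 : Leb n (\bigcup_k A k) = 0%E.
    apply: measure_negligible; first exact: bigcup_measurable.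
    apply: negligible_bigcup => k; apply/negligibleP => //.
    by apply/eqP; rewrite -measure_le0 leNgt; apply/negP; exact: nA.
  (* If all [A k] are null, so is the part in the unit ball of the cone over this set, whose measure
     is the surface measure up to the factor n. *)
  pose N := V `&` (sphere n `&` Omega @^-1` [set~ 0]).
  have mN : measurable N.
    apply: measurableI; first exact: measurable_open.
    apply: mO; first exact: measurable_sphere.
    by apply: measurableC; exact: measurable_set1.
  exists N; split=> //.
    suff h : Leb_direction n N = 0%E.
      apply: (etrans (y := (n%:R%:E * Leb_direction n N)%E)) => //.
      by rewrite h mule0.
    apply/eqP; rewrite -measure_le0 -A0.
    apply: (@le_trans _ _ (Leb n (@direction R n @^-1` N `&` @punctured_ball R n))) => //.
    apply: le_measure.
    - rewrite inE; apply: measurableI; last exact: measurable_punctured_ball.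
      by rewrite -[X in measurable X]setTI; exact: measurable_direction.
    - by rewrite inE; exact: bigcup_measurable.
    move=> x [[Vx [Sx /= Ox]] /andP[x0 _]].
    have xn0 : x != 0 by rewrite -enorm_gt0.
    rewrite homogeneous0_direction// in Ox.
    have sx : 0 < s * Omega x.
      rewrite lt0r mulf_neq0//=; last exact/eqP.
        by rewrite -homogeneous0_direction//; apply: sO.
      by apply: contra_eqN s2 => /eqP ->; rewrite expr0n eq_sym oner_eq0.
    exists (Num.truncn (s * Omega x)^-1) => //; split=> //=.
    rewrite -[leRHS]invrK lef_pV2 ?posrE ?invr_gt0// ?ltr0n//.
    by apply: ltW; exact: truncnS_gt.
  by move=> x /= /not_implyP[[Vx Sx] Ox].
have [a [l [l0 [D CD]]]] := open_bigcup_cubes oC.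
have [i Di Ai] : exists2 i, D i & (0 < Leb n (A k `&` cube (a i) (l i)))%E.
  apply: contrapT => /forall2NP h; move: Ak; apply/negP; rewrite -leNgt measure_le0; apply/eqP.
  apply: measure_negligible => //.
  apply: (@negligibleS _ _ _ _ (\bigcup_i (if i \in D then A k `&` cube (a i) (l i) else set0))).
    move=> x Ax; have [Cx _] := Ax; move: Cx; rewrite CD => -[i Di xi].
    by exists i => //; rewrite mem_set.
  apply: negligible_bigcup => i; case: ifPn => [/set_mem Di|_]; last exact: negligible_set0.
  apply/negligibleP; first by apply: measurableI => //; exact: measurable_cube.
  by have [//|/negP] := h i; rewrite -leNgt measure_le0 => /eqP.
have [z [r [r0 zr Lz]]] := density_subcube (l0 i) (mA k) d0 Ai.
have zC : cube z r `<=` C.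
  by move=> x /zr xi; rewrite CD; exists i.
exists z, r, k.+1%:R^-1, s; split=> //.
- move=> y /zC[y0 Vy]; split=> //; rewrite -homogeneous0_direction//.
  by apply: sO; split=> //; exact: direction_sphere.
- apply: le_trans Lz; apply: le_measure.
  + rewrite inE; apply: measurableI; first exact: measurable_cube.
    rewrite (_ : mkset _ = ~` [set y | k.+1%:R^-1 <= s * Omega y]); first exact: measurableC.
    by apply/seteqP; split => y /=; rewrite ltNge => /negP.
  + by rewrite inE; apply: measurableD => //; exact: measurable_cube.
  + by move=> y [zy] /= yk; split=> // -[_] /=; rewrite leNgt yk.
Qed.

End rough_function.

(** * Medians and weights *)

Section measure_aux.
Context d {T : measurableType d} {R : realType}.
Variable mu : {measure set T -> \bar R}.

Lemma small_tail (F : nat -> set T) (e : R) : 0 < e ->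
  (forall k, measurable (F k)) -> (mu (F 0%N) < +oo)%E ->
  (forall j k, (j <= k)%N -> F k `<=` F j) -> (forall x, ~ forall k, F k x) ->
  exists k, (mu (F k) <= e%:E)%E.
Proof.
move=> e0 mF F0 Fd nF.
have c : (mu \o F) x @[x --> \oo] --> 0%E.
  rewrite -(measure0 mu) (_ : set0 = \bigcap_k F k).
    apply: nonincreasing_cvg_mu => //; first exact: bigcapT_measurable.
    by move=> i j ij; apply/subsetPset; exact: Fd.
  by apply/seteqP; split => // x /= H; apply: (nF x) => k; exact: H.
move/fine_cvgP : c => [[K1 _ ff] /cvgrPdist_le /(_ _ e0) [K2 _ fK]].
exists (maxn K1 K2); have := fK _ (leq_maxr K1 K2); rewrite /= sub0r normrN => h.
by rewrite -[X in (X <= _)%E](fineK (ff _ (leq_maxl K1 K2))) lee_fin; apply: le_trans h; exact: ler_norm.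
Qed.

(** M is the infimum of the levels whose sublevel set fills half of P. Both inequalities hold up to
    the slices M < f <= M + 1/(k+1) and M - 1/(k+1) < f < M, whose measures tend to 0. *)
Lemma median (P : set T) (f : T -> R) (t : R) : measurable P -> 0 < t ->
  mu P = t%:E -> measurable_fun setT f ->
  exists M, ((t / 2)%:E <= mu (P `&` [set x | (f x <= M)%R]))%E /\
            ((t / 2)%:E <= mu (P `&` [set x | (M <= f x)%R]))%E.
Proof.
move=> mP t0 Pt mf.
have mle M : measurable [set x | f x <= M].
  rewrite (_ : mkset _ = setT `&` f @^-1` `]-oo, M]%classic); first exact: mf.
  by apply/seteqP; split => x /=; rewrite in_itv//=; case.
have mge M : measurable [set x | M <= f x].
  rewrite (_ : mkset _ = setT `&` f @^-1` `[M, +oo[%classic); first exact: mf.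
  by apply/seteqP; split => x /=; rewrite in_itv//= andbT//; case.
have mlt M : measurable [set x | f x < M].
  rewrite (_ : mkset _ = setT `&` f @^-1` `]-oo, M[%classic); first exact: mf.
  by apply/seteqP; split => x /=; rewrite in_itv//=; case.
have mgt M : measurable [set x | M < f x].
  rewrite (_ : mkset _ = setT `&` f @^-1` `]M, +oo[%classic); first exact: mf.
  by apply/seteqP; split => x /=; rewrite in_itv//= andbT//; case.
have fin A : measurable A -> (mu (P `&` A) < +oo)%E.
  move=> mA; apply: (@le_lt_trans _ _ (mu P)); last by rewrite Pt ltry.
  by apply: le_measure; rewrite ?inE//; exact: measurableI.
have split_ge A B : measurable A -> measurable B -> P `<=` A `|` B ->
    (mu (P `&` A) <= (t / 2)%:E)%E -> ((t / 2)%:E <= mu (P `&` B))%E.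
  move=> mA mB PAB hA.
  have h : (mu P <= mu (P `&` A) + mu (P `&` B))%E.
    apply: le_trans (measureU2 _ _ _); [|exact: measurableI|exact: measurableI].
    apply: le_measure; rewrite ?inE//.
      by apply: measurableU; exact: measurableI.
    by move=> x Px; case: (PAB x Px); [left|right].
  have := le_trans h (leeD2r _ hA); rewrite Pt.
  case: (mu (P `&` B)) => [u| |]//; last by move=> _; rewrite leey.
  by rewrite -EFinD !lee_fin => ?; lra.
pose E := [set M | ((t / 2)%:E <= mu (P `&` [set x | (f x <= M)%R]))%E].
have t4 : 0 < t / 4 by rewrite divr_gt0.
have t2 : 0 < t / 2 by rewrite divr_gt0.
have E0 : E !=set0.
  have [||||k hk] := @small_tail (fun k => P `&` [set x | k%:R < f x]) _ t2.
  - by move=> k; exact: measurableI.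
  - exact: fin.
  - move=> j k jk x [Px /= fx]; split=> //=; apply: le_lt_trans fx; by rewrite ler_nat.
  - move=> x h; have [_ /=] := h (Num.truncn (f x)).+1; rewrite ltNge => /negP; apply.
    by rewrite ltW// truncnS_gt.
  exists k%:R; apply: split_ge hk => // x Px /=.
  by have [h|h] := ltP k%:R (f x); [left|right].
(* A level whose sublevel set has measure at most t / 4 lies below all of [E]. *)
have lbE : has_lbound E.
  have [||||k hk] := @small_tail (fun k => P `&` [set x | f x <= - k%:R]) _ t4.
  - by move=> k; exact: measurableI.
  - exact: fin.
  - move=> j k jk x [Px /= fx]; split=> //=; apply: (le_trans fx).
    by rewrite lerN2 ler_nat.
  - move=> x h; have [_ /=] := h (Num.truncn (- f x)).+1; rewrite leNgt => /negP; apply.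
    by rewrite ltrNl truncnS_gt.
  exists (- k%:R) => M EM; rewrite leNgt; apply/negP => Mk.
  suff : ((t / 2)%:E <= (t / 4)%:E)%E by rewrite lee_fin; lra.
  apply: (le_trans EM); apply: le_trans hk; apply: le_measure; rewrite ?inE.
  - exact: measurableI.
  - exact: measurableI.
  - by move=> x [Px /= fx]; split=> //=; apply: (le_trans fx); exact: ltW.
have Eup M M' : M <= M' -> E M -> E M'.
  move=> MM' EM; apply: (le_trans EM); apply: le_measure; rewrite ?inE.
  - exact: measurableI.
  - exact: measurableI.
  - by move=> x [Px /= fx]; split=> //=; exact: le_trans fx MM'.
have infE : has_inf E by [].
pose M := inf E.
have EM k : E (M + k.+1%:R^-1).
  have [|u Eu uM] := @inf_adherent _ E k.+1%:R^-1 _ infE; first by rewrite invr_gt0.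
  by apply: Eup Eu; exact: ltW.
have nEM k : ~ E (M - k.+1%:R^-1).
  move=> /(ge_inf lbE); rewrite -/M lerBrDl gerDr leNgt invr_gt0 ltr0n//.
exists M; split; apply/lee_addgt0Pr => e e0.
  have [||||k hk] := @small_tail (fun k => P `&` [set x | M < f x <= M + k.+1%:R^-1]) _ e0.
  - move=> k; apply: measurableI => //; rewrite (_ : mkset _ = [set x | M < f x] `&` [set x | f x <= M + k.+1%:R^-1]).
      exact: measurableI.
    by apply/seteqP; split => x /= => [/andP|[-> ->]].
  - apply: fin; rewrite (_ : mkset _ = [set x | M < f x] `&` [set x | f x <= M + 1%:R^-1]).
      exact: measurableI.
    by apply/seteqP; split => x /= => [/andP|[-> ->]].
  - move=> j k jk x [Px /= /andP[-> fx]]; split=> //=; apply: (le_trans fx).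
    by rewrite lerD2l lef_pV2 ?posrE ?ltr0n// ler_nat.
  - move=> x h; have [_ /= /andP[Mx _]] := h 0%N.
    have [_ /= /andP[_]] := h (Num.truncn (f x - M)^-1); rewrite leNgt => /negP; apply.
    rewrite -ltrBrDl -[ltRHS]invrK ltf_pV2 ?posrE ?invr_gt0 ?subr_gt0 ?ltr0n//.
    exact: truncnS_gt.
  apply: (le_trans (EM k)).
  apply: (@le_trans _ _ (mu (P `&` [set x | f x <= M]%R) +
    mu (P `&` [set x | M < f x <= M + k.+1%:R^-1]%R))%E); last exact: leeD2l.
  have m2 : measurable [set x | M < f x <= M + k.+1%:R^-1].
    rewrite (_ : mkset _ = [set x | M < f x] `&` [set x | f x <= M + k.+1%:R^-1]).
      exact: measurableI.
    by apply/seteqP; split => x /= => [/andP|[-> ->]].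
  apply: le_trans (measureU2 _ _ _); [|exact: measurableI|exact: measurableI].
  apply: le_measure; rewrite ?inE.
  - exact: measurableI.
  - by apply: measurableU; exact: measurableI.
  - move=> x [Px /= fx]; have [h|h] := leP (f x) M; first by left.
    by right; split=> //; apply/andP; split.
have [||||k hk] := @small_tail (fun k => P `&` [set x | M - k.+1%:R^-1 < f x < M]) _ e0.
- move=> k; apply: measurableI => //; rewrite (_ : mkset _ = [set x | M - k.+1%:R^-1 < f x] `&` [set x | f x < M]).
    exact: measurableI.
  by apply/seteqP; split => x /= => [/andP|[-> ->]].
- apply: fin; rewrite (_ : mkset _ = [set x | M - 1%:R^-1 < f x] `&` [set x | f x < M]).
    exact: measurableI.
  by apply/seteqP; split => x /= => [/andP|[-> ->]].
- move=> j k jk x [Px /= /andP[fx ->]]; split=> //=; rewrite andbT; apply: le_lt_trans fx.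
  by rewrite lerD2l lerN2 lef_pV2 ?posrE ?ltr0n// ler_nat.
- move=> x h; have [_ /= /andP[_ Mx]] := h 0%N.
  have [_ /= /andP[+ _]] := h (Num.truncn (M - f x)^-1); rewrite ltNge => /negP; apply.
  rewrite lerBrDl addrC -lerBrDl -[leRHS]invrK lef_pV2 ?posrE ?invr_gt0 ?subr_gt0 ?ltr0n//.
  by apply: ltW; exact: truncnS_gt.
have m2 : measurable [set x | M - k.+1%:R^-1 < f x < M].
  rewrite (_ : mkset _ = [set x | M - k.+1%:R^-1 < f x] `&` [set x | f x < M]).
    exact: measurableI.
  by apply/seteqP; split => x /= => [/andP|[-> ->]].
apply: (@le_trans _ _ (mu (P `&` [set x | M - k.+1%:R^-1 < f x]%R))).
  apply: (split_ge [set x | f x <= M - k.+1%:R^-1]) => //.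
    by move=> x Px /=; have [h|h] := leP (f x) (M - k.+1%:R^-1); [left|right].
  by apply: ltW; rewrite ltNge; apply/negP; exact: nEM.
apply: (@le_trans _ _ (mu (P `&` [set x | M <= f x]%R) +
  mu (P `&` [set x | M - k.+1%:R^-1 < f x < M]%R))%E); last exact: leeD2l.
apply: le_trans (measureU2 _ _ _); [|exact: measurableI|exact: measurableI].
apply: le_measure; rewrite ?inE.
- exact: measurableI.
- by apply: measurableU; exact: measurableI.
- move=> x [Px /= fx]; have [h|h] := leP M (f x); first by left.
  by right; split=> //; apply/andP; split.
Qed.

End measure_aux.

Section weights.
Context {R : realType} {n : nat}.
Local Notation Rn := 'rV[R]_n.

Lemma powR_inv (a r : R) : 0 <= a -> a^-1 `^ r = a `^ (- r).
Proof. by move=> a0; rewrite -powR_inv1// -powRrM mulN1r. Qed.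

(** Jensen's inequality up to a factor 2: g^s <= Y^s where g <= Y, and g^s <= Y^(s-t) g^t
    elsewhere. *)
Lemma power_mean (D : set Rn) (g : Rn -> R) (s t Y T : R) :
  measurable D -> measurable_fun setT g -> (forall x, 0 <= g x) ->
  0 < s -> s <= t -> 0 < Y -> Leb n D = T%:E ->
  (\int[Leb n]_(x in D) (g x `^ t)%:E <= (Y `^ t * T)%:E)%E ->
  (\int[Leb n]_(x in D) (g x `^ s)%:E <= (2 * Y `^ s * T)%:E)%E.
Proof.
move=> mD mg g0 s0 st Y0 DT h.
have t0 : 0 < t by exact: lt_le_trans st.
have mgp r : measurable_fun D (fun x => (g x `^ r)%:E).
  apply/measurable_EFinP; apply: measurable_funTS.
  exact: (measurableT_comp (measurable_powR r)).
apply: (@le_trans _ _ (\int[Leb n]_(x in D) ((Y `^ s)%:E + (Y `^ (s - t))%:E * (g x `^ t)%:E))%E).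
  apply: ge0_le_integral => //.
  - by move=> x _; rewrite lee_fin powR_ge0.
  - by apply: emeasurable_funD => //; apply: emeasurable_funM => //; exact: measurable_cst.
  move=> x _; rewrite -EFinM -EFinD lee_fin.
  have [gY|Yg] := leP (g x) Y.
    by rewrite ler_wpDr ?mulr_ge0 ?powR_ge0// ge0_ler_powR ?nnegrE ?(ltW s0) ?(ltW Y0).
  rewrite ler_wpDl ?powR_ge0// -{1}(subrK t s) (@powRD _ (g x)); last first.
    by rewrite (gt_eqF (lt_trans Y0 Yg)) implybT.
  rewrite ler_wpM2r ?powR_ge0// -opprB !powRN lef_pV2 ?posrE ?powR_gt0//; last exact: lt_trans Yg.
  by rewrite ge0_ler_powR ?nnegrE ?subr_ge0// ltW// (lt_trans Y0).
rewrite ge0_integralD//; last 3 first.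
- by move=> x _; rewrite lee_fin powR_ge0.
- by move=> x _; rewrite -EFinM lee_fin mulr_ge0 ?powR_ge0.
- by apply: emeasurable_funM => //; exact: measurable_cst.
rewrite ge0_integralZl//; last 2 first.
- by move=> x _; rewrite lee_fin powR_ge0.
- by rewrite lee_fin powR_ge0.
rewrite integral_cst// [X in ((Y `^ s)%:E * X)%E]DT.
apply: (@le_trans _ _ ((Y `^ s)%:E * T%:E + (Y `^ (s - t))%:E * (Y `^ t * T)%:E)%E).
  by apply: leeD2l; apply: lee_wpmul2l => //; rewrite lee_fin powR_ge0.
rewrite -!EFinM -EFinD lee_fin mulrA -powRD ?subrK; last by rewrite (gt_eqF Y0) implybT.
by rewrite -mulrA mulr_natl mulr2n.
Qed.

(** Hölder's inequality for |F| = (|F| w) w^(-1), an identity valid almost everywhere because w > 0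
    almost everywhere. *)
Lemma hoelder_weight (w : Rn -> R) (q q' : R) (F : Rn -> R[i]) (E : set Rn) :
  measurable_fun setT w -> (forall x, 0 <= w x) -> {ae Leb n, forall x, 0 < w x} ->
  0 < q -> 0 < q' -> q^-1 + q'^-1 = 1 -> cmeasurable F -> measurable E ->
  (\int[Leb n]_(x in E) (normc (F x))%:E <=
   wLp_norm q w F * (\int[Leb n]_(x in E) ((w x)^-1 `^ q')%:E) `^ q'^-1)%E.
Proof.
move=> mw w0 wae q0 q'0 qq mF mE.
have mV : measurable_fun setT (fun x => (w x)^-1).
  rewrite (_ : (fun _ => _) = fun x => (w x) `^ (-1)).
    exact: (measurableT_comp (measurable_powR _)).
  by apply/funext => x; rewrite powR_inv1.
pose g x := (w x)^-1 * \1_E x.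
have mg : measurable_fun setT g by apply: measurable_funM => //; exact: measurable_indic.
have := hoelder (Leb n) (measurable_normcw mw mF) mg q0 q'0 qq.
rewrite -(wLp_normE w0) Lnorm1 => h.
apply: (@le_trans _ _ (\int[Leb n]_x `|(EFin \o ((fun x => normc (F x) * w x) \* g)%R) x|)%E).
  rewrite integral_mkcond; apply: ae_ge0_le_integral => //.
  - by move=> x _; rewrite patchE; case: ifP => // _; rewrite lee_fin normc_ge0.
  - apply/(measurable_restrictT _ mE); apply/measurable_EFinP; apply: measurable_funTS.
    exact: measurable_normc.
  - apply: measurableT_comp => //; apply/measurable_EFinP; apply: measurable_funM => //.
    exact: measurable_normcw.
  move: wae; apply: filterS => x wx _; rewrite patchE; case: ifPn => xE; last by rewrite abse_ge0.
  rewrite /= /g indicE xE mulr1 mulfK ?gt_eqF// lee_fin ger0_norm ?normc_ge0//.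
apply: (le_trans h); apply: lee_wpmul2l; first exact: wLp_norm_ge0.
rewrite unlock gt0_ler_poweR ?in_itv/= ?leey ?andbT//.
- by rewrite invr_ge0 ltW.
- by apply: integral_ge0 => x _; rewrite lee_fin powR_ge0.
- by apply: integral_ge0 => x _; rewrite lee_fin powR_ge0.
rewrite [leRHS]integral_mkcond; apply: ge0_le_integral => //.
- apply/measurable_EFinP; apply: (measurableT_comp (measurable_powR _)).
  exact: measurableT_comp.
- apply/(measurable_restrictT _ mE); apply/measurable_EFinP; apply: measurable_funTS.
  exact: (measurableT_comp (measurable_powR _)).
move=> x _; rewrite patchE /g indicE; case: ifPn => xE; rewrite ?mulr1 ?mulr0.
  by rewrite lee_fin ger0_norm// invr_ge0.
by rewrite normr0 powR0// gt_eqF.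
Qed.

(** Y and X are the roots of the means of w^q and w^(-p'). Both integrals are positive because w > 0
    almost everywhere; an infinite one would make the product infinite. So both are finite, and the
    A_{p,q} bound reads X Y <= A. *)
Lemma Apq_cube (p q : R) (w : Rn -> R) : 1 < p -> 0 < q -> Apq p q w ->
  exists2 A : R, 0 < A & forall (a : Rn) (l : R), 0 < l -> exists X Y : R,
  [/\ 0 < X, 0 < Y, X * Y <= A,
    (\int[Leb n]_(x in cube a l) (w x `^ q)%:E <= (Y `^ q * l ^+ n)%:E)%E &
    (\int[Leb n]_(x in cube a l) ((w x)^-1 `^ conjugate_exponent p)%:E <=
      (X `^ conjugate_exponent p * l ^+ n)%:E)%E].
Proof.
move=> p1 q0 [[[[mw _] _] w0 wae] supA].
set p' := conjugate_exponent p in supA *.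
have p'0 : 0 < p' by rewrite /p' /conjugate_exponent invr_gt0 subr_gt0 invf_lt1// (lt_trans ltr01).
have mP r : measurable_fun setT (fun x => (w x `^ r)%:E).
  by apply/measurable_EFinP; exact: (measurableT_comp (measurable_powR r)).
have Ipos r a l : 0 < l -> (0 < \int[Leb n]_(x in cube a l) (w x `^ r)%:E)%E.
  move=> l0; rewrite lt0e integral_ge0 ?andbT; last by move=> x _; rewrite lee_fin powR_ge0.
  apply/eqP => I0; have mc := measurable_cube a l.
  have : ae_eq (Leb n) (cube a l) (fun x => (w x `^ r)%:E) (cst 0%E).
    apply/ae_eq_integral_abs => //; first exact: measurable_funTS.
    by rewrite -[RHS]I0; apply: eq_integral => x _; rewrite gee0_abs// lee_fin powR_ge0.
  move=> H; have : Leb n (cube a l) = 0%E.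
    apply: measure_negligible => //.
    have : {ae Leb n, forall x, ~ cube a l x}.
      apply: filterS2 wae H => x wx h cx; have [/eqP] := h cx.
      by rewrite powR_eq0 (gt_eqF wx).
    by apply: negligibleS => x cx /=; exact.
  by rewrite Leb_cube ?ltW// => -[/eqP]; rewrite expf_eq0 (gt_eqF l0) andbF.
have [A supE] : exists A : R, forall a l, 0 < l ->
    (mean (cube a l) (fun x => (w x `^ q)%:E) `^ q^-1 *
     mean (cube a l) (fun x => (w x `^ (- p'))%:E) `^ p'^-1 <= A%:E)%E.
  have H a l : 0 < l -> (mean (cube a l) (fun x => (w x `^ q)%:E) `^ q^-1 *
     mean (cube a l) (fun x => (w x `^ (- p'))%:E) `^ p'^-1 <= Apq_sup p q w)%E.
    by move=> l0; apply: ereal_sup_ubound; exists (cube a l) => //; exists a, l.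
  move: supA H; case: (Apq_sup p q w) => [A _ H|//|_ H]; first by exists A.
  by exists 0 => a l /(H a) /le_trans; apply; rewrite leNye.
exists (Num.max A 1); first by rewrite lt_max ltr01 orbT.
move=> a l l0; have := supE a l l0.
have Lc : fine (Leb n (cube a l)) = l ^+ n by rewrite Leb_cube// ltW.
have T0 : 0 < l ^+ n by rewrite exprn_gt0.
rewrite /mean Lc; have := Ipos q a l l0; have := Ipos (- p') a l l0.
have -> : (\int[Leb n]_(x in cube a l) ((w x)^-1 `^ p')%:E =
    \int[Leb n]_(x in cube a l) (w x `^ (- p'))%:E)%E.
  by apply: eq_integral => x _; rewrite powR_inv.
set I2 := (\int[Leb n]_(x in cube a l) (w x `^ (- p'))%:E)%E.
set I1 := (\int[Leb n]_(x in cube a l) (w x `^ q)%:E)%E.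
move=> I20 I10.
have T0' : (0 < ((l ^+ n)^-1)%:E)%E by rewrite lte_fin invr_gt0.
have J1 : (0 < (((l ^+ n)^-1)%:E * I1) `^ q^-1)%E by apply: poweR_gt0; exact: mule_gt0.
have J2 : (0 < (((l ^+ n)^-1)%:E * I2) `^ p'^-1)%E by apply: poweR_gt0; exact: mule_gt0.
have p'n : p'^-1 != 0 by rewrite invr_neq0// gt_eqF.
have qn : q^-1 != 0 by rewrite invr_neq0// gt_eqF.
move: I10 I20 J1 J2; case: I1 => [i1| |]//; case: I2 => [i2| |]//; last 3 first.
- by move=> _ _ J1 _; rewrite (gt0_muley T0') (poweRyr p'n) (gt0_muley J1).
- by move=> _ _ _ J2; rewrite (gt0_muley T0') (poweRyr qn) (gt0_mulye J2).
- by move=> _ _ _ _; rewrite (gt0_muley T0') (poweRyr qn) (poweRyr p'n) mulyy.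
rewrite !lte_fin -!EFinM lee_fin => i10 i20 J1 J2 XY.
exists ((l ^- n * i2) `^ p'^-1), ((l ^- n * i1) `^ q^-1); split=> //.
- by rewrite mulrC (le_trans XY)// le_max lexx.
- rewrite lee_fin -powRrM mulVf ?gt_eqF// powRr1; last first.
    by apply: mulr_ge0; rewrite ?invr_ge0 ltW.
  by rewrite mulrAC mulVf ?mul1r ?gt_eqF.
- rewrite lee_fin -powRrM mulVf ?gt_eqF// powRr1; last first.
    by apply: mulr_ge0; rewrite ?invr_ge0 ltW.
  by rewrite mulrAC mulVf ?mul1r ?gt_eqF.
Qed.

End weights.

(** * Testing the commutator on oscillating cubes *)

Section cone_cube.
Context {R : realType} {n : nat}.
Local Notation Rn := 'rV[R]_n.
Variables (Omega : Rn -> R) (alpha : R) (z : Rn) (r k s d : R).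
Hypothesis n0 : (0 < n)%N.
Hypothesis halphan : alpha < n%:R.
Hypothesis mO : measurable_fun (sphere n) Omega.
Hypothesis bO : bounded_on_sphere Omega.
Hypothesis hO : homogeneous0 Omega.
Hypothesis r0 : 0 < r.
Hypothesis k0 : 0 < k.
Hypothesis s2 : s ^+ 2 = 1.
Hypothesis zO : forall y, cube z r y -> y != 0 /\ 0 <= s * Omega y.
Hypothesis zk : (Leb n (cube z r `&` [set y | (s * Omega y < k)%R]) <= (d * r ^+ n)%:E)%E.

(* For x in [cube a l] and y in [cube (a - l *: offset) l] the difference x - y
   lies in the dilate of [cube z r] by 2 l / r. *)
Definition offset : Rn := \row_i (1 + 2 / r * z ord0 i).

Lemma cube_shift a l x y : 0 < l -> cube a l x -> cube (a - l *: offset) l y ->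
  cube z r ((r / (2 * l)) *: (x - y)).
Proof.
move=> l0 xa ya i; have := xa i; have := ya i; rewrite !mxE.
have l2 : 0 < 2 * l by rewrite mulr_gt0.
have e : l * (1 + 2 / r * z ord0 i) = l + 2 * l / r * z ord0 i by ring.
rewrite e.
have -> : r / (2 * l) * (x ord0 i - y ord0 i) = (x ord0 i - y ord0 i) / (2 * l / r).
  by rewrite invf_div mulrC.
have c0 : 0 < 2 * l / r by rewrite divr_gt0.
rewrite ler_pdivlMr// ler_pdivrMr// (mulrDl (z ord0 i)).
have -> : r * (2 * l / r) = 2 * l by rewrite mulrC divfK// gt_eqF.
rewrite [z ord0 i * _]mulrC; move: (2 * l / r * _) => t.
by move=> /andP[h1 h2] /andP[h3 h4]; apply/andP; split; lra.
Qed.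

Lemma shift_neq0 a l x y : 0 < l -> cube a l x -> cube (a - l *: offset) l y -> x - y != 0.
Proof.
move=> l0 xa ya; have [+ _] := zO (cube_shift l0 xa ya).
by apply: contra => /eqP ->; rewrite scaler0.
Qed.

Lemma shift_Omega a l x y : 0 < l -> cube a l x -> cube (a - l *: offset) l y ->
  Omega ((r / (2 * l)) *: (x - y)) = Omega (x - y).
Proof.
move=> l0 xa ya; rewrite hO//; first by rewrite divr_gt0// mulr_gt0.
exact: shift_neq0 xa ya.
Qed.

Lemma shift_sign a l x y : 0 < l -> cube a l x -> cube (a - l *: offset) l y ->
  0 <= s * Omega (x - y).
Proof.
move=> l0 xa ya; rewrite -(shift_Omega l0 xa ya).
by have [] := zO (cube_shift l0 xa ya).
Qed.

(** Points of [cube z r] have sup norm at most |z| + r; the dilation by 2 l / r and the passage to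
    the Euclidean norm supply the other factors. *)
Definition shift_bound : R := Num.sqrt n%:R * (2 / r * (`|z| + r)).

Lemma shift_bound_gt0 : 0 < shift_bound.
Proof.
rewrite mulr_gt0 ?sqrtr_gt0 ?ltr0n// mulr_gt0 ?divr_gt0//.
by rewrite ltr_wpDl.
Qed.

Lemma shift_enorm_le a l x y : 0 < l -> cube a l x -> cube (a - l *: offset) l y ->
  enorm (x - y) <= shift_bound * l.
Proof.
move=> l0 xa ya; have -> : shift_bound * l = Num.sqrt n%:R * (2 / r * (`|z| + r) * l).
  by rewrite /shift_bound [RHS]mulrA.
apply: enorm_le.
  by rewrite !mulr_ge0 ?invr_ge0 ?addr_ge0// ltW.
move=> i; rewrite !mxE.
have zt : z ord0 i <= r / (2 * l) * (x ord0 i - y ord0 i) <= z ord0 i + r.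
  by have := cube_shift l0 xa ya i; rewrite !mxE.
have zi : `|z ord0 i| <= `|z|.
  have := normr_rV_le z (normr_ge0 z); rewrite lexx => /esym/forallP; exact.
have -> : x ord0 i - y ord0 i = 2 * l / r * (r / (2 * l) * (x ord0 i - y ord0 i)).
  by field; rewrite ?gt_eqF ?mulr_gt0.
move: (r / (2 * l) * _) zt => t zt; rewrite normrM ger0_norm; last first.
  by rewrite !mulr_ge0 ?invr_ge0// ltW.
have -> : 2 / r * (`|z| + r) * l = 2 * l / r * (`|z| + r) by ring.
rewrite ler_wpM2l//; first by rewrite !mulr_ge0 ?invr_ge0// ltW.
move: zi zt; rewrite !ler_norml => /andP[h1 h2] /andP[h3 h4].
by apply/andP; split; lra.
Qed.

(** The cube is a product of intervals and misses the origin, so one of the intervals misses 0; its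
    distance to 0 is the bound. *)
Lemma cube_away : exists2 e : R, 0 < e & forall y, cube z r y -> e <= enorm y.
Proof.
have [i zi] : exists i, ~ (z ord0 i <= 0 <= z ord0 i + r).
  apply/existsNP => H; have [|/eqP] := @zO 0; last by [].
  by move=> i; rewrite mxE.
exists (if 0 < z ord0 i then z ord0 i else - (z ord0 i + r)).
  case: ifPn => //; rewrite -leNgt => z0; rewrite oppr_gt0 ltNge; apply/negP => zr.
  by apply: zi; rewrite z0 zr.
move=> y /(_ i) /andP[h1 h2]; apply: le_trans (coord_le_enorm y i).
case: ifPn => z0; first by apply: le_trans (ler_norm _).
by rewrite -normrN; apply: le_trans (ler_norm _); rewrite lerN2.
Qed.

(** Purely qualitative: [e] and [C] depend on the cube and serve to make the commutator an
    absolutely convergent integral. *)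
Lemma shift_kernel_bounded a l x : 0 < l -> cube a l x -> exists e C : R,
  [/\ 0 < e, 0 <= C, (forall y, cube (a - l *: offset) l y -> e <= enorm (x - y)) &
   (forall y, cube (a - l *: offset) l y -> `|rough_kernel Omega alpha (x - y)| <= C)].
Proof.
move=> l0 xa; have [e e0 ez] := cube_away; have [M OM] := bO.
have c0 : 0 < 2 * l / r by rewrite divr_gt0// mulr_gt0.
have en y : cube (a - l *: offset) l y -> 2 * l / r * e <= enorm (x - y).
  move=> ya; have := ez _ (cube_shift l0 xa ya); rewrite enormZ ger0_norm; last first.
    by rewrite divr_ge0 ?mulr_ge0// ltW.
  have -> : r / (2 * l) = (2 * l / r)^-1 by rewrite invf_div.
  by rewrite ler_pdivlMl.
have ce0 : 0 < 2 * l / r * e by rewrite mulr_gt0.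
exists (2 * l / r * e), (`|M| / ((2 * l / r * e) `^ (n%:R - alpha))); split=> //.
  by rewrite divr_ge0 ?powR_ge0.
move=> y ya; rewrite /rough_kernel normrM normfV.
rewrite (ger0_norm (powR_ge0 _ _)); apply: ler_pM => //; first by rewrite invr_ge0 powR_ge0.
  rewrite -(homogeneous0_direction hO (shift_neq0 l0 xa ya)).
  apply: le_trans (ler_norm M); apply: OM; apply: direction_sphere; exact: shift_neq0 ya.
rewrite lef_pV2 ?posrE ?powR_gt0//; last exact: lt_le_trans (en _ ya).
rewrite ge0_ler_powR ?subr_ge0 ?nnegrE ?enorm_ge0 ?(ltW ce0) ?(ltW halphan)//; exact: en.
Qed.

Lemma shift_kernel_ge a l x y : 0 < l -> cube a l x -> cube (a - l *: offset) l y ->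
  k <= s * Omega (x - y) ->
  k / ((shift_bound * l) `^ (n%:R - alpha)) <= s * rough_kernel Omega alpha (x - y).
Proof.
move=> l0 xa ya kO; rewrite /rough_kernel mulrA; apply: ler_pM => //; first exact: ltW.
  by rewrite invr_ge0 powR_ge0.
have e0 : 0 < enorm (x - y) by rewrite enorm_gt0; exact: shift_neq0 ya.
have g0 : 0 < shift_bound * l by rewrite mulr_gt0// shift_bound_gt0.
rewrite lef_pV2 ?posrE ?powR_gt0//; apply: ge0_ler_powR; rewrite ?nnegrE ?subr_ge0.
- exact: ltW.
- exact: ltW.
- exact: ltW.
- exact: shift_enorm_le ya.
Qed.

Lemma shift_kernel_ge0 a l x y : 0 < l -> cube a l x -> cube (a - l *: offset) l y ->
  0 <= s * rough_kernel Omega alpha (x - y).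
Proof.
move=> l0 xa ya; rewrite /rough_kernel mulrA mulr_ge0 ?invr_ge0 ?powR_ge0//.
exact: shift_sign ya.
Qed.

(** The map y -> (r / (2 l)) (x - y) sends these points into the part of [cube z r] where s Omega <
    k; its Jacobian turns r^n into 2^n l^n. *)
Lemma Leb_shift_bad a l x : 0 < l -> cube a l x ->
  (Leb n (cube (a - l *: offset) l `&` [set y | (s * Omega (x - y) < k)%R]) <=
   (d * 2 ^+ n * l ^+ n)%:E)%E.
Proof.
move=> l0 xa; pose B := cube z r `&` [set y | s * Omega y < k].
have mB : measurable B.
  apply: measurableI; first exact: measurable_cube.
  rewrite (_ : mkset _ = setT `&` (fun y => s * Omega y) @^-1` `]-oo, k[%classic).
    have h : measurable_fun setT (fun y => s * Omega y).
      by apply: measurable_funM => //; exact: measurable_homogeneous0.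
    exact: h.
  by apply/seteqP; split => y /=; rewrite in_itv/=//; case.
pose c := r / (2 * l).
have c0 : 0 < c by rewrite divr_gt0// mulr_gt0.
have mA : measurable_fun setT (fun y : Rn => c *: x + (- c) *: y) by exact: measurable_affine_rV.
apply: (@le_trans _ _ (Leb n ((fun y : Rn => c *: x + (- c) *: y) @^-1` B))).
  apply: le_measure; rewrite ?inE.
  - apply: measurableI; first exact: measurable_cube.
    rewrite (_ : mkset _ = setT `&` (fun y : Rn => s * Omega (x + (- 1) *: y)) @^-1` `]-oo, k[%classic).
      have h : measurable_fun setT (fun y : Rn => s * Omega (x + (- 1) *: y)).
        apply: measurable_funM => //.
        apply: (measurableT_comp (f := Omega)); first exact: measurable_homogeneous0.
        exact: measurable_affine_rV.
      exact: h.
    apply/seteqP; split => y /=; rewrite in_itv/= scaleN1r//; by case.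
  - by rewrite -[X in measurable X]setTI; exact: mA.
  - move=> y [ya /= yk]; rewrite /= scaleNr -scalerBr; split.
      exact: cube_shift.
    by rewrite /= (shift_Omega l0 xa ya).
rewrite Leb_affine//; last by rewrite oppr_eq0 gt_eqF.
rewrite normrN ger0_norm ?(ltW c0)//.
apply: (le_trans (lee_wpmul2l _ zk)); first by rewrite lee_fin invr_ge0 exprn_ge0// ltW.
rewrite -EFinM lee_fin /c expr_div_n invf_div exprMn le_eqVlt; apply/orP; left; apply/eqP.
by field; rewrite expf_neq0// gt_eqF.
Qed.

End cone_cube.

Lemma normcX {R : realType} (z : R[i]) k : normc (z ^+ k) = normc z ^+ k.
Proof. by elim: k => [|k IH]; rewrite ?expr0 ?normc1// !exprS normcM IH. Qed.

Lemma normr_sqr1 {R : realType} (t : R) : t ^+ 2 = 1 -> `|t| = 1.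
Proof.
by move=> t2; apply/eqP; rewrite -sqrp_eq1 ?normr_ge0// real_normK ?num_real// t2.
Qed.

Section real_component.
Context {R : realType} {n : nat}.
Local Notation Rn := 'rV[R]_n.
Variables (m : nat) (b : Rn -> R[i]).

(* [pi] is the real or the imaginary part and [beta] the corresponding part of
   b; for m >= 2 only the real part of a real-valued b is considered. *)
Record component (beta : Rn -> R) (pi : R[i] -> R) : Prop := Component {
  component_measurable : measurable_fun setT beta ;
  component_le : forall z, `|pi z| <= normc z ;
  component_integral : forall f : Rn -> R[i],
    pi (cintegral setT f) = (\int[Leb n]_x pi (f x))%R ;
  component_integrable : forall f : Rn -> R[i], cintegrable f ->
    (Leb n).-integrable setT (EFin \o (fun x => pi (f x))) ;
  component_exp : forall (x y : Rn) (r : R),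
    pi ((b x - b y) ^+ m * r%:C%C) = (beta x - beta y) ^+ m * r }.

(** For m = 1 the real part passes through multiplication by a real number; for a real b the base of
    the power is already real. *)
Lemma component_Re : cmeasurable b -> (m = 1)%N \/ (forall x, complex.Im (b x) = 0) ->
  component (fun x => complex.Re (b x)) (@complex.Re R).
Proof.
move=> [mb _] h; split=> //; first exact: abs_Re_le.
  by move=> f [].
case: h => [->|h] x y r; first by rewrite !expr1 ReM /= mulr0 subr0 ReD ReN.
have -> : b x - b y = (complex.Re (b x) - complex.Re (b y))%:C%C.
  by apply: eq_complex; rewrite ?ReD ?ReN ?ImD ?ImN ?h ?subr0.
by rewrite -rmorphXn -rmorphM.
Qed.

Lemma component_Im : cmeasurable b -> (m = 1)%N ->
  component (fun x => complex.Im (b x)) (@complex.Im R).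
Proof.
move=> [_ mb] m1; split=> //; first exact: abs_Im_le.
  by move=> f [].
by move=> x y r; rewrite m1 !expr1 ImM /= mulr0 add0r ImD ImN.
Qed.

End real_component.

Section pointwise_lower_bound.
Context {R : realType} {n : nat}.
Local Notation Rn := 'rV[R]_n.
Variables (Omega : Rn -> R) (alpha : R) (z : Rn) (r k s d : R).
Hypothesis n0 : (0 < n)%N.
Hypothesis halphan : alpha < n%:R.
Hypothesis mO : measurable_fun (sphere n) Omega.
Hypothesis bO : bounded_on_sphere Omega.
Hypothesis hO : homogeneous0 Omega.
Hypothesis r0 : 0 < r.
Hypothesis k0 : 0 < k.
Hypothesis s2 : s ^+ 2 = 1.
Hypothesis zO : forall y, cube z r y -> y != 0 /\ 0 <= s * Omega y.
Hypothesis zk : (Leb n (cube z r `&` [set y | (s * Omega y < k)%R]) <= (d * r ^+ n)%:E)%E.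
Hypothesis d16 : d * 2 ^+ n <= 16^-1.
Variables (m : nat) (b : Rn -> R[i]) (beta : Rn -> R) (pi : R[i] -> R).
Hypothesis mb : cmeasurable b.
Hypothesis cb : component m b beta pi.

Definition test (F : set Rn) (c : R) : Rn -> R[i] := fun y => (c * \1_F y)%:C%C.

Lemma cmeasurable_test F c : measurable F -> cmeasurable (test F c).
Proof.
move=> mF; apply: cmeasurable_real; apply: measurable_funM => //.
Qed.

Lemma test_out F c y : ~ F y -> test F c y = 0.
Proof. by move=> Fy; rewrite /test indicE memNset// mulr0. Qed.

Lemma test_powers F (c N : R) j : measurable F -> (forall y, F y -> normc (b y) <= N) ->
  forall y, normc (b y ^+ j * test F c y) <= `|N| ^+ j * `|c|.
Proof.
move=> mF FN y; have [Fy|Fy] := pselect (F y); last first.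
  by rewrite test_out// mulr0 normc0 mulr_ge0// exprn_ge0.
rewrite normcM normcX /test indicE mem_set// mulr1 normc_real ler_wpM2r//.
by apply: lerXn2r; rewrite ?nnegrE ?normc_ge0// (le_trans (FN _ Fy) (ler_norm N)).
Qed.

Lemma test_lower_bound a l x F (c N M t : R) : 0 < l -> cube a l x ->
  measurable F -> F `<=` cube (a - l *: offset z r) l ->
  (forall y, F y -> normc (b y) <= N) -> 0 < c ->
  t ^+ 2 = 1 -> (forall y, F y -> t * (beta y - M) <= 0) -> 0 <= t * (beta x - M) ->
  ((5 / 16 * l ^+ n)%:E <= Leb n F)%E ->
  `|beta x - M| ^+ m * (k / ((shift_bound z r * l) `^ (n%:R - alpha))) * c * (l ^+ n / 4) <=
  normc (iter_commutator m b (T_op Omega alpha) (test F c) x).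
Proof.
move=> l0 xa mF FP FN c0 t2 Ft xt F5.
set P := cube (a - l *: offset z r) l in FP *.
have mP : measurable P by exact: measurable_cube.
have finP : (Leb n P < +oo)%E by rewrite /P Leb_cube ?ltry// ltW.
have [e [C [e0 C0 Pe PC]]] := shift_kernel_bounded halphan bO hO r0 zO l0 xa.
have bp : bounded_powers b P m (test F c).
  move=> j jm; split.
  - by apply: cmeasurableM; [exact: cmeasurableX|exact: cmeasurable_test].
  - by move=> y Py; rewrite test_out ?mulr0// => /FP.
  - by exists (`|N| ^+ j * `|c|); exact: test_powers.
have mK := measurable_rough_kernel mO hO alpha x.
rewrite (iter_commutator_far mP finP e0 C0 Pe mK PC bp).
have ik := cintegrable_kernel mP finP C0 mK PC bp.
apply: le_trans (component_le cb _); rewrite (component_integral cb).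
have iu := component_integrable cb ik.
pose u y := (beta x - beta y) ^+ m * (rough_kernel Omega alpha (x - y) * (c * \1_F y)).
have uE y : pi ((b x - b y) ^+ m * ((rough_kernel Omega alpha (x - y))%:C%C * test F c y)) = u y.
  by rewrite /test -rmorphM (component_exp cb).
have {}iu : (Leb n).-integrable setT (EFin \o u).
  by move: iu; under eq_fun do rewrite uE.
under eq_Rintegral do rewrite uE.
(* The sign that makes [u] nonnegative. *)
pose o := t ^+ m * s.
have o1 : `|o| = 1.
  by apply: normr_sqr1; rewrite /o exprMn s2 mulr1 exprAC t2 expr1n.
pose D := k / ((shift_bound z r * l) `^ (n%:R - alpha)).
have D0 : 0 <= D by rewrite divr_ge0 ?powR_ge0// ltW.
pose A := `|beta x - M| ^+ m * D * c.
have A0 : 0 <= A by rewrite /A; apply: mulr_ge0; [apply: mulr_ge0 => //; exact: exprn_ge0|exact: ltW].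
pose B := [set y : Rn | s * Omega (x - y) < k].
have mB : measurable B.
  rewrite (_ : B = setT `&` (fun y : Rn => s * Omega (x + (- 1) *: y)) @^-1` `]-oo, k[%classic).
    have h : measurable_fun setT (fun y : Rn => s * Omega (x + (- 1) *: y)).
      apply: measurable_funM => //.
      apply: (measurableT_comp (f := Omega)); first exact: measurable_homogeneous0.
      exact: measurable_affine_rV.
    exact: h.
  by apply/seteqP; split => y; rewrite /B /= in_itv/= scaleN1r//; case.
pose E := F `\` B.
have mE : measurable E by exact: measurableD.
have finE : (Leb n E < +oo)%E.
  by apply: le_lt_trans finP; apply: le_measure; rewrite ?inE// => y [/FP].
(* 5/16 of the cube minus at most 1/16 lost to a small kernel. *)
have LE : ((l ^+ n / 4)%:E <= Leb n E)%E.
  have h1 : (Leb n F <= Leb n (P `&` B) + Leb n E)%E.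
    apply: le_trans (measureU2 _ _ _); [|exact: measurableI|exact: mE].
    apply: le_measure; rewrite ?inE//.
      by apply: measurableU => //; exact: measurableI.
    by move=> y Fy; have [By|By] := pselect (B y); [left; split=> //; exact: FP|right].
  have h2 := Leb_shift_bad mO hO r0 zO zk l0 xa.
  have h3 : (Leb n (P `&` B) <= (16^-1 * l ^+ n)%:E)%E.
    by apply: (le_trans h2); rewrite lee_fin ler_wpM2r// exprn_ge0// ltW.
  have := le_trans F5 (le_trans h1 (leeD2r _ h3)).
  case: (Leb n E) => [v| |]//; last by move=> _; rewrite leey.
  by rewrite -EFinD !lee_fin; set X := l ^+ n => ?; lra.
have [iE _] : cintegrable (fun y : Rn => (\1_E y : R)%:C%C).
  apply: (@cintegrable_bounded _ _ E _ 1) => //.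
  - by apply: cmeasurable_real; exact: measurable_indic.
  - by move=> y Ey; rewrite indicE memNset.
  - by move=> y; rewrite normc_real indicE; case: (y \in E); rewrite ?normr1 ?normr0.
apply: (@le_trans _ _ (\int[Leb n]_y (A * \1_E y))%R).
  rewrite RintegralZl// /Rintegral (integral_indic _ _ mE)// setIT -/A.
  by rewrite -/D -/A ler_wpM2l// -lee_fin fineK ?ge0_fin_numE.
rewrite -[leRHS]mul1r -o1 -normrM -RintegralZl//; apply: le_trans (ler_norm _).
apply: le_Rintegral => //.
- exact: integrable_scale.
- exact: integrable_scale.
move=> y _; rewrite /u !indicE.
have [Fy|Fy] := pselect (F y); last first.
  by rewrite !memNset ?mulr0// => -[].
rewrite (mem_set Fy) mulr1.
have -> : o * ((beta x - beta y) ^+ m * (rough_kernel Omega alpha (x - y) * c)) =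
    (t * (beta x - beta y)) ^+ m * (s * rough_kernel Omega alpha (x - y)) * c.
  by rewrite exprMn /o; ring.
have xM : `|beta x - M| = t * (beta x - M).
  by rewrite -[LHS]mul1r -(normr_sqr1 t2) -normrM ger0_norm.
have xy : `|beta x - M| <= t * (beta x - beta y).
  rewrite xM -subr_ge0; have := Ft _ Fy.
  by rewrite !mulrBr; move: (t * _) (t * _) (t * _) => u1 u2 u3; lra.
have [Ey|Ey] := pselect (E y); last first.
  rewrite (memNset Ey) mulr0; apply: mulr_ge0; last exact: ltW.
  apply: mulr_ge0; first by rewrite exprn_ge0// (le_trans _ xy).
  exact: (shift_kernel_ge0 alpha hO r0 zO l0 xa (FP _ Fy)).
rewrite (mem_set Ey) mulr1 /A ler_wpM2r ?(ltW c0)//; apply: ler_pM => //.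
- by rewrite lerXn2r ?nnegrE// (le_trans _ xy).
- apply: (shift_kernel_ge n0 halphan r0 k0 zO l0 xa (FP _ Fy)).
  by case: Ey => _ /negP; rewrite -leNgt.
Qed.

End pointwise_lower_bound.

Section oscillation_split.
Context d {T : measurableType d} {R : realType}.
Variable mu : {measure set T -> \bar R}.

Lemma measurable_sign_set (Q : set T) (u : T -> R) : measurable Q ->
  measurable_fun setT u -> measurable (Q `&` [set x | 0 <= u x]).
Proof.
move=> mQ mf; apply: measurableI => //.
rewrite (_ : mkset _ = setT `&` u @^-1` `[0, +oo[%classic); first exact: mf.
by apply/seteqP; split => x /=; rewrite in_itv/= andbT//; case.
Qed.

Lemma integral_sign_half (Q : set T) (u : T -> R) (e : R) : measurable Q ->
  measurable_fun setT u -> (e%:E < \int[mu]_(x in Q) (`|u x|)%:E)%E ->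
  exists2 t : R, t = 1 \/ t = -1 &
    ((e / 2)%:E < \int[mu]_(x in Q `&` [set x | (0 <= t * u x)%R]) (`|u x|)%:E)%E.
Proof.
move=> mQ mf eQ; apply: contrapT => /forall2NP H.
have mn D : measurable_fun D (fun x => (`|u x|)%:E).
  by apply/measurable_EFinP; apply: measurable_funTS; exact: measurableT_comp.
have h t : t = 1 \/ t = -1 ->
    (\int[mu]_(x in Q `&` [set x | (0 <= t * u x)%R]) (`|u x|)%:E <= (e / 2)%:E)%E.
  by move=> t1; have [//|/negP] := H t; rewrite -leNgt.
have mt t : measurable_fun setT (fun x => t * u x) by exact: measurable_funM.
have h1 := h 1 (or_introl erefl); have h2 := h (-1) (or_intror erefl).
move: eQ; apply/negP; rewrite -leNgt.
pose E1 := Q `&` [set x | 0 <= 1 * u x]; pose E2 := Q `&` [set x | 0 <= -1 * u x].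
have mE1 : measurable E1 by exact: measurable_sign_set.
have mE2 : measurable E2 by exact: measurable_sign_set.
have QE : Q = E1 `|` (E2 `\` E1).
  apply/seteqP; split => x; last by case=> [[]|[[]]].
  move=> Qx; have [h0|h0] := leP 0 (u x); first by left; split=> //=; rewrite mul1r.
  right; split; first by split=> //=; rewrite mulN1r oppr_ge0 ltW.
  by case=> _ /=; rewrite mul1r leNgt h0.
rewrite QE ge0_integral_setU//; last 2 first.
- exact: measurableD.
- by apply/disj_setPS => x [E1x []].
rewrite [e in leRHS]splitr EFinD; apply: leeD => //.
by apply: le_trans h2; apply: ge0_subset_integral => //; exact: measurableD.
Qed.

(** Pointwise |u| <= s + s^(1-m) |u|^m. The integral of the constant is at most s t, half of the
    assumed lower bound. *)
Lemma moment_lower_bound (E : set T) (u : T -> R) (s t : R) m : (0 < m)%N -> 0 < s ->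
  measurable E -> measurable_fun setT u -> (mu E <= t%:E)%E ->
  ((2 * s * t)%:E < \int[mu]_(x in E) (`|u x|)%:E)%E ->
  ((s ^+ m * t)%:E <= \int[mu]_(x in E) (`|u x| ^+ m)%:E)%E.
Proof.
move=> m0 s0 mE mf Et H.
have mX j D : measurable_fun D (fun x => (`|u x| ^+ j)%:E).
  apply/measurable_EFinP; apply: measurable_funTS; apply: measurable_funX.
  exact: measurableT_comp.
have sm : 0 < s ^+ m.-1 by rewrite exprn_gt0.
have h : (\int[mu]_(x in E) (`|u x|)%:E <=
    \int[mu]_(x in E) (s%:E + ((s ^+ m.-1)^-1)%:E * (`|u x| ^+ m)%:E))%E.
  apply: ge0_le_integral => //.
  - exact: (mX 1%N).
  - by apply: emeasurable_funD => //; apply: emeasurable_funM => //; exact: mX.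
  move=> x _; rewrite -EFinM -EFinD lee_fin.
  have [us|su] := leP `|u x| s.
    by rewrite ler_wpDr// mulr_ge0 ?invr_ge0 ?(ltW sm)// exprn_ge0.
  rewrite ler_wpDl ?(ltW s0)// mulrC ler_pdivlMr// -(prednK m0) /= exprS.
  by rewrite ler_wpM2l// lerXn2r ?nnegrE ?(ltW s0)// ltW.
move: H => /lt_le_trans /(_ h).
rewrite ge0_integralD//; last 3 first.
- by move=> x _; rewrite lee_fin ltW.
- by move=> x _; rewrite -EFinM lee_fin mulr_ge0 ?invr_ge0 ?(ltW sm)// exprn_ge0.
- by apply: emeasurable_funM => //; exact: mX.
rewrite ge0_integralZl//; last by rewrite lee_fin invr_ge0 ltW.
rewrite integral_cst//.
have : (s%:E * mu E <= (s * t)%:E)%E by rewrite EFinM lee_wpmul2l// lee_fin ltW.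
move=> /leeD2r h1 /lt_le_trans /(_ (h1 _)) {h1}.
have : (0 <= \int[mu]_(x in E) (`|u x| ^+ m)%:E)%E.
  by apply: integral_ge0 => x _; rewrite lee_fin exprn_ge0.
case: (\int[mu]_(x in E) (`|u x| ^+ m)%:E)%E => [v| |]// _; last by rewrite leey.
rewrite -EFinM -EFinD lte_fin lee_fin => h1.
have : s * t < (s ^+ m.-1)^-1 * v by move: h1; rewrite -mulrA; set st := s * t; lra.
by rewrite ltr_pdivlMl// mulrA -exprSr prednK// => /ltW.
Qed.

End oscillation_split.

Section testing.
Context {R : realType} {n : nat}.
Local Notation Rn := 'rV[R]_n.
Variables (p q alpha : R) (m : nat) (w Omega : Rn -> R) (b : Rn -> R[i]).
Variables (S : (Rn -> R[i]) -> Rn -> R[i]) (beta : Rn -> R) (pi : R[i] -> R).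
Hypotheses (p1 : 1 < p) (q1 : 1 < q) (halpha0 : 0 <= alpha) (halphan : alpha < n%:R).
Hypotheses (hpq : q^-1 = p^-1 - alpha / n%:R) (hm : (0 < m)%N).
Hypothesis hw : Apq p q w.
Hypothesis mO : measurable_fun (sphere n) Omega.
Hypothesis bO : bounded_on_sphere Omega.
Hypothesis hO : homogeneous0 Omega.
Hypothesis sO : constant_sign_on_open Omega.
Hypothesis hb : L1loc b.
Hypothesis cS : compact_operator p q w S.
Hypothesis hS : forall f, suitable m b f ->
  {ae Leb n, forall x, S f x = iter_commutator m b (T_op Omega alpha) f x}.
Hypothesis cb : component m b beta pi.

Let n0 : (0 < n)%N.
Proof. by rewrite -(ltr0n R); exact: le_lt_trans halphan. Qed.
Let p0 : 0 < p. Proof. exact: lt_trans ltr01 p1. Qed.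
Let q0 : 0 < q. Proof. exact: lt_trans ltr01 q1. Qed.
Let mb : cmeasurable b. Proof. by case: hb. Qed.
Let mw : measurable_fun setT w. Proof. by case: hw => -[[[]]]. Qed.
Let w0 x : 0 <= w x. Proof. by case: hw => -[]. Qed.
Let wae : {ae Leb n, forall x, 0 < w x}. Proof. by case: hw => -[]. Qed.
Let mbeta : measurable_fun setT beta. Proof. exact: component_measurable cb. Qed.
Let p' := conjugate_exponent p.
Let q' := conjugate_exponent q.

(** From alpha >= 0; it makes the A_{p,q} exponents q and p' dominate the exponents p and q' at
    which the weight is integrated below. *)
Let pq : p <= q.
Proof.
rewrite -[p]invrK -[q]invrK lef_pV2 ?posrE ?invr_gt0// hpq gerBl.
by rewrite divr_ge0.
Qed.

Let q'0 : 0 < q'.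
Proof. by rewrite /q' /conjugate_exponent invr_gt0 subr_gt0 invf_lt1. Qed.

Let q'p' : q' <= p'.
Proof.
rewrite lef_pV2 ?posrE ?subr_gt0 ?invf_lt1// lerD2l lerN2.
by rewrite lef_pV2 ?posrE.
Qed.

Let q'V : q'^-1 = 1 - q^-1. Proof. by rewrite /q' /conjugate_exponent invrK. Qed.

Lemma test_suitable a l F (c N : R) : measurable F -> F `<=` cube a l ->
  (forall y, F y -> normc (b y) <= N) -> suitable m b (test F c).
Proof.
move=> mF Fa FN; split; first exact: cmeasurable_test.
  apply: (subclosed_compact _ (@compact_cube R n a l)); first exact: closed_closure.
  have cc : closed (cube a l) by apply: compact_closed; [exact: norm_hausdorff|exact: compact_cube].
  rewrite /csupport => x xF; apply: cc; move: x xF; apply: closure_subset => x /= Fx.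
  by apply: Fa; apply: contrapT => nF; move/eqP: Fx; apply; exact: test_out.
(* The base |N| + 1 is at least 1, so its m-th power bounds all powers k <= m at once. *)
exists ((`|N| + 1) ^+ m * `|c|) => k km x.
apply: (le_trans (test_powers c k mF FN x)); rewrite ler_wpM2r//.
apply: (@le_trans _ _ ((`|N| + 1) ^+ k)).
  by apply: lerXn2r; rewrite ?nnegrE ?addr_ge0// lerDl.
by apply: ler_weXn2l => //; rewrite lerDr.
Qed.

(** By [power_mean] with p <= q, the bound on w^q over the cube limits the norm of the indicator of
    [F] to (2 l^n)^(1/p) Y. *)
Lemma test_norm F (c : R) (a : Rn) (l Y : R) : measurable F -> F `<=` cube a l -> 0 < l -> 0 < Y ->
  (\int[Leb n]_(x in cube a l) (w x `^ q)%:E <= (Y `^ q * l ^+ n)%:E)%E ->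
  0 < c -> c * ((2 * l ^+ n) `^ p^-1 * Y) <= 1 ->
  (wLp_norm p w (test F c) <= 1)%E.
Proof.
move=> mF Fa l0 Y0 hY c0 cY.
have mc := measurable_cube a l.
have h := power_mean mc mw w0 p0 pq Y0 (Leb_cube a (ltW l0)) hY.
have ln : 0 < l ^+ n by rewrite exprn_gt0.
rewrite /wLp_norm -[leRHS](poweR1r p^-1) gt0_ler_poweR ?in_itv/= ?leey ?andbT//.
- by rewrite invr_ge0 ltW.
- by apply: integral_ge0 => x _; rewrite lee_fin mulr_ge0 ?powR_ge0.
have mwp D : measurable_fun D (fun x => (w x `^ p)%:E).
  apply/measurable_EFinP; apply: measurable_funTS.
  exact: (measurableT_comp (measurable_powR p)).
apply: (@le_trans _ _ (\int[Leb n]_(x in cube a l) ((c `^ p)%:E * (w x `^ p)%:E))%E).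
  rewrite [leRHS]integral_mkcond; apply: ge0_le_integral => //.
  - by move=> x _; rewrite lee_fin mulr_ge0 ?powR_ge0.
  - exact: (measurable_powR_normcw mw p (cmeasurable_test c mF)).
  - by apply/(measurable_restrictT _ mc); apply: emeasurable_funM => //; exact: (mwp (cube a l)).
  move=> x _; rewrite -[leLHS]/((normc (test F c x) `^ p * w x `^ p)%:E) patchE.
  case: ifPn => [_|/negP xa]; last first.
    by rewrite test_out ?normc0 ?powR0 ?gt_eqF ?mul0r// => /Fa /mem_set.
  rewrite -EFinM lee_fin ler_wpM2r ?powR_ge0//.
  apply: ge0_ler_powR; rewrite ?nnegrE ?normc_ge0 ?(ltW p0) ?(ltW c0)//.
  rewrite /test normc_real normrM (ger0_norm (ltW c0)) indicE.
  by case: (_ \in _); rewrite ?normr1 ?mulr1// normr0 mulr0 ltW.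
rewrite ge0_integralZl//; last 2 first.
- by move=> x _; rewrite lee_fin powR_ge0.
- by rewrite lee_fin powR_ge0.
apply: (le_trans (lee_wpmul2l _ h)); first by rewrite lee_fin powR_ge0.
rewrite -EFinM lee_fin.
have -> : c `^ p * (2 * Y `^ p * l ^+ n) = (c * ((2 * l ^+ n) `^ p^-1 * Y)) `^ p.
  rewrite powRM ?(ltW c0) ?mulr_ge0 ?powR_ge0 ?(ltW Y0)//.
  rewrite [in RHS]powRM ?powR_ge0 ?(ltW Y0)// -powRrM mulVf ?gt_eqF// powRr1.
    by ring.
  by rewrite mulr_ge0 ?(ltW ln).
apply: (@le_trans _ _ (1 `^ p)); last by rewrite powR1.
apply: ge0_ler_powR; rewrite ?nnegrE ?(ltW p0)//.
by rewrite mulr_ge0 ?(ltW c0) ?mulr_ge0 ?powR_ge0 ?(ltW Y0).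
Qed.

(** The dual estimate: [power_mean] with q' <= p' bounds w^(-q') over the cube, and [hoelder_weight]
    does the rest. It turns a lower bound on the unweighted integral into one on the norm. *)
Lemma test_hoelder (E : set Rn) (a : Rn) (l X : R) (F : Rn -> R[i]) : measurable E ->
  E `<=` cube a l -> 0 < l -> 0 < X -> cmeasurable F ->
  (\int[Leb n]_(x in cube a l) ((w x)^-1 `^ p')%:E <= (X `^ p' * l ^+ n)%:E)%E ->
  (\int[Leb n]_(x in E) (normc (F x))%:E <=
    wLp_norm q w F * ((2 * l ^+ n) `^ q'^-1 * X)%:E)%E.
Proof.
move=> mE Ea l0 X0 mF hX.
have mc := measurable_cube a l.
have mV : measurable_fun setT (fun x => (w x)^-1).
  rewrite (_ : (fun _ => _) = fun x => (w x) `^ (-1)).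
    exact: (measurableT_comp (measurable_powR _)).
  by apply/funext => x; rewrite powR_inv1.
have V0 x : 0 <= (w x)^-1 by rewrite invr_ge0.
have h := power_mean mc mV V0 q'0 q'p' X0 (Leb_cube a (ltW l0)) hX.
have ln : 0 < l ^+ n by rewrite exprn_gt0.
have qq : q^-1 + q'^-1 = 1 by rewrite q'V addrC subrK.
apply: (le_trans (hoelder_weight mw w0 wae q0 q'0 qq mF mE)).
apply: lee_wpmul2l; first exact: wLp_norm_ge0.
have -> : (2 * l ^+ n) `^ q'^-1 * X = (2 * X `^ q' * l ^+ n) `^ q'^-1.
  rewrite mulrAC [in RHS]powRM ?powR_ge0 ?mulr_ge0 ?(ltW ln)//.
  by rewrite -powRrM divff ?gt_eqF// powRr1 ?(ltW X0).
rewrite -poweR_EFin gt0_ler_poweR ?in_itv/= ?leey ?andbT//.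
- by rewrite invr_ge0 ltW.
- by apply: integral_ge0 => x _; rewrite lee_fin powR_ge0.
- by rewrite lee_fin !mulr_ge0 ?powR_ge0 ?(ltW ln).
apply: le_trans h; apply: ge0_subset_integral => //.
  by apply/measurable_EFinP; apply: measurable_funTS; exact: (measurableT_comp (measurable_powR _)).
by move=> x _; rewrite lee_fin powR_ge0.
Qed.

(** The A_{p,q} condition is applied to one cube containing both cubes at hand; its enlargement
    factor [H] depends on v alone. *)
Lemma cube_enlarge (v a : Rn) (l : R) : 0 < l ->
  let H := 2 * `|v| + 1 in let a' := a - (l * `|v|) *: const_mx 1 in
  cube a l `<=` cube a' (H * l) /\ cube (a - l *: v) l `<=` cube a' (H * l).
Proof.
move=> l0 H a'.
have vi i : - `|v| <= v ord0 i <= `|v|.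
  have := normr_rV_le v (normr_ge0 v); rewrite lexx => /esym/forallP /(_ i).
  by rewrite ler_norml.
have lv : 0 <= l * `|v| by rewrite mulr_ge0// ltW.
have e : H * l = 2 * (l * `|v|) + l by rewrite /H; ring.
split=> x xa i; have := xa i; rewrite /a' !mxE mulr1 e.
  by move=> /andP[h1 h2]; apply/andP; split; lra.
have /andP[v1 v2] := vi i.
have : l * - `|v| <= l * v ord0 i <= l * `|v| by rewrite !ler_pM2l// v1 v2.
rewrite mulrN; move: (l * v ord0 i) (l * `|v|) => u1 u2 /andP[? ?] /andP[h1 h2].
by apply/andP; split; lra.
Qed.

Let measurable_le (f : Rn -> R) (M : R) : measurable_fun setT f ->
  measurable [set x | f x <= M].
Proof.
move=> mf; rewrite (_ : mkset _ = setT `&` f @^-1` `]-oo, M]%classic); first exact: mf.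
by apply/seteqP; split => x /=; rewrite in_itv/=//; case.
Qed.

(* The median M of beta on the shifted cube P bounds beta from one side on half
   of P; F is this half, deprived of G and of the points where b is large. *)
Lemma test_set (P G : set Rn) (T : R) : measurable P -> 0 < T -> Leb n P = T%:E ->
  measurable G -> (Leb n (G `&` P) <= (16^-1 * T)%:E)%E -> exists M, forall t : R,
    t = 1 \/ t = -1 -> exists F N, [/\ measurable F, F `<=` P `\` G,
      (forall y, F y -> normc (b y) <= N),
      (forall y, F y -> t * (beta y - M) <= 0) &
      ((5 / 16 * T)%:E <= Leb n F)%E].
Proof.
move=> mP T0 PT mG GP; have [M [M1 M2]] := median mP T0 PT mbeta.
have T16 : 0 < 16^-1 * T by rewrite mulr_gt0.
have mnb := measurable_normc mb.
have mgt k : measurable [set x | k%:R < normc (b x)].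
  rewrite (_ : mkset _ = ~` [set x | normc (b x) <= k%:R]).
    by apply: measurableC; exact: measurable_le.
  by apply/seteqP; split => x /=; rewrite ltNge => /negP.
(* |b| exceeds the level k on at most 1/16 of [P]; below that level the test function is
   suitable. *)
have [||||k hk] := @small_tail _ _ _ (Leb n) (fun k => P `&` [set x | k%:R < normc (b x)]) _ T16.
- by move=> k; exact: measurableI.
- apply: (@le_lt_trans _ _ (Leb n P)); last by rewrite PT ltry.
  by apply: le_measure; rewrite ?inE//; exact: measurableI.
- by move=> i j ij x [Px /= h]; split=> //=; apply: le_lt_trans h; rewrite ler_nat.
- move=> x h; have [_ /=] := h (Num.truncn (normc (b x))).+1; rewrite ltNge => /negP; apply.
  by apply: ltW; exact: truncnS_gt.
exists M => t t1.
pose A := P `&` [set x | t * (beta x - M) <= 0].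
pose B := [set x | k%:R < normc (b x)].
have mA : measurable A.
  apply: measurableI => //; apply: measurable_le; apply: measurable_funM => //.
  exact: measurable_funB.
have A2 : ((T / 2)%:E <= Leb n A)%E.
  case: t1 => t1; rewrite /A t1.
    rewrite (_ : [set x | 1 * (beta x - M) <= 0] = [set x | beta x <= M])//.
    by apply/seteqP; split => x /=; rewrite mul1r subr_le0.
  rewrite (_ : [set x | -1 * (beta x - M) <= 0] = [set x | M <= beta x])//.
  by apply/seteqP; split => x /=; rewrite mulN1r oppr_le0 subr_ge0.
exists ((A `\` B) `\` G), k%:R; split.
- by apply: measurableD => //; apply: measurableD => //; exact: mgt.
- by move=> x [[[Px _] _] Gx].
- by move=> x [[_ /= /negP]]; rewrite -leNgt.
- by move=> x [[[_ /=]]].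
have h : (Leb n A <= Leb n ((A `\` B) `\` G) + (Leb n (P `&` B) + Leb n (G `&` P)))%E.
  have mAB : measurable (A `\` B) by apply: measurableD => //; exact: mgt.
  have mABG : measurable ((A `\` B) `\` G) by exact: measurableD.
  have mPB : measurable (P `&` B) by apply: measurableI => //; exact: mgt.
  have mGP : measurable (G `&` P) by exact: measurableI.
  apply: le_trans (leeD2l _ (measureU2 _ mPB mGP)).
  apply: le_trans (measureU2 _ mABG (measurableU _ _ mPB mGP)).
  apply: le_measure; rewrite ?inE//.
    by do 2 apply: measurableU => //.
  move=> x Ax; have [Px _] := Ax; have [Bx|Bx] := pselect (B x); first by right; left.
  by have [Gx|Gx] := pselect (G x); [right; right|left].
(* T / 2 - T / 16 - T / 16 = 3 T / 8, above the claimed 5 T / 16. *)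
have h2 := le_trans A2 (le_trans h (leeD2l _ (leeD hk GP))).
move: h2; case: (Leb n ((A `\` B) `\` G)) => [u| |]//; last by move=> _; rewrite leey.
by rewrite -!EFinD !lee_fin => h2; lra.
Qed.

(** The integral of |S f| over the part of Q where t (beta - M) >= 0 is bounded below by
    [test_lower_bound] and [moment_lower_bound], and above by the weighted norm of S f through
    [test_hoelder]. Normalising f brings in Y, the upper bound brings in X, and X Y <= A removes the
    dependence on the cube. *)
Lemma oscillation_test : exists v : Rn, forall e : R, 0 < e -> exists2 c : R, 0 < c &
  forall (a : Rn) (l : R), 0 < l ->
  (forall M : R, ((e * l ^+ n)%:E < \int[Leb n]_(x in cube a l) (`|beta x - M|)%:E)%E) ->
  forall G, measurable G -> (Leb n (G `&` cube (a - l *: v) l) <= (16^-1 * l ^+ n)%:E)%E ->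
  exists f, [/\ wLp p w f, (wLp_norm p w f <= 1)%E,
    (forall x, ~ (cube (a - l *: v) l `\` G) x -> f x = 0) &
    (c%:E <= wLp_norm q w (S f))%E].
Proof.
(* Passing from the model cube to P costs a factor 2^n, after which the kernel is small on at most
   1/16 of P. *)
have d0 : 0 < (16 * 2 ^+ n)^-1 :> R by rewrite invr_gt0 mulr_gt0// exprn_gt0.
have [z [r [k [s [r0 k0 s2 zO zk]]]]] := homogeneous0_dense_cube mO hO d0 sO.
have d16 : (16 * 2 ^+ n)^-1 * 2 ^+ n <= 16^-1 :> R.
  by rewrite invfM -mulrA mulVf ?mulr1// expf_neq0// pnatr_eq0.
pose v := offset z r; exists v => e e0.
have [A A0 Acube] := Apq_cube p1 q0 hw.
pose H := 2 * `|v| + 1.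
have H0 : 0 < H by rewrite ltr_wpDl// mulr_ge0.
pose g := shift_bound z r.
have g0 : 0 < g by exact: shift_bound_gt0.
pose K := (2 * H ^+ n) `^ p^-1 * (2 * H ^+ n) `^ q'^-1.
have HH : 0 < 2 * H ^+ n by rewrite mulr_gt0// exprn_gt0.
have K0 : 0 < K by rewrite mulr_gt0// powR_gt0.
(* One sign of beta - M carries more than e l^n / 2 = 2 s0 l^n, as [moment_lower_bound] requires. *)
pose s0 := e / 4.
have s00 : 0 < s0 by rewrite divr_gt0.
(* The 4 comes from the quarter of P that is left, [K] from the two norm estimates on the enlarged
   cube, [A] from X Y. *)
pose c := (k / g `^ (n%:R - alpha)) * s0 ^+ m / (4 * K * A).
have gn : 0 < g `^ (n%:R - alpha) by rewrite powR_gt0.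
have c0 : 0 < c.
  apply: divr_gt0; first by rewrite mulr_gt0 ?exprn_gt0// divr_gt0.
  by rewrite mulr_gt0// mulr_gt0.
exists c => // a l l0 bad G mG GP.
set P := cube (a - l *: v) l in GP *.
have mP : measurable P by exact: measurable_cube.
have ln : 0 < l ^+ n by rewrite exprn_gt0.
have PT : Leb n P = (l ^+ n)%:E by rewrite /P Leb_cube// ltW.
have [M HM] := test_set mP ln PT mG GP.
have mQ := measurable_cube a l.
have mu : measurable_fun setT (fun x => beta x - M) by exact: measurable_funB.
have [t t1 ht] := integral_sign_half mQ mu (bad M).
have t2 : t ^+ 2 = 1 by case: t1 => ->; rewrite ?sqrrN expr1n.
have [F [N [mF FP FN Ft F5]]] := HM t t1.
have [aQ aP] := cube_enlarge v a l0.
set a' := a - _ in aQ aP; rewrite -/H in aQ aP.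
have Hl : 0 < H * l by rewrite mulr_gt0.
have [X [Y [X0 Y0 XY hY hX]]] := Acube a' (H * l) Hl.
pose B := (2 * (H * l) ^+ n) `^ p^-1 * Y.
have Hln : 0 < 2 * (H * l) ^+ n by rewrite mulr_gt0// exprn_gt0.
have B0 : 0 < B by rewrite /B mulr_gt0// powR_gt0.
pose c1 := B^-1.
have c10 : 0 < c1 by rewrite invr_gt0.
have FP' : F `<=` P by move=> y /FP[].
have Fa' : F `<=` cube a' (H * l) by move=> y /FP' /aP.
have f1 : (wLp_norm p w (test F c1) <= 1)%E.
  by apply: (test_norm mF Fa' Hl Y0 hY c10); rewrite -/B mulVf ?gt_eqF.
have mf := cmeasurable_test c1 mF.
have fL : wLp p w (test F c1) by split=> //; apply: (le_lt_trans f1); rewrite ltry.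
exists (test F c1); split=> //.
  by move=> x Px; apply: test_out => Fx; apply: Px; exact: FP.
have [mSf _] : wLp q w (S (test F c1)) by case: cS => /(_ _ fL).
pose E := cube a l `&` [set x | 0 <= t * (beta x - M)].
have mE : measurable E by apply: measurable_sign_set => //; exact: measurable_funM.
have LE : (Leb n E <= (l ^+ n)%:E)%E.
  have -> : (l ^+ n)%:E = Leb n (cube a l) by rewrite Leb_cube// ltW.
  by apply: le_measure; rewrite ?inE// => x [].
pose D0 := k / (g * l) `^ (n%:R - alpha) * c1 * (l ^+ n / 4).
have D00 : 0 < D0.
  by rewrite /D0 !mulr_gt0 ?invr_gt0// powR_gt0// mulr_gt0.
have J : ((s0 ^+ m * l ^+ n)%:E <= \int[Leb n]_(x in E) (`|beta x - M| ^+ m)%:E)%E.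
  apply: moment_lower_bound => //.
  by move: ht; rewrite (_ : e * l ^+ n / 2 = 2 * s0 * l ^+ n)// /s0; field.
have low : (D0%:E * \int[Leb n]_(x in E) (`|beta x - M| ^+ m)%:E <=
    \int[Leb n]_(x in E) (normc (S (test F c1) x))%:E)%E.
  have mX D : measurable_fun D (fun x => (`|beta x - M| ^+ m)%:E).
    apply/measurable_EFinP; apply: measurable_funTS.
    by apply: (measurable_funX m); apply: (measurableT_comp _ mu).
  rewrite -ge0_integralZl; [|exact: mE|exact: (mX E)|
    by move=> x _; rewrite lee_fin exprn_ge0|by rewrite lee_fin ltW].
  apply: ae_ge0_le_integral => //.
  - by move=> x _; rewrite -EFinM lee_fin mulr_ge0 ?(ltW D00)// exprn_ge0.
  - by apply: emeasurable_funM => //; exact: (mX E).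
  - by move=> x _; rewrite lee_fin normc_ge0.
  - by apply/measurable_EFinP; apply: measurable_funTS; exact: measurable_normc.
  have := hS (test_suitable c1 mF FP' FN); apply: filterS => x -> [xa xt].
  rewrite -EFinM lee_fin mulrC /D0 !mulrA.
  have := test_lower_bound n0 halphan mO bO hO r0 k0 s2 zO zk d16 mb cb l0 xa mF FP' FN c10 t2 Ft xt F5.
  by rewrite !mulrA.
have up := test_hoelder mE (subset_trans (@subIsetl _ _ _) aQ) Hl X0 mSf hX.
have fin := le_trans (le_trans (lee_wpmul2l _ J) low) up.
have := fin; rewrite lee_fin => /(_ (ltW D00)).
have := wLp_norm_ge0 w q (S (test F c1)).
case: (wLp_norm q w _) => [u| |]// _; last by rewrite leey.
rewrite -!EFinM !lee_fin => fin'.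
have u0 : 0 <= u.
  rewrite leNgt; apply/negP => u0; move: fin'; apply/negP; rewrite -ltNge.
  apply: (@lt_trans _ _ 0).
    by rewrite nmulr_rlt0// mulr_gt0// powR_gt0.
  by rewrite mulr_gt0// mulr_gt0// exprn_gt0.
pose L2 := (l ^+ n) `^ p^-1 * (l ^+ n) `^ q'^-1.
have L20 : 0 < L2 by rewrite mulr_gt0// powR_gt0.
have BE : (2 * (H * l) ^+ n) `^ p^-1 * (2 * (H * l) ^+ n) `^ q'^-1 = K * L2.
  have e2 : 2 * (H * l) ^+ n = (2 * H ^+ n) * l ^+ n by rewrite exprMn mulrA.
  by rewrite e2 !(powRM _ (ltW HH) (ltW ln)) /K /L2; ring.
(* 1/p + 1/q' = 1 + alpha / n gives l^(n + alpha), and the kernel contributes l^(n - alpha). *)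
have LE2 : (l ^+ n) * (l ^+ n) = l `^ (n%:R - alpha) * L2.
  rewrite /L2 -!powR_mulrn ?(ltW l0)// -!powRrM -!powRD ?(gt_eqF l0) ?implybT//.
  congr (l `^ _); rewrite q'V hpq; field; by rewrite !gt_eqF// ltr0n.
move: fin'; rewrite /D0 /c1 powRM ?(ltW g0) ?(ltW l0)//.
set gl := g `^ _ in gn *; set ll := l `^ _ in LE2 *.
have ll0 : 0 < ll by rewrite powR_gt0.
set Z := (2 * (H * l) ^+ n) `^ q'^-1 in BE *.
have Z0 : 0 < Z by rewrite powR_gt0.
move=> fin'.
have fin2 : k / gl * s0 ^+ m * (l ^+ n * l ^+ n) <= u * 4 * (K * L2 * (X * Y)) * ll.
  have -> : K * L2 * (X * Y) = B * (Z * X) by rewrite -BE /B; ring.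
  have e1 : k / (gl * ll) * B^-1 * (l ^+ n / 4) * (s0 ^+ m * l ^+ n) * (4 * B * ll) =
      k / gl * s0 ^+ m * (l ^+ n * l ^+ n).
    by field; rewrite !gt_eqF.
  rewrite -e1 (_ : u * 4 * (B * (Z * X)) * ll = u * (Z * X) * (4 * B * ll)); last by ring.
  rewrite ler_wpM2r//; last by rewrite ltW// mulr_gt0// mulr_gt0.
have fin3 : k / gl * s0 ^+ m <= u * (4 * K * A).
  move: fin2; rewrite LE2.
  have -> : u * 4 * (K * L2 * (X * Y)) * ll = u * (4 * K * (X * Y)) * (ll * L2) by ring.
  rewrite ler_pM2r; last exact: (mulr_gt0 ll0 L20).
  move=> /le_trans; apply; apply: ler_wpM2l => //; apply: ler_wpM2l => //.
  by apply: mulr_ge0 => //; exact: ltW.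
rewrite /c ler_pdivrMr//; apply: mulr_gt0 => //; exact: mulr_gt0.
Qed.

End testing.

(** * Vanishing oscillation *)

Section vanishing.
Context {R : realType} {n : nat}.
Local Notation Rn := 'rV[R]_n.

Definition sup_ball (rho : R) : set Rn := [set x | `|x| <= rho].

Lemma sup_ballE rho : 0 <= rho -> sup_ball rho = cube (const_mx (- rho)) (2 * rho).
Proof.
move=> r0; apply/seteqP; split => x; rewrite /sup_ball /= normr_rV_le//.
  by move=> /forallP H i; rewrite mxE; have := H i; rewrite ler_norml => /andP[? ?]; apply/andP; split; lra.
by move=> H; apply/forallP => i; have := H i; rewrite mxE ler_norml => /andP[? ?]; apply/andP; split; lra.
Qed.

Lemma measurable_sup_ball rho : 0 <= rho -> measurable (sup_ball rho).
Proof. by move=> r0; rewrite sup_ballE//; exact: measurable_cube. Qed.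

Lemma cube_sup_ball (a : Rn) l : 0 <= l -> cube a l `<=` sup_ball (`|a| + l).
Proof.
move=> l0 x xa; rewrite /sup_ball /= normr_rV_le ?addr_ge0//; apply/forallP => i.
have /andP[h1 h2] := xa i.
have : `|a ord0 i| <= `|a|.
  by have := normr_rV_le a (normr_ge0 a); rewrite lexx => /esym/forallP.
by rewrite !ler_norml => /andP[? ?]; apply/andP; split; lra.
Qed.

Variables (p q : R) (w : Rn -> R) (S : (Rn -> R[i]) -> Rn -> R[i]) (beta : Rn -> R).
Hypotheses (n0 : (0 < n)%N) (p1 : 1 < p) (q1 : 1 < q).
Hypothesis mw : measurable_fun setT w.
Hypothesis w0 : forall x, 0 <= w x.
Hypothesis cS : compact_operator p q w S.

Definition oscillating (e : R) (c : Rn * R) := 0 < c.2 /\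
  forall M : R, ((e * c.2 ^+ n)%:E < \int[Leb n]_(x in cube c.1 c.2) (`|beta x - M|)%:E)%E.

Variables (v : Rn) (e c : R).
Hypothesis c0 : 0 < c.
Hypothesis test : forall (a : Rn) (l : R), oscillating e (a, l) ->
  forall G, measurable G -> (Leb n (G `&` cube (a - l *: v) l) <= (16^-1 * l ^+ n)%:E)%E ->
  exists f, [/\ wLp p w f, (wLp_norm p w f <= 1)%E,
    (forall x, ~ (cube (a - l *: v) l `\` G) x -> f x = 0) &
    (c%:E <= wLp_norm q w (S f))%E].

Let P (x : Rn * R) := cube (x.1 - x.2 *: v) x.2.

(** The test functions of such cubes, each supported in P deprived of G, contradict
    [compact_operator_disjoint]. *)
Lemma no_disjoint_oscillation (x : nat -> Rn * R) (G : nat -> set Rn) :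
  (forall k, oscillating e (x k)) -> (forall k, measurable (G k)) ->
  (forall k, (Leb n (G k `&` P (x k)) <= (16^-1 * (x k).2 ^+ n)%:E)%E) ->
  (forall j k y, (j < k)%N -> (P (x j) `\` G j) y -> (P (x k) `\` G k) y -> False) ->
  False.
Proof.
move=> ox mG GP dis.
have H k : exists f, [/\ wLp p w f, (wLp_norm p w f <= 1)%E,
    (forall y, ~ (P (x k) `\` G k) y -> f y = 0) & (c%:E <= wLp_norm q w (S f))%E].
  have := GP k; have := ox k; rewrite /P; case: (x k) => a l oxk GPk.
  exact: (test oxk (mG k) GPk).
have [F FP] := choice H.
apply: (@compact_operator_disjoint R n w p q S mw w0 p1 q1 cS F c c0).
- by move=> k; have [] := FP k.
- by move=> k; have [] := FP k.
- move=> j k y; have [_ _ Fj _] := FP j; have [_ _ Fk _] := FP k.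
  rewrite neq_ltn => /orP[jk|kj].
    have [h|h] := pselect ((P (x j) `\` G j) y); last by left; exact: Fj.
    by right; apply: Fk => h'; exact: dis jk h h'.
  have [h|h] := pselect ((P (x j) `\` G j) y); last by left; exact: Fj.
  by right; apply: Fk => h'; exact: dis kj h' h.
- by move=> k; have [] := FP k.
Qed.

(** Otherwise some sequence of oscillating cubes has sides shrinking by a factor 32 or more. From
    each P all later ones are removed, which is affordable wherever they lie. *)
Lemma small_cubes : exists2 r : R, 0 < r & forall x, x.2 <= r -> ~ oscillating e x.
Proof.
apply: contrapT => /forall2NP H.
have pk (r : R) : exists x, 0 < r -> oscillating e x /\ x.2 <= r.
  have [r0|r0] := ltP 0 r; last by exists (0, 0).
  have [//|/existsNP[x /not_implyP[xr /contrapT ox]]] := H r; by exists x.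
have [f fP] := choice pk.
(* The later cubes measure at most the sum over i of 2^(-i) / 32, that is 1/16, relative to the
   current one. *)
pose x := fix x k := if k is k'.+1 then f ((x k').2 / 32) else f 1.
have ox k : oscillating e (x k).
  elim: k => [|k IH] /=; first by have [] := fP 1 ltr01.
  have [l0 _] := IH; have h : 0 < (x k).2 / 32 by rewrite divr_gt0.
  by have [] := fP _ h.
have x0 k : 0 < (x k).2 by have [] := ox k.
have xS k : (x k.+1).2 <= (x k).2 / 32.
  have h : 0 < (x k).2 / 32 by rewrite divr_gt0.
  by have [] := fP _ h.
(* A factor 1/2 per step suffices to sum the series; the factor 1/32 is used for its first term. *)
have xn k i : (x (k + i)%N).2 ^+ n <= (x k).2 ^+ n / 2 ^+ i.
  elim: i => [|i IH]; first by rewrite addn0 expr0 divr1.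
  rewrite addnS exprSr invfM mulrA; apply: le_trans (ler_wpM2r _ IH); last by rewrite invr_ge0.
  apply: (@le_trans _ _ (((x (k + i)%N).2 / 2) ^+ n)).
    apply: lerXn2r; rewrite ?nnegrE ?divr_ge0// ?(ltW (x0 _))//.
    apply: (le_trans (xS _)); rewrite ler_pM2l// lef_pV2 ?posrE// ler_nat//.
  rewrite exprMn ler_wpM2l// ?exprn_ge0 ?(ltW (x0 _))//.
  rewrite -(prednK n0) exprS -[leRHS]mulr1 ler_wpM2l// exprn_ile1//.
  by rewrite invf_le1// ler1n.
pose G j := \bigcup_i P (x (j.+1 + i)%N).
apply: (@no_disjoint_oscillation x G) => //.
- by move=> k; apply: bigcup_measurable => i _; exact: measurable_cube.
- move=> k; apply: (@le_trans _ _ (Leb n (G k))).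
    apply: le_measure; rewrite ?inE.
    - apply: measurableI; last exact: measurable_cube.
      by apply: bigcup_measurable => i _; exact: measurable_cube.
    - by apply: bigcup_measurable => i _; exact: measurable_cube.
    - by move=> y [].
  apply: (@le_trans _ _ (\sum_(i <oo) Leb n (P (x (k.+1 + i)%N)))%E).
    apply: measure_sigma_subadditive => //.
    + by move=> i; exact: measurable_cube.
    + by apply: bigcup_measurable => i _; exact: measurable_cube.
  have T0 : 0 <= 16^-1 * (x k).2 ^+ n by rewrite mulr_ge0// exprn_ge0// ltW.
  apply: le_trans (epsilon_trick0 xpredT T0); apply: lee_nneseries => // i _.
  rewrite /P Leb_cube ?(ltW (x0 _))// lee_fin.
  apply: (le_trans (xn _ _)).
  have h : (x k.+1).2 ^+ n <= (x k).2 ^+ n / 32.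
    apply: (@le_trans _ _ (((x k).2 / 32) ^+ n)).
      by apply: lerXn2r; rewrite ?nnegrE ?divr_ge0 ?(ltW (x0 _)).
    rewrite exprMn ler_wpM2l// ?exprn_ge0 ?(ltW (x0 _))//.
    rewrite -(prednK n0) exprS -[leRHS]mulr1 ler_wpM2l// exprn_ile1//.
    by rewrite invf_le1// ler1n.
  apply: (@le_trans _ _ ((x k).2 ^+ n / 32 / 2 ^+ i)).
    by rewrite ler_wpM2r// invr_ge0 exprn_ge0.
  by rewrite natrX exprS le_eqVlt; apply/orP; left; apply/eqP; field; rewrite expf_neq0// pnatr_eq0.
- move=> j k y jk [_ nG] [Pk _]; apply: nG; exists (k - j.+1)%N => //.
  by rewrite subnKC.
Qed.

(** If for every r some oscillating cube had at most 1/16 of P in the ball of radius r, taking r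
    beyond all earlier P would give disjoint supports. So in one fixed ball each P has more than
    1/16 of its measure. This bounds its side and position, hence Q = P + l v: large cubes and
    remote cubes are excluded together. *)
Lemma far_cubes : exists2 rho : R, 0 < rho &
  forall x, oscillating e x -> cube x.1 x.2 `<=` sup_ball rho.
Proof.
have [r r0 H] : exists2 r : R, 0 < r & forall x, oscillating e x ->
    ((16^-1 * x.2 ^+ n)%:E < Leb n (sup_ball r `&` P x))%E.
  apply: contrapT => /forall2NP H.
  have pk (r : R) : exists x, 0 < r -> oscillating e x /\
      (Leb n (sup_ball r `&` P x) <= (16^-1 * x.2 ^+ n)%:E)%E.
    have [r0|r0] := ltP 0 r; last by exists (0, 0).
    have [//|/existsNP[x /not_implyP[ox /negP]]] := H r; rewrite -leNgt; by exists x.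
  have [f fP] := choice pk.
  pose rad (x : Rn * R) := `|x.1 - x.2 *: v| + x.2.
  (* The ball of radius [rr k] contains every P chosen before step k. *)
  pose rr := fix rr k := if k is k'.+1 then rr k' + `|rad (f (rr k'))| else 1 : R.
  have rr0 k : 0 < rr k by elim: k => //= k IH; rewrite ltr_wpDr.
  pose x k := f (rr k).
  have ox k : oscillating e (x k) by have [] := fP _ (rr0 k).
  have rrm j k : (j <= k)%N -> rr j <= rr k.
    by move=> /subnK <-; elim: (k - j)%N => //= i IH; rewrite ler_wpDr.
  apply: (@no_disjoint_oscillation x (fun k => sup_ball (rr k))) => //.
  - by move=> k; apply: measurable_sup_ball; exact: ltW.
  - by move=> k; have [] := fP _ (rr0 k).
  - move=> j k y jk [Pj _] [_]; apply.
    have [l0 _] := ox j; have := cube_sup_ball (ltW l0) Pj.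
    rewrite /sup_ball /= => /le_trans; apply; apply: le_trans (rrm _ _ jk) => /=.
    by rewrite -/(rad (x j)) ler_wpDl ?(ltW (rr0 j))// ler_norm.
(* A point of P within r of the origin, a side of at most 32 r, and the shift by l v. *)
pose rho := r + 32 * r * (1 + `|v|).
exists rho; first by rewrite ltr_wpDr// mulr_ge0 ?mulr_ge0 ?addr_ge0// ltW.
move=> [a l] ox y ya; have [l0 _] := ox; rewrite /= in l0 ya.
have h := H _ ox; rewrite /= in h.
(* Otherwise l^n / 16 would be at least (2 r)^n, the measure of the whole ball, because (32 r)^n >=
   16 (2 r)^n. *)
have lr : l <= 32 * r.
  rewrite leNgt; apply/negP => rl; move: h; apply/negP; rewrite -leNgt.
  apply: (@le_trans _ _ (Leb n (sup_ball r))).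
    have ms := measurable_sup_ball (ltW r0); have mc := measurable_cube (a - l *: v) l.
    by apply: le_measure; rewrite ?inE//; exact: measurableI.
  rewrite sup_ballE ?(ltW r0)// Leb_cube ?mulr_ge0 ?(ltW r0)// lee_fin.
  rewrite ler_pdivlMl//; apply: (@le_trans _ _ ((16 * (2 * r)) ^+ n)).
    rewrite [leRHS]exprMn ler_wpM2r ?exprn_ge0 ?mulr_ge0 ?(ltW r0)//.
    by rewrite -(prednK n0) exprS ler_peMr// exprn_ege1// ler1n.
  by apply: lerXn2r; rewrite ?nnegrE ?mulr_ge0 ?(ltW r0) ?(ltW l0)//; lra.
have [t [tr Pt]] : sup_ball r `&` P (a, l) !=set0.
  apply/set0P; apply/eqP => E0; move: h; rewrite E0 measure0 lte_fin ltNge.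
  by rewrite mulr_ge0// exprn_ge0// ltW.
have rho0 : 0 <= rho by rewrite /rho addr_ge0 ?(ltW r0)// mulr_ge0 ?mulr_ge0 ?addr_ge0 ?(ltW r0).
rewrite /sup_ball /= normr_rV_le//; apply/forallP => i.
have /andP[y1 y2] := ya i.
have := Pt i; rewrite /= !mxE => /andP[t1 t2].
have ti : `|t ord0 i| <= r.
  by move: tr; rewrite /sup_ball /= normr_rV_le ?(ltW r0)// => /forallP.
have vi : `|v ord0 i| <= `|v|.
  by have := normr_rV_le v (normr_ge0 v); rewrite lexx => /esym/forallP.
have lv : `|l * v ord0 i| <= 32 * r * `|v|.
  by rewrite normrM ger0_norm ?(ltW l0)// ler_pM// ltW.
have -> : rho = r + 32 * r + 32 * r * `|v| by rewrite /rho; ring.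
move: ti lv; rewrite !ler_norml; move: (l * _) (32 * r * `|v|) t1 t2 => u1 u2 t1 t2.
by move=> /andP[? ?] /andP[? ?]; apply/andP; split; lra.
Qed.

End vanishing.

(** * Approximation by smooth functions *)

Section oscillation.
Context {R : realType} {n : nat}.
Local Notation Rn := 'rV[R]_n.
Implicit Types (u h : Rn -> R) (a : Rn) (l e M : R).

Lemma coord_le_norm (x : Rn) i : `|x ord0 i| <= `|x|.
Proof.
by have := normr_rV_le x (normr_ge0 x); rewrite lexx => /esym/forallP.
Qed.

(** The constant is free and may come from wherever is convenient; [mean_osc] returns to the mean at
    the cost of a factor 2. *)
Definition osc_at u e a l M :=
  (\int[Leb n]_(x in cube a l) (`|u x - M|)%:E <= (e * l ^+ n)%:E)%E.

Definition osc_le u e a l := exists M, osc_at u e a l M.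

Lemma measurable_abs_sub (D : set Rn) u M : measurable_fun setT u ->
  measurable_fun D (fun x => (`|u x - M|)%:E).
Proof.
move=> mu; apply/measurable_EFinP; apply: measurable_funTS; apply: measurableT_comp => //.
exact: measurable_funB.
Qed.

Lemma osc_at_le u (v : Rn -> R) e d a l M (N : R) : 0 < l -> measurable_fun setT u -> measurable_fun setT v ->
  osc_at u e a l M -> (forall x, cube a l x -> `|v x - N| <= `|u x - M| + d) -> 0 <= d ->
  osc_at v (e + d) a l N.
Proof.
move=> l0 mu mv uM H d0; have mc := measurable_cube a l.
apply: (@le_trans _ _ (\int[Leb n]_(x in cube a l) ((`|u x - M|)%:E + d%:E))%E).
  apply: ge0_le_integral => //.
  - exact: measurable_abs_sub.
  - by apply: emeasurable_funD => //; exact: measurable_abs_sub.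
rewrite ge0_integralD//; last exact: measurable_abs_sub.
rewrite integral_cst//; apply: (@le_trans _ _ ((e * l ^+ n)%:E + d%:E * (l ^+ n)%:E)%E).
  have L : (Leb n (cube a l) <= (l ^+ n)%:E)%E by rewrite Leb_cube ?(ltW l0).
  by apply: leeD => //; exact: lee_wpmul2l L.
by rewrite -EFinM -EFinD lee_fin mulrDl.
Qed.

Lemma osc_atW u e e' a l M : 0 < l -> e <= e' -> osc_at u e a l M -> osc_at u e' a l M.
Proof.
move=> l0 ee h; apply: (le_trans h); rewrite lee_fin ler_wpM2r// exprn_ge0// ltW//.
Qed.

(** Integrate |M - M'| <= |u - M| + |u - M'| over the smaller cube. *)
Lemma osc_const_le u e a l M a' l' M' : 0 < l -> measurable_fun setT u ->
  cube a l `<=` cube a' l' -> osc_at u e a l M -> osc_at u e a' l' M' ->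
  `|M - M'| * l ^+ n <= e * (l ^+ n + l' ^+ n).
Proof.
move=> l0 mu aa uM uM'; have mc := measurable_cube a l; have mc' := measurable_cube a' l'.
rewrite -lee_fin mulrDr EFinD.
apply: (@le_trans _ _ (\int[Leb n]_(x in cube a l) ((`|u x - M|)%:E + (`|u x - M'|)%:E))%E).
  apply: (@le_trans _ _ (\int[Leb n]_(x in cube a l) (`|M - M'|)%:E)%E).
    have L : ((l ^+ n)%:E <= Leb n (cube a l))%E by rewrite Leb_cube ?(ltW l0).
    by rewrite integral_cst// EFinM; exact: lee_wpmul2l L.
  apply: ge0_le_integral => //.
  - by apply: emeasurable_funD; exact: measurable_abs_sub.
  - move=> x xa; rewrite -EFinD lee_fin [`|u x - M|]distrC.
    by rewrite (_ : M - M' = (M - u x) + (u x - M')) ?ler_normD// addrA subrK.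
rewrite ge0_integralD//; [|exact: measurable_abs_sub|exact: measurable_abs_sub].
apply: leeD => //; apply: le_trans uM'; apply: ge0_subset_integral => //.
exact: measurable_abs_sub.
Qed.

Section cutoff.
Variables (beta : Rn -> R) (rho e : R).
Hypotheses (n0 : (0 < n)%N) (rho0 : 0 < rho) (e0 : 0 < e).
Hypothesis mbeta : measurable_fun setT beta.
Hypothesis obeta : forall a l, 0 < l -> ~ (cube a l `<=` sup_ball rho) ->
  osc_le beta e a l.

(** Larger than [rho], so that a cube with a point |x| >= r leaves the ball of radius rho and has
    small oscillation. *)
Let r := rho + 1.
Let r0 : 0 < r. Proof. exact: addr_gt0. Qed.
Let psi (x : Rn) : R := Num.max 0 (Num.min 1 (2 - `|x| / r)).

Let psi_ge0 x : 0 <= psi x. Proof. by rewrite le_max lexx. Qed.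

Let psi_le1 x : psi x <= 1.
Proof. by rewrite ge_max ler01 ge_min lexx. Qed.

Let psi_in x : `|x| <= r -> psi x = 1.
Proof.
move=> xr; have h : `|x| / r <= 1 by rewrite ler_pdivrMr// mul1r.
rewrite /psi min_l; first by rewrite max_r.
by lra.
Qed.

Let psi_out x : 2 * r <= `|x| -> psi x = 0.
Proof.
move=> xr; have h : 2 <= `|x| / r by rewrite ler_pdivlMr.
rewrite /psi max_l// ge_min; apply/orP; right; lra.
Qed.

Let psi_lip x y d : `|x - y| <= d -> `|psi x - psi y| <= d / r.
Proof.
wlog: x y / psi y <= psi x.
  move=> H xy; have [h|/ltW h] := leP (psi y) (psi x); first exact: H.
  by rewrite distrC; apply: H => //; rewrite distrC.
move=> yx xy; rewrite ger0_norm ?subr_ge0//.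
have h : `|y| / r - `|x| / r <= d / r.
  rewrite -mulrBl ler_wpM2r ?invr_ge0 ?(ltW r0)//; apply: le_trans xy.
  by rewrite distrC; apply: le_trans (lerB_dist _ _).
have d0 : 0 <= d / r by rewrite divr_ge0 ?(ltW r0)// (le_trans _ xy).
rewrite lerBlDr; have p0 : 0 <= psi y by exact: psi_ge0.
pose s := `|x| / r; pose t := `|y| / r; rewrite -/s -/t in h.
rewrite {1}/psi -/s ge_max addr_ge0//=.
have [h1|h1] := leP 1 (2 - t).
  have -> : psi y = 1 by rewrite /psi -/t min_l// max_r.
  by rewrite ge_min; apply/orP; left; rewrite lerDr.
have h2 : 2 - t <= psi y by rewrite /psi -/t le_max [Num.min _ _]min_r ?lexx ?orbT// ltW.
by rewrite ge_min; apply/orP; right; rewrite -/s; lra.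
Qed.

Let mpsi : measurable_fun setT psi.
Proof.
have mnorm : measurable_fun setT (fun x : Rn => `|x|).
  by apply: measurable_continuous => x; exact: norm_continuous.
apply: measurable_maxr => //; apply: measurable_minr => //.
by apply: measurable_funB => //; exact: measurable_funM.
Qed.

Let not_sub a l x : cube a l x -> r <= `|x| -> ~ cube a l `<=` sup_ball rho.
Proof.
move=> xa rx H; have := H _ xa; rewrite /sup_ball /= leNgt => /negP; apply.
by apply: lt_le_trans rx; rewrite /r ltrDl.
Qed.

(** h is (beta - c0) psi, with c0 the constant of a large cube, so beta - h is c0 near the origin
    and beta far away. On a small cube in between, with constant M, beta - h is up to a constant
    (beta - M)(1 - psi x) + (M - c0)(psi a - psi x). There psi varies by at most l / r, while |M -
    c0| is controlled by the number of doublings from l to r. *)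
Lemma cutoff : exists h, [/\ measurable_fun setT h,
    (forall x, 2 * (rho + 1) <= `|x| -> h x = 0) &
    forall a l, 0 < l -> osc_le (fun x => beta x - h x) ((3 + 2 * 8 ^+ n) * e) a l].
Proof.
have B4 : cube (const_mx (- (4 * r)) : Rn) (8 * r) = sup_ball (4 * r).
  by rewrite sup_ballE ?mulr_ge0 ?(ltW r0)//; congr cube; ring.
have r8 : 0 < 8 * r by rewrite mulr_gt0.
(* Centred at the origin with half-side 4 r: it leaves the ball of radius rho and contains every
   cube of side at most 2 r that meets the ball of radius 2 r. *)
have [c0 hc0] : osc_le beta e (const_mx (- (4 * r))) (8 * r).
  apply: obeta => //; rewrite B4 => /(_ (const_mx (4 * r))).
  have nc : `|const_mx (4 * r) : Rn| = 4 * r.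
    apply/eqP; rewrite eq_le; apply/andP; split.
      rewrite normr_rV_le ?mulr_ge0 ?(ltW r0)//; apply/forallP => i.
      by rewrite mxE ger0_norm ?mulr_ge0 ?(ltW r0).
    apply: le_trans (coord_le_norm (const_mx (4 * r) : Rn) (Ordinal n0)).
    by rewrite mxE; exact: ler_norm.
  by rewrite /sup_ball /= nc lexx => /(_ isT); rewrite /r => h; move: rho0; rewrite ltNge => /negP; apply; lra.
pose h x := (beta x - c0) * psi x.
have mh : measurable_fun setT h by apply: measurable_funM => //; exact: measurable_funB.
have mbh : measurable_fun setT (fun x => beta x - h x) by exact: measurable_funB.
exists h; split=> //; first by move=> x xr; rewrite /h psi_out// mulr0.
move=> a l l0.
have e8 : 0 <= 8 ^+ n * e by rewrite mulr_ge0 ?exprn_ge0// ltW.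
have [Qr|Qr] := pselect (forall x, cube a l x -> `|x| <= r).
  exists c0; rewrite /osc_at (eq_integral (fun=> 0%E)).
    rewrite integral0 lee_fin mulr_ge0 ?exprn_ge0 ?(ltW l0)//.
    by rewrite mulr_ge0 ?(ltW e0)// addr_ge0 ?mulr_ge0 ?exprn_ge0.
  move=> x; rewrite inE => /Qr /psi_in px.
  have -> : beta x - h x - c0 = 0 by rewrite /h px; ring.
  by rewrite normr0.
have {Qr} [x1 [x1a x1r]] : exists x, cube a l x /\ r <= `|x|.
  move/existsNP : Qr => [x /not_implyP[xa /negP]]; rewrite -ltNge => /ltW xr; by exists x.
have [M hM] : osc_le beta e a l by apply: obeta => //; exact: not_sub x1a x1r.
have mc := measurable_cube a l.
(* For l > r the whole integral of |h| is affordable: it is at most the deviation of beta from c0 on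
   the large cube, and (8 r)^n <= 8^n l^n. *)
have [rl|lr] := ltP r l.
  exists M; apply: (@le_trans _ _ (\int[Leb n]_(x in cube a l) ((`|beta x - M|)%:E + (`|h x|)%:E))%E).
    apply: ge0_le_integral => //.
    - exact: measurable_abs_sub.
    - apply: emeasurable_funD; first exact: measurable_abs_sub.
      by apply/measurable_EFinP; apply: measurable_funTS; exact: measurableT_comp.
    - by move=> x _; rewrite -EFinD lee_fin addrAC; exact: ler_normB.
  rewrite ge0_integralD//; last 2 first.
  - exact: measurable_abs_sub.
  - by apply/measurable_EFinP; apply: measurable_funTS; exact: measurableT_comp.
  have hB : (\int[Leb n]_(x in cube a l) (`|h x|)%:E <= (e * (8 * r) ^+ n)%:E)%E.
    apply: le_trans hc0; rewrite integral_mkcond [leRHS]integral_mkcond.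
    have mB := measurable_cube (const_mx (- (4 * r)) : Rn) (8 * r).
    apply: ge0_le_integral => //.
    - by move=> x _; rewrite patchE; case: ifP.
    - apply/(measurable_restrictT _ mc); apply/measurable_EFinP; apply: measurable_funTS.
      exact: measurableT_comp.
    - by apply/(measurable_restrictT _ mB); exact: measurable_abs_sub.
    move=> x _; rewrite !patchE; have [xB|xB] := pselect (cube (const_mx (- (4 * r))) (8 * r) x).
      rewrite (mem_set xB); case: ifP => _; last by rewrite lee_fin.
      by rewrite lee_fin /h normrM ler_piMr// ger0_norm.
    rewrite (memNset xB); case: ifP => _ //.
    rewrite /h psi_out ?mulr0 ?normr0//.
    move: xB; rewrite B4 /sup_ball /= => /negP; rewrite -ltNge => /ltW; apply: le_trans.
    by rewrite ler_pM2r// ler_nat.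
  apply: (le_trans (leeD hM hB)); rewrite -EFinD lee_fin.
  have : (8 * r) ^+ n <= 8 ^+ n * l ^+ n.
    by rewrite exprMn ler_wpM2l ?exprn_ge0// lerXn2r ?nnegrE ?(ltW r0) ?(ltW l0)// ltW.
  move=> /(ler_wpM2l (ltW e0)) h1; apply: (le_trans (lerD (lexx _) h1)).
  have ln : 0 <= l ^+ n by rewrite exprn_ge0// ltW.
  have -> : e * l ^+ n + e * (8 ^+ n * l ^+ n) = ((1 + 8 ^+ n) * e) * l ^+ n by ring.
  rewrite ler_wpM2r// ler_wpM2r ?(ltW e0)//.
  have : 0 <= 8 ^+ n :> R by rewrite exprn_ge0.
  lra.
have [[x0 [x0a x0r]]|out] := pselect (exists x, cube a l x /\ `|x| < 2 * r); last first.
  exists M; apply: (@le_trans _ _ (e * l ^+ n)%:E).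
    rewrite (eq_integral (fun x => (`|beta x - M|)%:E))//.
    move=> x; rewrite inE => xa; rewrite /h psi_out ?mulr0 ?subr0//.
    by rewrite leNgt; apply/negP => xr; apply: out; exists x.
  rewrite lee_fin ler_wpM2r ?exprn_ge0 ?(ltW l0)// ler_peMl ?(ltW e0)//.
  have : 0 <= 8 ^+ n :> R by rewrite exprn_ge0.
  lra.
(* With k least, doubling the cube k times brings its side between r and 2 r, where it can be
   compared with the large cube. *)
have exk : exists k, r < 2 ^+ k * l.
  exists (Num.truncn (r / l)).+1; rewrite -ltr_pdivrMr//.
  apply: lt_trans (truncnS_gt _) _; rewrite -natrX ltr_nat; exact: ltn_expl.
pose k := ex_minn exk.
have [k1 k2] : r < 2 ^+ k * l /\ 2 ^+ k * l <= 2 * r.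
  rewrite /k; case: ex_minnP => j rj jmin; split=> //.
  case: j rj jmin => [|j] rj jmin; first by move: rj; rewrite mul1r ltNge lr.
  rewrite exprS -mulrA ler_pM2l// leNgt; apply/negP => /jmin; by rewrite ltnn.
have twol i : 0 < 2 ^+ i * l by rewrite mulr_gt0// exprn_gt0.
have Q01 i : cube a l `<=` cube a (2 ^+ i * l).
  move=> x xa j; have /andP[h1 h2] := xa j; rewrite h1 (le_trans h2)// lerD2l.
  by rewrite ler_peMl ?(ltW l0)// exprn_ege1// ler1n.
have oi i : osc_le beta e a (2 ^+ i * l).
  by apply: obeta => //; apply: not_sub x1r; apply: Q01.
have [Mf hMf] := choice oi.
have stepM i : `|Mf i - Mf i.+1| <= (1 + 2 ^+ n) * e.
  have sub : cube a (2 ^+ i * l) `<=` cube a (2 ^+ i.+1 * l).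
    move=> x xa j; have /andP[h1 h2] := xa j; rewrite h1 (le_trans h2)// lerD2l.
    by rewrite exprS -mulrA ler_peMl ?(ltW (twol i))// ler1n.
  have := osc_const_le (twol i) mbeta sub (hMf i) (hMf i.+1).
  have -> : 2 ^+ i.+1 * l = 2 * (2 ^+ i * l) by rewrite exprS mulrA.
  rewrite [(2 * (2 ^+ i * l)) ^+ n]exprMn; have := exprn_gt0 n (twol i); move: ((2 ^+ i * l) ^+ n) => T T0.
  rewrite (_ : e * (T + 2 ^+ n * T) = (1 + 2 ^+ n) * e * T); last by ring.
  by rewrite ler_pM2r.
have lastM : `|Mf k - c0| <= (1 + 8 ^+ n) * e.
  have sub : cube a (2 ^+ k * l) `<=` cube (const_mx (- (4 * r))) (8 * r).
    rewrite B4 => x xa; rewrite /sup_ball /= normr_rV_le ?mulr_ge0 ?(ltW r0)//.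
    apply/forallP => i; have /andP[h1 h2] := xa i; have /andP[h3 h4] := x0a i.
    have : `|x0 ord0 i| <= 2 * r.
      by move: x0r => /ltW; rewrite normr_rV_le ?mulr_ge0 ?(ltW r0)// => /forallP.
    by rewrite !ler_norml => /andP[? ?]; apply/andP; split; lra.
  have := osc_const_le (twol k) mbeta sub (hMf k) hc0.
  have h1 : (8 * r) ^+ n <= 8 ^+ n * (2 ^+ k * l) ^+ n.
    rewrite [leLHS]exprMn ler_wpM2l ?exprn_ge0//.
    by apply: lerXn2r; rewrite ?nnegrE ?(ltW r0) ?(ltW (twol k))// ltW.
  have := exprn_gt0 n (twol k); move: ((2 ^+ k * l) ^+ n) h1 => T h1 T0 h2.
  rewrite -(ler_pM2r T0); apply: (le_trans h2).
  rewrite (_ : (1 + 8 ^+ n) * e * T = e * (T + 8 ^+ n * T)); last by ring.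
  by rewrite ler_wpM2l ?(ltW e0)// lerD2l.
have p8 : 2 ^+ n <= 8 ^+ n :> R by apply: lerXn2r; rewrite ?nnegrE// ler_nat.
have chainM j : `|Mf 0%N - Mf j| <= j%:R * ((1 + 8 ^+ n) * e).
  elim: j => [|j IH]; first by rewrite subrr normr0 mul0r.
  rewrite -[Mf 0%N](subrK (Mf j)) -addrA; apply: (le_trans (ler_normD _ _)).
  rewrite -natr1 mulrDl mul1r; apply: lerD => //; apply: (le_trans (stepM j)).
  by rewrite ler_wpM2r ?(ltW e0)// lerD2l.
pose D := (1 + 8 ^+ n) * e.
have D0 : 0 <= D by rewrite mulr_ge0 ?(ltW e0)// addr_ge0// exprn_ge0.
have Mc : `|Mf 0%N - c0| <= k.+1%:R * D.
  rewrite -[Mf 0%N](subrK (Mf k)) -addrA; apply: (le_trans (ler_normD _ _)).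
  by rewrite -natr1 mulrDl mul1r; apply: lerD.
(* k + 1 <= 2^k and l / r <= 2 / 2^k, so the length of the chain is absorbed. *)
have Mc2 : `|Mf 0%N - c0| * (l / r) <= 2 * D.
  have lr2 : l / r <= 2 / 2 ^+ k.
    rewrite ler_pdivrMr// mulrAC ler_pdivlMr ?exprn_gt0//.
    by rewrite mulrC (le_trans k2).
  have kk : k.+1%:R <= 2 ^+ k :> R by rewrite -natrX ler_nat ltn_expl.
  apply: (@le_trans _ _ (2 ^+ k * D * (2 / 2 ^+ k))).
    apply: ler_pM => //; first by rewrite divr_ge0 ?(ltW l0) ?(ltW r0).
    by apply: (le_trans Mc); rewrite ler_wpM2r.
  by rewrite le_eqVlt; apply/orP; left; apply/eqP; field; rewrite expf_neq0// pnatr_eq0.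
have hM0 : osc_at beta e a l (Mf 0%N) by have := hMf 0%N; rewrite expr0 mul1r.
exists (c0 + (Mf 0%N - c0) * (1 - psi a)).
(* e + 2 D is (3 + 2 8^n) e, the origin of the constant. *)
apply: (@osc_atW _ (e + 2 * D)) => //.
  by rewrite /D; have := mulr_ge0 (exprn_ge0 n (ler0n R 8)) (ltW e0); lra.
apply: osc_at_le hM0 _ _ => //; last by rewrite mulr_ge0.
move=> x xa.
have -> : beta x - h x - (c0 + (Mf 0%N - c0) * (1 - psi a)) =
    (beta x - Mf 0%N) * (1 - psi x) + (Mf 0%N - c0) * (psi a - psi x) by rewrite /h; ring.
apply: (le_trans (ler_normD _ _)); apply: lerD.
  rewrite normrM ler_piMr// ger0_norm ?subr_ge0 ?psi_le1//.
  by rewrite lerBlDr lerDl.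
rewrite normrM; apply: le_trans Mc2; rewrite ler_wpM2l//; apply: psi_lip.
rewrite normr_rV_le ?(ltW l0)//; apply/forallP => i; have /andP[h1 h2] := xa i.
by rewrite !mxE ler_norml; apply/andP; split; lra.
Qed.

End cutoff.

End oscillation.

(** * Smooth functions of one variable *)

Section smooth_line.
Context {R : realType}.
Implicit Types f g : R -> R.

(** Nothing is asked of the last derivative, which is harmless because [smooth1] demands every k. *)
Fixpoint Ck (k : nat) f : Prop := if k is k'.+1 then
  exists2 f' : R -> R, (forall x : R, is_derive x (1 : R) f (f' x)) & Ck k' f' else True.

Lemma CkS k f : Ck k.+1 f -> Ck k f.
Proof. by elim: k f => // k IH f [f' ff' Cf']; exists f' => //; exact: IH. Qed.

Lemma Ck_cst k c : Ck k (cst c).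
Proof.
by elim: k c => // k IH c; exists (cst 0) => // x; exact: is_derive_cst.
Qed.

Lemma CkD k f g : Ck k f -> Ck k g -> Ck k (f + g).
Proof.
elim: k f g => // k IH f g [f' ff' Cf'] [g' gg' Cg'].
by exists (f' + g') => [x|]; [exact: is_deriveD|exact: IH].
Qed.

Lemma CkM k f g : Ck k f -> Ck k g -> Ck k (f * g).
Proof.
elim: k f g => // k IH f g Cf Cg; have Cf' := CkS Cf; have Cg' := CkS Cg.
case: Cf Cg => [f' ff' Cf1] [g' gg' Cg1].
exists (f * g' + g * f'); last by apply: CkD; exact: IH.
by move=> x; exact: (is_deriveM (ff' x) (gg' x)).
Qed.

Lemma CkN k f : Ck k f -> Ck k (- f).
Proof.
elim: k f => // k IH f [f' ff' Cf'].
by exists (- f') => [x|]; [exact: is_deriveN|exact: IH].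
Qed.

Lemma CkV k f : (forall x, f x != 0) -> Ck k f -> Ck k (fun x => (f x)^-1).
Proof.
move=> f0; elim: k => // k IH Cf; have Cf1 := IH (CkS Cf).
case: Cf => f' ff' Cf'.
exists (- (f' * ((fun x => (f x)^-1) * (fun x => (f x)^-1)))).
  move=> x; have := is_deriveV (f0 x) (ff' x).
  rewrite (_ : - (f x) ^- 2 *: f' x = - (f' x * ((f x)^-1 * (f x)^-1)))//.
  by rewrite -[LHS]/(- (f x) ^- 2 * f' x) expr2 invfM; ring.
by apply: CkN; apply: CkM => //; exact: CkM.
Qed.

Lemma Ck_affine k f (c s : R) : Ck k f -> Ck k (fun x => f (c + s * x)).
Proof.
elim: k f => // k IH f [f' ff' Cf'].
exists (cst s * (fun x => f' (c + s * x))); last by apply: CkM; [exact: Ck_cst|exact: IH].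
move=> x; have h : is_derive x (1 : R) (fun x => c + s * x) s.
  have h0 : is_derive x (1 : R) (cst c + s *: (id : R -> R)) (0 + s *: 1) by exact: is_deriveD.
  by rewrite add0r [s *: 1]mulr1 in h0.
have -> : (cst s * (fun x => f' (c + s * x))) x = f' (c + s * x) * s by rewrite mulrC.
exact: (@is_derive1_comp _ f (fun x => c + s * x) x _ _ (ff' (c + s * x)) h).
Qed.

Definition smooth1 f := forall k, Ck k f.

Lemma smooth1_derive f : smooth1 f ->
  (forall x : R, derivable f x 1) /\ smooth1 (derive1 f).
Proof.
move=> sf; split; first by move=> x; have [f' ff' _] := sf 1%N; have [] := ff' x.
move=> k; have [f' ff' Cf'] := sf k.+1.
rewrite (_ : derive1 f = f')//; apply/funext => x; rewrite derive1E.
by have [_ ->] := ff' x.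
Qed.

Lemma smooth1_continuous f : smooth1 f -> continuous f.
Proof.
move=> /smooth1_derive[df _] x.
by apply: differentiable_continuous; apply/derivable1_diffP.
Qed.

(** The functions s^(-j) exp(-1/s), extended by 0: derivatives are linear combinations of members of
    the same family, so all are smooth at once. *)
Definition flat (j : nat) (s : R) : R :=
  if 0 < s then s^-1 ^+ j * expR (- s^-1) else 0.

(** From exp(1/h) >= h^(-(j+2)) / (j+2)!. The quadratic decay gives derivative 0 at the origin. *)
Lemma flat_le j h : 0 < h -> flat j h <= (j.+2)`!%:R * h ^+ 2.
Proof.
move=> h0; rewrite /flat h0; have u0 : 0 < h^-1 by rewrite invr_gt0.
have := expR_ge1Dxn j.+1 (ltW u0); set F := _%:R => h1.
have F0 : 0 < F by rewrite ltr0n fact_gt0.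
have h2 : h^-1 ^+ j.+2 / F <= expR h^-1 by apply: le_trans h1; rewrite lerDr.
rewrite expRN ler_pdivrMr ?expR_gt0//.
have -> : h^-1 ^+ j = F * h ^+ 2 * (h^-1 ^+ j.+2 / F).
  by rewrite !exprS; field; rewrite !gt_eqF.
by rewrite ler_wpM2l// mulr_ge0 ?(ltW F0)// exprn_ge0// ltW.
Qed.

Lemma flat_ge0 j h : 0 <= flat j h.
Proof.
rewrite /flat; case: ifP => // h0.
by rewrite mulr_ge0 ?expR_ge0// exprn_ge0// invr_ge0 ltW.
Qed.

Lemma is_derive_flat j x :
  is_derive x (1 : R) (flat j) (- (j%:R * flat j.+1 x) + flat j.+2 x).
Proof.
have [x0|x0|->] := ltgtP x 0.
- rewrite /flat ltNge (ltW x0)/= mulr0 oppr0 addr0.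
  apply: (@near_eq_is_derive _ _ _ (cst 0)).
  near=> y; rewrite /= ifN// -leNgt ltW//; near: y; exact: lt_nbhsl.
- rewrite /flat x0.
  have x0' : (id x : R) != 0 by rewrite gt_eqF.
  have dV : is_derive x (1 : R) (fun s : R => s^-1) (- x ^- 2).
    have := is_deriveV x0' (is_derive_id x (1 : R)).
    by rewrite [_ *: 1]mulr1.
  have dNV : is_derive x (1 : R) (fun s : R => - s^-1) (- - x ^- 2) by exact: is_deriveN.
  have dE := @is_derive1_comp _ expR (fun s : R => - s^-1) x _ _ (is_derive_expR (- x^-1)) dNV.
  have D := is_deriveM (is_deriveX j dV) dE.
  rewrite [X in is_derive _ _ _ X](_ : _ = - (j%:R * (x^-1 ^+ j.+1 * expR (- x^-1))) +
      x^-1 ^+ j.+2 * expR (- x^-1)) in D.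
    apply: near_eq_is_derive D.
    near=> y; have y0 : 0 < y by near: y; exact: lt_nbhsr.
    by rewrite y0 mulrfctE exprfctE.
  rewrite -![_ *: _]/(_ * _) /= !fctE.
  case: j => [|j] /=.
    by rewrite !expr0; field; rewrite gt_eqF.
  by rewrite !exprS; field; rewrite gt_eqF.
- rewrite /flat ltxx mulr0 oppr0 addr0.
  have h : (fun h : R => h^-1 *: ((flat j \o shift 0) (h *: 1) - flat j 0)) @ 0^' --> 0.
    apply/cvgrPdist_le => e e0.
    pose F : R := (j.+2)`!%:R.
    have F0 : 0 < F by rewrite ltr0n fact_gt0.
    near=> t; rewrite sub0r normrN /= addr0 [t *: 1]mulr1 {2}/flat ltxx subr0.
    have te : `|t| <= e / F by near: t; apply: dnbhs0_le; rewrite divr_gt0.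
    have [t0|t0] := ltP 0 t; last by rewrite /flat ltNge t0/= scaler0 normr0 ltW.
    rewrite normrM normfV !ger0_norm ?flat_ge0 ?(ltW t0)// ler_pdivrMl//.
    apply: (le_trans (flat_le j t0)); rewrite -/F expr2 mulrCA ler_pM2l//.
    by rewrite mulrC -ler_pdivlMr// (le_trans _ te)// ler_norm.
  have dv : 'D_1 (flat j) 0 = 0 by exact: (cvg_lim _ h).
  by apply: DeriveDef => //; apply/cvg_ex; exists 0.
Unshelve. all: by end_near.
Qed.

Lemma smooth1_flat j : smooth1 (flat j).
Proof.
move=> k; elim: k j => // k IH j.
exists (- (cst j%:R * flat j.+1) + flat j.+2) => [x|]; first exact: is_derive_flat.
by apply: CkD => //; apply: CkN; apply: CkM => //; exact: Ck_cst.
Qed.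

Lemma flat0_gt0 s : 0 < s -> 0 < flat 0 s.
Proof. by move=> s0; rewrite /flat s0 expr0 mul1r expR_gt0. Qed.

Lemma flat0_eq0 s : s <= 0 -> flat 0 s = 0.
Proof. by move=> s0; rewrite /flat ltNge s0. Qed.

Definition smooth_step (s : R) : R := flat 0 s / (flat 0 s + flat 0 (1 - s)).

Let denom_gt0 s : 0 < flat 0 s + flat 0 (1 - s).
Proof.
have [s0|s0] := ltP 0 s; first by rewrite ltr_wpDr ?flat_ge0// flat0_gt0.
by rewrite ltr_wpDl ?flat_ge0// flat0_gt0//; lra.
Qed.

Lemma smooth_step_le0 s : s <= 0 -> smooth_step s = 0.
Proof. by move=> s0; rewrite /smooth_step flat0_eq0// mul0r. Qed.

Lemma smooth_step_ge1 s : 1 <= s -> smooth_step s = 1.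
Proof.
move=> s1; rewrite /smooth_step [flat 0 (1 - s)]flat0_eq0 ?subr_le0// addr0 divff//.
by rewrite gt_eqF// flat0_gt0// (lt_le_trans ltr01).
Qed.

Lemma smooth_step_ge0 s : 0 <= smooth_step s.
Proof. by rewrite divr_ge0 ?flat_ge0// ltW. Qed.

Lemma smooth_step_le1 s : smooth_step s <= 1.
Proof. by rewrite ler_pdivrMr// mul1r lerDl flat_ge0. Qed.

Lemma smooth1_step : smooth1 smooth_step.
Proof.
move=> k; rewrite (_ : smooth_step = flat 0 * (fun s => (flat 0 s + flat 0 (1 + (-1) * s))^-1)).
  apply: CkM; first exact: smooth1_flat.
  apply: CkV => [x|]; first by rewrite mulN1r gt_eqF.
  by apply: CkD; [exact: smooth1_flat|apply: (Ck_affine 1 (-1)); exact: smooth1_flat].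
by apply/funext => s; rewrite /smooth_step mulrfctE mulN1r.
Qed.

(* Integer translates of [bump] sum to 1, by telescoping. *)
Definition bump (s : R) : R := smooth_step (1 + s) - smooth_step s.

Lemma smooth1_bump : smooth1 bump.
Proof.
move=> k; rewrite (_ : bump = (fun s => smooth_step (1 + 1 * s)) + (- smooth_step)).
  by apply: CkD; [apply: (Ck_affine 1 1)|apply: CkN]; exact: smooth1_step.
by apply/funext => s; rewrite addrfctE opprfctE mul1r.
Qed.

Lemma bump_ge0 s : 0 <= bump s.
Proof.
have [s0|s0] := leP s 0; rewrite /bump.
  by rewrite (smooth_step_le0 s0) subr0 smooth_step_ge0.
by rewrite [smooth_step (1 + s)]smooth_step_ge1 ?subr_ge0 ?smooth_step_le1// lerDl ltW.
Qed.

Lemma bump_out s : 1 <= `|s| -> bump s = 0.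
Proof.
rewrite ler_normr /bump => /orP[s1|s1].
  by rewrite !smooth_step_ge1 ?subrr//; lra.
by rewrite !smooth_step_le0 ?subrr//; lra.
Qed.

Lemma sum_bumpE (K : nat) s :
  \sum_(k < K) bump (s - k%:R) = smooth_step (1 + s) - smooth_step (1 + s - K%:R).
Proof.
elim: K => [|K IH]; first by rewrite big_ord0 subr0 subrr.
rewrite big_ord_recr /= IH /bump -natr1 opprD.
have -> : 1 + s + (- K%:R - 1) = s - K%:R by ring.
have -> : 1 + (s - K%:R) = 1 + s - K%:R by ring.
by rewrite addrA subrK.
Qed.

Lemma sum_bump_le1 (K : nat) s : \sum_(k < K) bump (s - k%:R) <= 1.
Proof.
rewrite sum_bumpE; have := smooth_step_le1 (1 + s).
have := smooth_step_ge0 (1 + s - K%:R); lra.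
Qed.

Lemma sum_bump (K : nat) s : 0 <= s -> s <= K%:R - 1 -> \sum_(k < K) bump (s - k%:R) = 1.
Proof.
move=> s0 sK; rewrite sum_bumpE smooth_step_ge1 ?lerDl//.
by rewrite smooth_step_le0 ?subr0//; lra.
Qed.

End smooth_line.

Section tensor.
Context {R : realType} {n : nat}.
Local Notation Rn := 'rV[R]_n.

Definition tensor (u : 'I_n -> R -> R) (x : Rn) : R := \prod_i u i (x ord0 i).

(** Partial derivatives of such sums are again such sums, so smoothness in n variables reduces to
    that of the one-variable factors. *)
Definition lincomb (L : seq (R * ('I_n -> R -> R))) (x : Rn) : R :=
  \sum_(p <- L) p.1 * tensor p.2 x.

Definition tensor_derive (i : 'I_n) (u : 'I_n -> R -> R) : 'I_n -> R -> R :=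
  fun j => if j == i then derive1 (u j) else u j.

Lemma tensor_shift (u : 'I_n -> R -> R) i (h : R) x :
  tensor u (h *: delta_mx ord0 i + x) =
  u i (h + x ord0 i) * \prod_(j | j != i) u j (x ord0 j).
Proof.
rewrite /tensor (bigD1 i)//= !mxE !eqxx mulr1; congr (_ * _).
by apply: eq_bigr => j ji; rewrite !mxE (negbTE ji) andbF mulr0 add0r.
Qed.

Lemma is_derive_tensor u i x : (forall j, smooth1 (u j)) ->
  is_derive x (delta_mx ord0 i) (tensor u) (tensor (tensor_derive i u) x).
Proof.
move=> su; have [du _] := smooth1_derive (su i).
pose c := \prod_(j | j != i) u j (x ord0 j).
have E : tensor (tensor_derive i u) x = c * derive1 (u i) (x ord0 i).
  rewrite /tensor (bigD1 i)//= /tensor_derive eqxx mulrC; congr (_ * _).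
  by apply: eq_bigr => j /negbTE ->.
have h : (fun h : R => h^-1 *: ((tensor u \o shift x) (h *: delta_mx ord0 i) - tensor u x)) @ 0^'
    --> c * derive1 (u i) (x ord0 i).
  rewrite (_ : (fun _ => _) = (fun h : R => c * (h^-1 *: ((u i \o shift (x ord0 i)) (h *: 1) - u i (x ord0 i))))).
    by apply: cvgMr; rewrite derive1E; exact: du.
  apply/funext => h; rewrite /= tensor_shift -/c.
  have -> : tensor u x = u i (x ord0 i) * c by rewrite /tensor (bigD1 i).
  rewrite [h *: 1]mulr1 -mulrBl; set w := u i (h + _) - _.
  by rewrite [LHS](mulrCA (h^-1) w c : _ = w * (h^-1 * c)) [RHS]mulrCA mulrA mulrC.
by rewrite E; apply: DeriveDef; [apply/cvg_ex; exists (c * derive1 (u i) (x ord0 i))|exact: cvg_lim h].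
Qed.

Definition smooth_factors (L : seq (R * ('I_n -> R -> R))) :=
  all (fun p => `[< forall i, smooth1 (p.2 i) >]) L.

Lemma is_derive_lincomb L i x : smooth_factors L ->
  is_derive x (delta_mx ord0 i) (lincomb L)
    (lincomb [seq (p.1, tensor_derive i p.2) | p <- L] x).
Proof.
elim: L => [|p L IH] /=.
  rewrite (_ : lincomb [::] = cst 0); last by apply/funext => y; rewrite /lincomb big_nil.
  by move=> _; exact: is_derive_cst.
move=> /andP[/asboolP sp sL].
rewrite (_ : lincomb (p :: L) = p.1 *: tensor p.2 + lincomb L); last first.
  by apply/funext => y; rewrite /lincomb big_cons.
have := IH sL; have := is_derive_tensor i x sp => d1 d2.
rewrite (_ : lincomb (_ :: _) x = p.1 *: tensor (tensor_derive i p.2) x +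
  lincomb [seq (q.1, tensor_derive i q.2) | q <- L] x); last by rewrite /lincomb big_cons.
by apply: is_deriveD; exact: is_deriveZ.
Qed.

Lemma smooth_factors_derive L i : smooth_factors L ->
  smooth_factors [seq (p.1, tensor_derive i p.2) | p <- L].
Proof.
rewrite /smooth_factors all_map; apply: sub_all => p /asboolP sp /=; apply/asboolP => j.
by rewrite /tensor_derive; case: ifP => // _; have [_] := smooth1_derive (sp j).
Qed.

Lemma continuous_lincomb L : smooth_factors L -> continuous (lincomb L).
Proof.
elim: L => [|p L IH] /=.
  rewrite (_ : lincomb [::] = cst 0); last by apply/funext => y; rewrite /lincomb big_nil.
  by move=> _; exact: cst_continuous.
move=> /andP[/asboolP sp sL].
rewrite (_ : lincomb (p :: L) = (fun x => p.1 * tensor p.2 x) + lincomb L); last first.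
  by apply/funext => y; rewrite /lincomb big_cons.
move=> x; apply: continuousD; last exact: IH.
apply: continuousM; first exact: cst_continuous.
rewrite /tensor; elim: (index_enum _) => [|i s IHs].
  rewrite (_ : (fun _ => _) = cst 1); first exact: cst_continuous.
  by apply/funext => y; rewrite big_nil.
rewrite (_ : (fun _ => _) = (fun y : Rn => p.2 i (y ord0 i)) * (fun y => \prod_(j <- s) p.2 j (y ord0 j))).
  apply: continuousM => //; apply: (@continuous_comp _ _ _ (fun y : Rn => y ord0 i) (p.2 i)).
    exact: coord_continuous.
  exact: smooth1_continuous.
by apply/funext => y; rewrite big_cons.
Qed.

Lemma iter_partial_lincomb L s : smooth_factors L ->
  exists2 L', smooth_factors L' & iter_partial s (lincomb L) = lincomb L'.
Proof.
move=> sL; elim: s => [|i s [L' sL' E]] /=; first by exists L.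
exists [seq (p.1, tensor_derive i p.2) | p <- L']; first exact: smooth_factors_derive.
rewrite E; apply/funext => x; have [_] := is_derive_lincomb i x sL'; exact.
Qed.

Lemma smooth_lincomb L : smooth_factors L -> smooth (lincomb L).
Proof.
move=> sL s; have [L' sL' ->] := iter_partial_lincomb s sL; split.
  exact: continuous_lincomb.
by move=> i x; have [] := is_derive_lincomb i x sL'.
Qed.

End tensor.

(** * Averaging against a smooth partition of unity *)

Section discretize.
Context {R : realType} {n : nat}.
Local Notation Rn := 'rV[R]_n.
Implicit Types (u h : Rn -> R) (a y : Rn) (l e M : R).

(** Per axis, the integer part of l / t plus one tiles suffice, and this is at most 2 l / t because
    t <= l. *)
Lemma cube_tiling a l t : 0 < t -> t <= l -> exists N : nat, N.+1%:R * t <= 2 * l /\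
  forall x, cube a l x ->
    exists k : {ffun 'I_n -> 'I_N.+1}, cube (a + t *: (\row_i (k i)%:R : Rn)) t x.
Proof.
move=> t0 tl; exists (Num.truncn (l / t)).
have lt0 : 0 <= l / t by rewrite divr_ge0// ltW// (lt_le_trans t0).
split.
  have h1 : (Num.truncn (l / t))%:R <= l / t by rewrite truncn_le.
  have h2 : (Num.truncn (l / t))%:R * t <= l by rewrite -ler_pdivlMr.
  by rewrite -natr1 mulrDl mul1r; lra.
move=> x xa; exists [ffun i => inord (Num.truncn ((x ord0 i - a ord0 i) / t))] => i.
have /andP[h1 h2] := xa i; rewrite !mxE ffunE.
have q0 : 0 <= (x ord0 i - a ord0 i) / t by rewrite divr_ge0 ?(ltW t0)// subr_ge0.
rewrite inordK; last first.
  rewrite ltnS le_truncn// ler_pM2r ?invr_gt0//; lra.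
have /andP[] := truncn_itv q0; rewrite ler_pdivlMr// ltr_pdivrMr// -natr1 => h3 h4.
by apply/andP; split; lra.
Qed.

(** All tiles share the constant 0, so their integrals add up, and ((N + 1) t)^n <= (2 l)^n. *)
Lemma osc_at_tiling u e t a l : 0 < t -> t <= l -> measurable_fun setT u -> 0 <= e ->
  (forall y, osc_at u e y t 0) -> osc_at u (2 ^+ n * e) a l 0.
Proof.
move=> t0 tl mu e0 H; have [N [NE cover]] := cube_tiling a t0 tl.
pose D (k : {ffun 'I_n -> 'I_N.+1}) := cube (a + t *: (\row_i (k i)%:R : Rn)) t.
pose f x := (`|u x - 0|)%:E.
have mf A : measurable_fun A f by exact: measurable_abs_sub.
have f0 x : (0 <= f x)%E by rewrite lee_fin.
have mD k : measurable (D k) by exact: measurable_cube.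
have sub s : (\int[Leb n]_(x in \big[setU/set0]_(k <- s) D k) f x <=
    \sum_(k <- s) \int[Leb n]_(x in D k) f x)%E.
  elim: s => [|k s IH]; first by rewrite !big_nil integral_set0.
  rewrite !big_cons; set U := \big[setU/set0]_(_ <- _) _.
  rewrite (_ : D k `|` U = D k `|` (U `\` D k)); last by rewrite setDE setUIr setUv setIT.
  have mS : measurable U by exact: bigsetU_measurable.
  rewrite ge0_integral_setU//; last 2 first.
  - exact: measurableD.
  - by apply/disj_setPS => x [? []].
  apply: leeD => //; apply: le_trans IH; apply: ge0_subset_integral => //.
  exact: measurableD.
apply: (@le_trans _ _ (\int[Leb n]_(x in \big[setU/set0]_(k <- index_enum {ffun 'I_n -> 'I_N.+1}) D k) f x)%E).
  apply: ge0_subset_integral => //; first exact: measurable_cube.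
    exact: bigsetU_measurable.
  by move=> x /cover[k xk]; rewrite -bigcup_seq; exists k => //=; exact: mem_index_enum.
apply: (le_trans (sub _)).
apply: (@le_trans _ _ (\sum_(k : {ffun 'I_n -> 'I_N.+1}) (e * t ^+ n)%:E)%E).
  by apply: lee_sum => k _; exact: H.
rewrite sumEFin sumr_const card_ffun !card_ord lee_fin -[leLHS]mulr_natl natrX.
have -> : N.+1%:R ^+ n * (e * t ^+ n) = e * (N.+1%:R * t) ^+ n by rewrite exprMn; ring.
have -> : 2 ^+ n * e * l ^+ n = e * (2 * l) ^+ n by rewrite exprMn; ring.
have p0 : 0 <= N.+1%:R * t by rewrite mulr_ge0// ltW.
by rewrite ler_wpM2l// lerXn2r ?nnegrE// (le_trans p0 NE).
Qed.

Section approximation.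
Variables (h : Rn -> R) (R0 r e : R).
Hypotheses (R0_gt0 : 0 < R0) (r0 : 0 < r) (e0 : 0 < e).
Hypothesis mh : measurable_fun setT h.
Hypothesis h_out : forall x, R0 <= `|x| -> h x = 0.
Hypothesis oh : forall a l, 0 < l -> l <= r -> osc_le h e a l.

(** The windows below have side 4 t, on which the oscillation of h is under control. *)
Let t := r / 4.
Let t0 : 0 < t. Proof. by rewrite divr_gt0. Qed.
(** The margin t makes the partition of unity sum to 1 on each whole cube of side t that meets a
    point with h nonzero. *)
Let A := R0 + t.
(** Large enough that [sigma x i] is at most K - 1 when |x| <= A, as [sum_bump] requires. *)
Let K := (Num.truncn (2 * A / t)).+2.
Let node (j : {ffun 'I_n -> 'I_K}) : Rn := \row_i (t * (j i)%:R - A).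
(** The bump of scale t around coordinate i of the node, in the affine form of [Ck_affine]. *)
Let eta (j : {ffun 'I_n -> 'I_K}) (i : 'I_n) (s : R) := bump ((A / t - (j i)%:R) + t^-1 * s).

Let sigma (x : Rn) (i : 'I_n) := (x ord0 i + A) / t.

Let etaE j i (x : Rn) : eta j i (x ord0 i) = bump (sigma x i - (j i)%:R).
Proof. by rewrite /eta /sigma; congr bump; field; rewrite gt_eqF. Qed.

Let sum_eta (x : Rn) : \sum_j tensor (eta j) x = \prod_i \sum_(k < K) bump (sigma x i - k%:R).
Proof.
rewrite bigA_distr_bigA; apply: eq_bigr => j _; apply: eq_bigr => i _; exact: etaE.
Qed.

Let sum_eta_le1 (x : Rn) : \sum_j tensor (eta j) x <= 1.
Proof.
rewrite sum_eta; apply: prodr_ile1 => i _; rewrite sum_bump_le1 andbT.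
by apply: sumr_ge0 => k _; exact: bump_ge0.
Qed.

Let sum_eta1 (x : Rn) : `|x| <= A -> \sum_j tensor (eta j) x = 1.
Proof.
have A0 : 0 <= A by rewrite addr_ge0// ltW.
rewrite normr_rV_le// => /forallP xA; rewrite sum_eta big1// => i _.
have := xA i; rewrite ler_norml => /andP[h1 h2]; apply: sum_bump.
  by rewrite divr_ge0 ?(ltW t0)//; lra.
rewrite /K -natr1 addrK; apply: ltW; apply: (le_lt_trans _ (truncnS_gt _)).
by rewrite /sigma ler_pM2r ?invr_gt0//; lra.
Qed.

Let tensor_eta_ge0 j (x : Rn) : 0 <= tensor (eta j) x.
Proof. by apply: prodr_ge0 => i _; exact: bump_ge0. Qed.

Let eta_supp j (x : Rn) i : tensor (eta j) x != 0 -> `|x ord0 i - node j ord0 i| < t.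
Proof.
move=> hx; rewrite ltNge; apply/negP => h1; move/negP: hx; apply.
rewrite /tensor (bigD1 i)//= etaE bump_out ?mul0r//.
rewrite mxE in h1.
have -> : sigma x i - (j i)%:R = (x ord0 i - (t * (j i)%:R - A)) / t.
  by rewrite /sigma; field; rewrite gt_eqF.
by rewrite normrM normfV (gtr0_norm t0) ler_pdivlMr// mul1r.
Qed.

(** Lower corner of the cube of side 4 t centred at the node, which contains each cube of side t on
    which [tensor (eta j)] is somewhere nonzero. *)
Let window j : Rn := node j - const_mx (2 * t).

Let window_le : 4 * t <= r. Proof. by rewrite mulrC divfK. Qed.

Let GamP j : exists M, osc_at h e (window j) (4 * t) M.
Proof. by apply: oh => //; rewrite mulr_gt0. Qed.

Let Gam j := projT1 (cid (GamP j)).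

Let osc_Gam j : osc_at h e (window j) (4 * t) (Gam j).
Proof. by rewrite /Gam; case: cid. Qed.

Let L : seq (R * ('I_n -> R -> R)) := [seq (Gam j, eta j) | j <- index_enum {ffun 'I_n -> 'I_K}].

Let phi := lincomb L.

Let phiE (x : Rn) : phi x = \sum_j Gam j * tensor (eta j) x.
Proof. by rewrite /phi /lincomb big_map. Qed.

Let smooth_L : smooth_factors L.
Proof.
rewrite /smooth_factors all_map; apply/allP => j _ /=; apply/asboolP => i k.
by apply: Ck_affine; exact: smooth1_bump.
Qed.

Let phi_bounded (x : Rn) : `|phi x| <= \sum_j `|Gam j|.
Proof.
rewrite phiE; apply: (le_trans (ler_norm_sum _ _ _)); apply: ler_sum => j _.
rewrite normrM (ger0_norm (tensor_eta_ge0 j x)) ler_piMr//.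
apply: le_trans (sum_eta_le1 x); rewrite (bigD1 j)//= lerDl.
by apply: sumr_ge0 => k _; exact: tensor_eta_ge0.
Qed.

Let phi_out (x : Rn) : A + t * K%:R < `|x| -> phi x = 0.
Proof.
move=> xA; rewrite phiE big1// => j _.
have [->|hx] := eqVneq (tensor (eta j) x) 0; first by rewrite mulr0.
move: xA; rewrite ltNge => /negP[]; have A0 : 0 <= A by rewrite addr_ge0// ltW.
have tK : 0 <= t * K%:R by rewrite mulr_ge0// ltW.
rewrite normr_rV_le; last exact: addr_ge0.
apply/forallP => i.
have := eta_supp i hx; rewrite mxE ltr_norml => /andP[h1 h2].
have j0 : 0 <= t * (j i)%:R by rewrite mulr_ge0// ltW.
have jK : t * (j i)%:R + t <= t * K%:R.
  by rewrite -{2}[t]mulr1 -mulrDr ler_pM2l// natr1 ler_nat.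
by rewrite ler_norml; apply/andP; split; lra.
Qed.

(** phi - c is the sum of (Gam j - c) tensor (eta j) plus c times the defect of the partition of
    unity. The first is small because the constants of nested cubes are close, the second
    vanishes. *)
Let local_const y : exists c, osc_at h e y t c /\
  forall x, cube y t x -> `|phi x - c| <= e * (1 + 4 ^+ n).
Proof.
have tr : t <= r by apply: le_trans window_le; move: (t) t0 => ? ?; lra.
(* Either h is 0 on the cube and c = 0 is taken, or the cube lies where the partition of unity sums
   to 1. *)
have [c hc out] : exists2 c, osc_at h e y t c &
    c != 0 -> forall x, cube y t x -> `|x| <= A.
  have [[z [yz hz]]|hD] := pselect (exists z, cube y t z /\ h z != 0).
    have [c hc] := oh y t0 tr; exists c => // _ x yx.
    have zR : `|z| <= R0 by rewrite leNgt; apply: contra hz => zR; rewrite h_out// ltW.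
    have := normr_rV_le z (ltW R0_gt0); rewrite zR => /esym/forallP zR'.
    rewrite normr_rV_le; last by rewrite /A addr_ge0 ?(ltW R0_gt0) ?(ltW t0).
    apply/forallP => i.
    have := zR' i; rewrite !ler_norml => /andP[h1 h2].
    have /andP[h3 h4] := yz i; have /andP[h5 h6] := yx i.
    by rewrite /A; apply/andP; split; lra.
  exists 0; last by rewrite eqxx.
  rewrite /osc_at (eq_integral (fun _ => 0%E)).
    by rewrite integral0 lee_fin mulr_ge0 ?exprn_ge0// ltW.
  move=> x; rewrite inE => yx; rewrite subr0; have [->|hx] := eqVneq (h x) 0; first by rewrite normr0.
  by case: hD; exists x.
exists c; split => // x yx.
have -> : phi x - c = \sum_j (Gam j - c) * tensor (eta j) x + c * (\sum_j tensor (eta j) x - 1).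
  rewrite phiE mulrBr mulr1 mulr_sumr addrA -big_split /=; congr (_ - _).
  by apply: eq_bigr => j _; rewrite mulrBl subrK.
have -> : c * (\sum_j tensor (eta j) x - 1) = 0.
  have [->|c0] := eqVneq c 0; first by rewrite mul0r.
  by rewrite (sum_eta1 (out c0 x yx)) subrr mulr0.
have E0 : 0 <= e * (1 + 4 ^+ n) by rewrite mulr_ge0 ?(ltW e0)// addr_ge0// exprn_ge0.
rewrite addr0; apply: (le_trans (ler_norm_sum _ _ _)).
apply: (@le_trans _ _ (\sum_j (e * (1 + 4 ^+ n)) * tensor (eta j) x)); last first.
  by rewrite -mulr_sumr ler_piMr.
apply: ler_sum => j _; rewrite normrM (ger0_norm (tensor_eta_ge0 j x)).
have [->|hx] := eqVneq (tensor (eta j) x) 0; first by rewrite !mulr0.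
rewrite ler_wpM2r//.
have sub : cube y t `<=` cube (window j) (4 * t).
  move=> z yz i; have /andP[h3 h4] := yz i; have /andP[h5 h6] := yx i.
  have := eta_supp i hx; rewrite ltr_norml => /andP[h1 h2].
  have -> : window j ord0 i = node j ord0 i - 2 * t by rewrite /window !mxE.
  by apply/andP; split; lra.
have H := osc_const_le t0 mh sub hc (osc_Gam j).
rewrite -(ler_pM2r (exprn_gt0 n t0)) distrC; apply: (le_trans H).
by rewrite (exprMn n 4 t) le_eqVlt; apply/orP; left; apply/eqP; ring.
Qed.

(** On cubes of side at most t, phi is nearly constant. When the side is t, one constant c serves
    both h and phi, so h - phi is small with constant 0, and larger cubes are tiled by these. *)
Lemma discretize : exists phi : Rn -> R, [/\ smooth phi,
  exists rho, forall x, rho < `|x| -> phi x = 0,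
  exists M, forall x, `|phi x| <= M &
  forall a l, 0 < l -> osc_le (fun x => h x - phi x) (2 ^+ n * (e + e * (1 + 4 ^+ n))) a l].
Proof.
exists phi; split; [exact: smooth_lincomb|by exists (A + t * K%:R)|by eexists; exact: phi_bounded|].
have mphi : measurable_fun setT phi by apply: measurable_continuous; exact: continuous_lincomb.
have mhp : measurable_fun setT (fun x => h x - phi x) by exact: measurable_funB.
have E0 : 0 <= e * (1 + 4 ^+ n) by rewrite mulr_ge0 ?(ltW e0)// addr_ge0// exprn_ge0.
have small a l M y : 0 < l -> cube a l `<=` cube y t -> osc_at h e a l M ->
    (forall c, (forall x, cube y t x -> `|phi x - c| <= e * (1 + 4 ^+ n)) ->
      osc_at (fun x => h x - phi x) (e + e * (1 + 4 ^+ n)) a l (M - c)).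
  move=> l0 ay hM c hc; apply: (osc_at_le l0 mh mhp hM) => // x /ay/hc.
  rewrite (_ : h x - phi x - (M - c) = h x - M - (phi x - c)); last by ring.
  by move=> H; apply: (le_trans (ler_normB _ _)); rewrite lerD2l.
move=> a l l0; have [lt|tl] := leP l t.
  have [M hM] : osc_le h e a l by apply: oh => //; apply: (le_trans lt); apply: le_trans window_le; lra.
  have [c [_ hc]] := local_const a; exists (M - c).
  apply: (osc_atW l0 _ (small a l M a l0 _ hM c hc)).
    rewrite ler_peMl ?addr_ge0 ?(ltW e0)// exprn_ege1//; lra.
  move=> x xa i; have /andP[h1 h2] := xa i; apply/andP; split => //; lra.
exists 0; apply: (@osc_at_tiling (fun x => h x - phi x) (e + e * (1 + 4 ^+ n)) t a l t0 (ltW tl) mhp).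
  by rewrite addr_ge0 ?(ltW e0).
move=> y; have [c [hc1 hc]] := local_const y.
by rewrite -(subrr c); exact: (small y t c y).
Qed.

End approximation.
End discretize.

Section mean_oscillation.
Context {R : realType} {n : nat}.
Local Notation Rn := 'rV[R]_n.
Implicit Types (u : Rn -> R) (f : Rn -> R[i]) (a : Rn) (l e M : R).

Lemma osc_leD u (v : Rn -> R) e e' a l : 0 < l -> measurable_fun setT u -> measurable_fun setT v ->
  osc_le u e a l -> osc_le v e' a l -> osc_le (fun x => u x + v x) (e + e') a l.
Proof.
move=> l0 mu mv [M uM] [N vN]; have mc := measurable_cube a l.
exists (M + N); rewrite /osc_at.
apply: (@le_trans _ _ (\int[Leb n]_(x in cube a l) ((`|u x - M|)%:E + (`|v x - N|)%:E))%E).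
  apply: ge0_le_integral => //.
  - by apply: measurable_abs_sub; exact: measurable_funD.
  - by apply: emeasurable_funD; exact: measurable_abs_sub.
  - move=> x _; rewrite -EFinD lee_fin.
    rewrite (_ : u x + v x - (M + N) = (u x - M) + (v x - N)); last by ring.
    exact: ler_normD.
rewrite ge0_integralD//; [|exact: measurable_abs_sub|exact: measurable_abs_sub].
by rewrite mulrDl EFinD; exact: leeD.
Qed.

Lemma osc_leN u e a l : osc_le u e a l -> osc_le (fun x => - u x) e a l.
Proof.
move=> [M uM]; exists (- M); apply: le_trans uM; rewrite le_eqVlt; apply/orP; left; apply/eqP.
by apply: eq_integral => x _; rewrite opprK addrC distrC.
Qed.

(** The mean differs from M by the average of u - M, which is at most e in absolute value. *)
Lemma mean_osc u e a l M : 0 < l -> measurable_fun setT u -> osc_at u e a l M ->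
  osc_at u (e + e) a l ((fine (Leb n (cube a l)))^-1 * \int[Leb n]_(x in cube a l) u x).
Proof.
move=> l0 mu uM; have mc := measurable_cube a l.
have ln0 : 0 < l ^+ n by rewrite exprn_gt0.
have Lc : Leb n (cube a l) = (l ^+ n)%:E by rewrite Leb_cube ?(ltW l0).
have iuM : (Leb n).-integrable (cube a l) (EFin \o (fun x => u x - M)).
  apply/integrableP; split.
    by apply/measurable_EFinP; apply: measurable_funTS; exact: measurable_funB.
  exact: (le_lt_trans uM (ltry _)).
have iM : (Leb n).-integrable (cube a l) (EFin \o cst M).
  apply/integrableP; split; first by apply/measurable_EFinP; exact: measurable_cst.
  rewrite [ltLHS](_ : _ = (`|M|%:E * Leb n (cube a l))%E); last first.
    by rewrite (eq_integral (cst (`|M|%:E)%E)) ?integral_cst.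
  by have -> := Lc; rewrite -EFinM ltry.
set A := _ * _; have AM : `|A - M| * l ^+ n <= e * l ^+ n.
  have -> : A - M = (l ^+ n)^-1 * \int[Leb n]_(x in cube a l) (u x - M).
    have H : \int[Leb n]_(x in cube a l) u x =
        \int[Leb n]_(x in cube a l) (u x - M) + \int[Leb n]_(x in cube a l) M.
      rewrite -RintegralD//; apply: eq_Rintegral => x _; by rewrite subrK.
    rewrite /A Lc /= H mulrDr -addrA [X in _ + X](_ : _ = 0) ?addr0//.
    rewrite Rintegral_cst//; have -> : fine (Leb n (cube a l)) = l ^+ n by rewrite Lc.
    by rewrite mulrCA mulVf ?mulr1 ?subrr// gt_eqF.
  rewrite normrM gtr0_norm ?invr_gt0// mulrC mulrA divff ?mul1r ?gt_eqF//.
  apply: (le_trans (le_normr_Rintegral mc iuM)); rewrite /Rintegral -lee_fin.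
  by rewrite fineK// ge0_fin_numE ?integral_ge0//; exact: (le_lt_trans uM (ltry _)).
rewrite ler_pM2r// in AM.
apply: (osc_at_le l0 mu mu uM); last exact: (le_trans (normr_ge0 _) AM).
move=> x _; rewrite (_ : u x - A = (u x - M) - (A - M)); last by ring.
by apply: (le_trans (ler_normB _ _)); rewrite lerD2l.
Qed.

(** A factor 2 for passing to the mean and another for adding the real and imaginary parts. *)
Lemma bmo_norm_le f e : cmeasurable f ->
  (forall a l, 0 < l -> osc_le (fun x => complex.Re (f x)) e a l) ->
  (forall a l, 0 < l -> osc_le (fun x => complex.Im (f x)) e a l) ->
  (bmo_norm f <= (4 * e)%:E)%E.
Proof.
move=> mf oR oI; apply: ge_ereal_sup => _ [_ [a [l [l0 ->]]] <-].
rewrite -[X in mean X]/(cube a l) -[X in cmean X]/(cube a l).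
have [mR mI] := mf; have mc := measurable_cube a l.
have ln0 : 0 < l ^+ n by rewrite exprn_gt0.
have [M hM] := oR a l l0; have [N hN] := oI a l l0.
have hR := mean_osc l0 mR hM; have hI := mean_osc l0 mI hN.
have Lc : Leb n (cube a l) = (l ^+ n)%:E by rewrite Leb_cube ?(ltW l0).
rewrite /mean.
have -> : fine (Leb n (cube a l)) = l ^+ n by rewrite Lc.
pose A := (fine (Leb n (cube a l)))^-1 * \int[Leb n]_(x in cube a l) complex.Re (f x).
pose B := (fine (Leb n (cube a l)))^-1 * \int[Leb n]_(x in cube a l) complex.Im (f x).
rewrite -/A in hR; rewrite -/B in hI.
have -> : cmean (cube a l) f = (A +i* B)%C.
  by apply: eq_complex; rewrite /= mul0r ?subr0 ?addr0.
apply: (@le_trans _ _ (((l ^+ n)^-1)%:E * (((e + e) * l ^+ n)%:E + ((e + e) * l ^+ n)%:E))%E).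
  apply: lee_wpmul2l; first by rewrite lee_fin invr_ge0 ltW.
  apply: (@le_trans _ _ (\int[Leb n]_(x in cube a l)
     ((`|complex.Re (f x) - A|)%:E + (`|complex.Im (f x) - B|)%:E))%E).
    apply: ge0_le_integral => //.
    - by move=> x _; rewrite lee_fin normc_ge0.
    - apply/measurable_EFinP; apply: measurable_funTS; apply: measurable_normc.
      by apply: cmeasurableB => //; exact: cmeasurable_cst.
    - by apply: emeasurable_funD; exact: measurable_abs_sub.
    - move=> x _; rewrite -EFinD lee_fin; apply: (le_trans (normc_le _)).
      by rewrite ReD ImD ReN ImN.
  rewrite ge0_integralD//; [|exact: measurable_abs_sub|exact: measurable_abs_sub].
  exact: leeD.
rewrite -EFinD -EFinM lee_fin le_eqVlt; apply/orP; left; apply/eqP.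
by field; rewrite gt_eqF.
Qed.

End mean_oscillation.

Section smooth_approximation.
Context {R : realType} {n : nat}.
Local Notation Rn := 'rV[R]_n.

Definition smooth_approximable (beta : Rn -> R) := forall e : R, 0 < e ->
  exists phi : Rn -> R, [/\ smooth phi,
    exists rho, forall x, rho < `|x| -> phi x = 0,
    exists M, forall x, `|phi x| <= M &
    forall a l, 0 < l -> osc_le (fun x => beta x - phi x) e a l].

Lemma smooth_measurable (phi : Rn -> R) : smooth phi -> measurable_fun setT phi.
Proof. by move=> /(_ [::])[c _]; exact: measurable_continuous. Qed.

(** The cut-off h inherits small oscillation on small cubes as the difference of beta and beta - h,
    so that it can be discretised. *)
Lemma vanishing_oscillation_approximable (beta : Rn -> R) : (0 < n)%N ->
  measurable_fun setT beta ->
  (forall e : R, 0 < e -> exists r rho : R, [/\ 0 < r, 0 < rho,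
    forall a (l : R), 0 < l -> l <= r -> osc_le beta e a l &
    forall a (l : R), 0 < l -> ~ cube a l `<=` sup_ball rho -> osc_le beta e a l]) ->
  smooth_approximable beta.
Proof.
move=> n0 mb vanish e e0.
(* [C1] is the loss of the cut-off, [C2] that of discretising h, whose oscillation on small cubes is
   at most (1 + C1) E. *)
pose C1 : R := 3 + 2 * 8 ^+ n; pose C2 : R := 2 ^+ n * (1 + (1 + 4 ^+ n)) * (1 + C1).
have C10 : 0 < C1 by rewrite ltr_wpDr// mulr_ge0// exprn_ge0.
have C20 : 0 < C2.
  apply: mulr_gt0; last exact: addr_gt0.
  by apply: mulr_gt0; rewrite ?exprn_gt0// !ltr_wpDr// addr_ge0// exprn_ge0.
pose E := e / (C1 + C2).
have E0 : 0 < E by apply: divr_gt0 => //; exact: addr_gt0.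
have [r [rho [r0 rho0 small far]]] := vanish E E0.
have [h [mh hout oh]] := cutoff n0 rho0 E0 mb far.
have mbh : measurable_fun setT (fun x => beta x - h x) by exact: measurable_funB.
have ohs a l : 0 < l -> l <= r -> osc_le h ((1 + C1) * E) a l.
  move=> l0 lr; have := osc_leD l0 mb _ (small a l l0 lr) (osc_leN (oh a l l0)).
  rewrite (_ : E + _ = (1 + C1) * E); last by rewrite -/C1; ring.
  rewrite (_ : (fun x => beta x + - (beta x - h x)) = h).
    by apply; exact: measurableT_comp mbh.
  by apply/funext => x; ring.
have R00 : 0 < 2 * (rho + 1) by rewrite mulr_gt0// addr_gt0.
have e'0 : 0 < (1 + C1) * E by rewrite mulr_gt0// addr_gt0.
have [phi [sphi pout pM op]] := discretize R00 r0 e'0 mh hout ohs.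
exists phi; split => // a l l0.
have mp := smooth_measurable sphi.
have := osc_leD l0 mbh _ (oh a l l0) (op a l l0).
rewrite (_ : (fun x => beta x - h x + (h x - phi x)) = (fun x => beta x - phi x)); last first.
  by apply/funext => x; ring.
rewrite (_ : _ * E + _ = e); first by apply; exact: measurable_funB.
rewrite -[3 + _]/C1; transitivity (E * (C1 + C2)); first by rewrite /C2; ring.
by rewrite divfK// gt_eqF// addr_gt0.
Qed.

(** Approximation within 1 already yields [BMO]: the approximant is bounded, so its oscillation and
    that of b are bounded. *)
Lemma CMO_approximable (b : Rn -> R[i]) : L1loc b ->
  smooth_approximable (fun x => complex.Re (b x)) ->
  smooth_approximable (fun x => complex.Im (b x)) -> CMO b.
Proof.
move=> hb aR aI; have [[mR mI] _] := hb.
have approx (e : R) : 0 < e -> exists phi : Rn -> R[i], [/\ Cc_infty phi,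
    exists M : R, forall x, `|complex.Re (phi x)| <= M /\ `|complex.Im (phi x)| <= M,
    forall a l, 0 < l -> osc_le (fun x => complex.Re (b x - phi x)) e a l &
    forall a l, 0 < l -> osc_le (fun x => complex.Im (b x - phi x)) e a l].
  move=> e0; have [f [sf [rf fout] [Mf fM] of_]] := aR e e0.
  have [g [sg [rg gout] [Mg gM] og]] := aI e e0.
  exists (fun x => (f x +i* g x)%C); split.
  - split=> //; pose r := `|rf| + `|rg|; have r0 : 0 <= r by rewrite addr_ge0.
    have cc : compact (sup_ball r : set Rn) by rewrite sup_ballE//; exact: compact_cube.
    apply: (subclosed_compact _ cc); first exact: closed_closure.
    have cl : closed (sup_ball r : set Rn) by apply: compact_closed cc; exact: norm_hausdorff.
    rewrite /csupport => x xF; apply: cl; move: x xF; apply: closure_subset => x /= Fx.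
    rewrite /sup_ball /= leNgt; apply: contra Fx => rx.
    rewrite fout ?gout//; apply: le_lt_trans rx.
      by rewrite (le_trans (ler_norm rg))// lerDr.
    by rewrite (le_trans (ler_norm rf))// lerDl.
  - exists (Num.max Mf Mg) => x; rewrite !le_max fM gM orbT//.
  - rewrite (_ : (fun x => complex.Re _) = (fun x => complex.Re (b x) - f x)) //.
    by apply/funext => x; rewrite ReD ReN.
  - rewrite (_ : (fun x => complex.Im _) = (fun x => complex.Im (b x) - g x)) //.
    by apply/funext => x; rewrite ImD ImN.
have mphi (phi : Rn -> R[i]) : Cc_infty phi -> cmeasurable phi.
  by move=> [s1 s2 _]; split; exact: smooth_measurable.
split; last first.
  (* [bmo_norm_le] multiplies by 4, which leaves e / 2 and hence a strict inequality. *)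
  move=> e e0; have e8 : 0 < e / 8 by rewrite divr_gt0.
  have [phi [cphi _ oR oI]] := approx _ e8; exists phi; split => //.
  have := bmo_norm_le (cmeasurableB (conj mR mI) (mphi _ cphi)) oR oI.
  by move=> H; apply: (le_lt_trans H); rewrite lte_fin; lra.
split=> //; have [phi [cphi [M pM] oR oI]] := approx 1 ltr01.
have mb' := cmeasurableB (conj mR mI) (mphi _ cphi).
have op (u : Rn -> R) a l : 0 < l -> measurable_fun setT u -> (forall x, `|u x| <= M) -> osc_le u M a l.
  move=> l0 mu uM; have mc := measurable_cube a l; exists 0; rewrite /osc_at.
  apply: (@le_trans _ _ (\int[Leb n]_(x in cube a l) M%:E)%E).
    apply: ge0_le_integral => //; first exact: measurable_abs_sub.
    by move=> x _; rewrite subr0 lee_fin.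
  have L : (Leb n (cube a l) = (l ^+ n)%:E)%E by rewrite Leb_cube ?(ltW l0).
  by rewrite integral_cst// EFinM; move: L => /= ->.
have [mpR mpI] := mphi _ cphi.
have H : (bmo_norm b <= (4 * (1 + M))%:E)%E.
  apply: bmo_norm_le; first by split.
  - move=> a l l0; have := osc_leD l0 mb'.1 mpR (oR a l l0) (op _ a l l0 mpR (fun x => (pM x).1)).
    rewrite (_ : (fun x => _ + _) = (fun x => complex.Re (b x)))//.
    by apply/funext => x; rewrite ReD ReN subrK.
  - move=> a l l0; have := osc_leD l0 mb'.2 mpI (oI a l l0) (op _ a l l0 mpI (fun x => (pM x).2)).
    rewrite (_ : (fun x => _ + _) = (fun x => complex.Im (b x)))//.
    by apply/funext => x; rewrite ImD ImN subrK.
exact: (le_lt_trans H (ltry _)).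
Qed.

End smooth_approximation.

(** * From a compact commutator to membership in CMO *)

Section component_approximable.
Context {R : realType} {n : nat}.
Local Notation Rn := 'rV[R]_n.
Variables (p q alpha : R) (m : nat) (w Omega : Rn -> R) (b : Rn -> R[i]).
Hypotheses (p1 : 1 < p) (q1 : 1 < q) (halpha0 : 0 <= alpha) (halphan : alpha < n%:R).
Hypotheses (hpq : q^-1 = p^-1 - alpha / n%:R) (hm : (0 < m)%N).
Hypothesis hw : Apq p q w.
Hypothesis mO : measurable_fun (sphere n) Omega.
Hypothesis bO : bounded_on_sphere Omega.
Hypothesis hO : homogeneous0 Omega.
Hypothesis sO : constant_sign_on_open Omega.
Hypothesis hb : L1loc b.
Hypothesis hT : iter_commutator_compact p q w m b (T_op Omega alpha).

(** A cube that is not oscillating has some constant M with deviation at most e. Thus [small_cubes]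
    and [far_cubes] supply the two conditions of [vanishing_oscillation_approximable]. *)
Lemma component_approximable (beta : Rn -> R) (pi : R[i] -> R) :
  component m b beta pi -> smooth_approximable beta.
Proof.
move=> cb; have [S [cS hS]] := hT.
have n0 : (0 < n)%N by rewrite -(ltr0n R); exact: le_lt_trans halphan.
have [[[mw _] _] w0 _] := hw.1.
apply: vanishing_oscillation_approximable => //; first exact: component_measurable cb.
move=> e e0.
have [v test] := oscillation_test p1 q1 halpha0 halphan hpq hm hw mO bO hO sO hb cS hS cb.
have [c c0 testc] := test e e0.
have T a l (o : oscillating beta e (a, l)) := testc a l o.1 o.2.
have [r r0 small] := small_cubes n0 p1 q1 mw w0 cS c0 T.
have [rho rho0 far] := far_cubes n0 p1 q1 mw w0 cS c0 T.
have osc a l : 0 < l -> ~ oscillating beta e (a, l) -> osc_le beta e a l.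
  move=> l0 h; apply: contrapT => /forallNP hM; apply: h; split => // M.
  by rewrite ltNge; apply/negP; exact: hM.
exists r, rho; split => // a l l0 h; apply: osc => //.
  exact: small.
by move=> /far.
Qed.

End component_approximable.

Theorem theorem1p4 (R : realType) (n : nat) (p q alpha : R) (m : nat)
    (w : 'rV[R]_n -> R) (Omega : 'rV[R]_n -> R) (b : 'rV[R]_n -> R[i])
    (hp : 1 < p) (hq : 1 < q) (halpha0 : 0 <= alpha) (halphan : alpha < n%:R)
    (hpq : q^-1 = p^-1 - alpha / n%:R) (hm : (0 < m)%N)
    (hw : Apq p q w)
    (hOmega_meas : measurable_fun (sphere n) Omega)
    (hOmega_bnd : bounded_on_sphere Omega)
    (hOmega_hom : homogeneous0 Omega)
    (hOmega_mean : alpha = 0 ->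
      \int[surface_measure n]_(x in sphere n) Omega x = 0)
    (hOmega_sign : constant_sign_on_open Omega)
    (hb : L1loc b)
    (hb_real : (2 <= m)%N -> forall x, complex.Im (b x) = 0)
    (hT : iter_commutator_compact p q w m b (T_op Omega alpha)) :
  CMO b.
Proof.
have mb : cmeasurable b by case: hb.
have approx := component_approximable hp hq halpha0 halphan hpq hm hw hOmega_meas
  hOmega_bnd hOmega_hom hOmega_sign hb hT.
have [m1|m2] : (m = 1)%N \/ (2 <= m)%N by case: m hm {hb_real hT approx} => [|[|k]] //; [left|right].
  apply: CMO_approximable => //.
    by apply: approx; apply: component_Re => //; left.
  by apply: approx; exact: component_Im.
apply: CMO_approximable => //.
  by apply: approx; apply: component_Re => //; right; exact: hb_real.
(* For m >= 2 the imaginary part of b is 0 and is its own approximant. *)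
move=> e e0; exists (cst 0); split.
- move=> s; suff -> : iter_partial s (cst 0 : 'rV[R]_n -> R) = cst 0.
    by split=> [|i x]; [exact: cst_continuous|exact: derivable_cst].
  elim: s => //= i s ->; apply/funext => x; exact: derive_cst.
- by exists 0.
- by exists 0 => x; rewrite normr0.
- move=> a l l0; exists 0; rewrite /osc_at.
  under eq_integral do rewrite hb_real// !subr0 normr0.
  by rewrite integral0 lee_fin mulr_ge0 ?exprn_ge0// ltW.
Qed.
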